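(* Let $(E_n)_{n\in\mathbb N}$ be a sequence of nonzero finite dimensional Banach spaces. Assume that for some sequence of exponents $1\le p_n<2$ with $p_n\to2$ the following conditions are satisfied: (a) for every $n$ and every $x,y\in E_n$, $$\|x+y\|_{E_n}^2+\|x-y\|_{E_n}^2\ \le\ 2\big(\|x\|_{E_n}^{p_n}+\|y\|_{E_n}^{p_n}\big)^{2/p_n};$$ (b) for every $n$ there exists a basis $\mathcal B_n$ of $E_n$ such that for every $y\in\mathcal B_n$ there is $x\in\mathcal B_n$ such that $(x,y)$ is an $\ell_{p_n}$-pair, that is, $\|x+\lambda y\|_{E_n}^{p_n}=1+|\lambda|^{p_n}$ for every $\lambda\in\mathbb R$. Let $E=\big(\bigoplus_nE_n\big)_{\ell_2}$. Then every ultrapower of $E$ is linearly isometric to $E\oplus_2H$ for some Hilbert space $H$; for every Hilbert space $H$, every linear isometric operator $T:E\to E\oplus_2H$ satisfies $T(E)=E$; and the Banach space $E$ is uncountably categorical.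
   Context: Banach spaces are over $\mathbb K\in\{\mathbb R,\mathbb C\}$. Hilbert spaces may have any dimension (including finite or $0$). $\big(\bigoplus_nE_n\big)_{\ell_2}$ is the space of sequences $x=(x_n)$, $x_n\in E_n$, with $\|x\|^2=\sum_n\|x_n\|_{E_n}^2<\infty$. $X\oplus_2Y$ is the direct sum with norm $\|x+y\|^2=\|x\|^2+\|y\|^2$; $X$ and $Y$ are identified with subspaces of it. Ultrapowers are Banach space ultrapowers $X_{\mathcal U}=\ell_\infty(I,X)/\{(x_i):\lim_{i,\mathcal U}\|x_i\|=0\}$, $\mathcal U$ an ultrafilter on a set $I$. Banach spaces $X,Y$ are elementarily equivalent if there are ultrafilters $\mathcal U,\mathcal V$ such that $X_{\mathcal U}$ and $Y_{\mathcal V}$ are linearly isometric (this is an equivalence relation). The elementary class of $X$ is the class of all Banach spaces elementarily equivalent to $X$. An infinite dimensional Banach space is uncountably categorical if for some uncountable cardinal $\kappa$ its elementary class contains, up to linear isometry, exactly one space of density character $\kappa$. *)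

(* Defs.v *)
Set Warnings "-notation-overridden,-ambiguous-paths,-notation-incompatible-prefix,-redundant-canonical-projection,-projection-no-head-constant".
From HB Require Import structures.
From mathcomp Require Import all_boot all_order all_algebra.
From mathcomp Require Import ring_quotient.
From mathcomp Require Import complex.
From mathcomp Require Import all_classical reals topology normedtype.
From mathcomp Require Import sequences exp.
From mathcomp Require Import ring lra.

Set Implicit Arguments.
Unset Strict Implicit.
Unset Printing Implicit Defensive.

Import Order.TTheory GRing.Theory Num.Theory.
Import numFieldNormedType.Exports.

Local Open Scope classical_set_scope.
Local Open Scope ring_scope.

(* Banach spaces over K in {R, C} are the objects of
   completeNormedModType (scalars R k). *)
Variant scalar_kind := RealScalars | ComplexScalars.

Definition scalars (R : realType) (k : scalar_kind) : numFieldType :=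
  match k with
  | RealScalars => (R : numFieldType)
  | ComplexScalars => (R[i] : numFieldType)
  end.

Section Scalars.
Variables (R : realType) (k : scalar_kind).
Local Notation K := (scalars R k).

Definition of_real : R -> K :=
  match k return R -> scalars R k with
  | RealScalars => fun x => x
  | ComplexScalars => fun x => (x%:C)%C
  end.

Definition real_part : K -> R :=
  match k return scalars R k -> R with
  | RealScalars => fun x => x
  | ComplexScalars => @complex.Re R
  end.

Definition conj_scalar : K -> K :=
  match k return scalars R k -> scalars R k with
  | RealScalars => fun x => x
  | ComplexScalars => @conjc R
  end.

Lemma of_realK : cancel of_real real_part.
Proof. by rewrite /of_real /real_part; case: k. Qed.

Lemma of_realD : {morph of_real : x y / x + y}.
Proof.
rewrite /of_real /scalars; case: k => x y //=; exact: rmorphD.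
Qed.

Lemma of_realM : {morph of_real : x y / x * y}.
Proof.
rewrite /of_real /scalars; case: k => x y //=; exact: rmorphM.
Qed.

Lemma of_real0 : of_real 0 = 0.
Proof. by rewrite /of_real /scalars; case: k. Qed.

Lemma of_real1 : of_real 1 = 1.
Proof. by rewrite /of_real /scalars; case: k. Qed.

Lemma ler_of_real : {mono of_real : x y / x <= y}.
Proof.
rewrite /of_real /scalars; case: k => x y //=; exact: lecR.
Qed.

Lemma ltr_of_real : {mono of_real : x y / x < y}.
Proof.
rewrite /of_real /scalars; case: k => x y //=; exact: ltcR.
Qed.

Lemma ge0_of_real (z : K) : 0 <= z -> of_real (real_part z) = z.
Proof.
rewrite /of_real /real_part /scalars in z *; case: k z => //= -[a b].
by rewrite lecE /= => /andP[/eqP-> _].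
Qed.

Lemma norm_of_real (r : R) : `|of_real r| = of_real `|r|.
Proof.
rewrite /of_real /scalars; case: k => //=.
by rewrite normc_def /= expr0n /= addr0 sqrtr_sqr.
Qed.

End Scalars.

Section RealNorm.
Variables (R : realType) (k : scalar_kind).
Local Notation K := (scalars R k).

(* Norms in a normedModType K take values in K; nrm is the same norm, read in
   the real numbers. *)
Definition nrm (X : normedZmodType K) (x : X) : R := real_part `|x|.

Lemma nrmE (X : normedZmodType K) (x : X) : of_real k (nrm x) = `|x|.
Proof. exact: ge0_of_real. Qed.

Lemma nrm_ge0 (X : normedZmodType K) (x : X) : 0 <= nrm x.
Proof. by rewrite -(@ler_of_real R k) of_real0 nrmE. Qed.

Lemma ler_nrmD (X : normedZmodType K) (x y : X) : nrm (x + y) <= nrm x + nrm y.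
Proof. by rewrite -(@ler_of_real R k) of_realD !nrmE ler_normD. Qed.

Lemma nrm0 (X : normedZmodType K) : nrm (0 : X) = 0.
Proof. by apply: (can_inj (@of_realK R k)); rewrite nrmE normr0 of_real0. Qed.

Lemma nrm0_eq0 (X : normedZmodType K) (x : X) : nrm x = 0 -> x = 0.
Proof.
by move=> h; apply/normr0_eq0; rewrite -nrmE h of_real0.
Qed.

Lemma nrmN (X : normedZmodType K) (x : X) : nrm (- x) = nrm x.
Proof. by rewrite /nrm normrN. Qed.

Lemma nrmBC (X : normedZmodType K) (x y : X) : nrm (x - y) = nrm (y - x).
Proof. by rewrite /nrm distrC. Qed.

Lemma nrmZ (X : normedModType K) (a : K) (x : X) :
  nrm (a *: x) = nrm a * nrm x.
Proof.
by apply: (can_inj (@of_realK R k)); rewrite of_realM !nrmE normrZ.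
Qed.

Lemma nrmM (a b : K) : nrm (a * b) = nrm a * nrm b.
Proof.
by apply: (can_inj (@of_realK R k)); rewrite of_realM !nrmE normrM.
Qed.

Lemma nrm1 : nrm (1 : K) = 1.
Proof. by rewrite /nrm normr1 -(of_real1 R k) of_realK. Qed.

Lemma real_part_gt0 (e : K) : 0 < e -> 0 < real_part e.
Proof. by move=> e0; rewrite -(@ltr_of_real R k) of_real0 ge0_of_real ?ltW. Qed.

End RealNorm.

Lemma half_exp_gt0 (R : realType) n : 0 < (2^-1 : R) ^+ n.
Proof. by rewrite exprn_gt0 // invr_gt0 ltr0n. Qed.

Lemma half_exp_small (R : realType) (C e : R) : 0 < e ->
  exists N, forall n, (N <= n)%N -> C * 2^-1 ^+ n < e.
Proof.
move=> e0; have h : C * 2^-1 ^+ n @[n --> \oo] --> (0 : R).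
  rewrite -(mulr0 C); apply: cvgMl_tmp; apply: cvg_expr.
  by rewrite ger0_norm; lra.
have /cvgrPdist_lt/(_ e e0) [N _ hN] := h.
exists N => n /hN /=; rewrite sub0r normrN => /le_lt_trans; apply.
exact: ler_norm.
Qed.

Section CompleteFromFastCauchy.
Variables (R : realType) (k : scalar_kind).
Local Notation K := (scalars R k).

(* Completeness with respect to a real-valued norm, tested on sequences with
   geometrically small increments; see fast_complete_cvg. *)
Definition fast_complete (V : zmodType) (N : V -> R) :=
  forall u : nat -> V,
    (forall n i, (n <= i)%N -> N (u n - u i) <= 2^-1 ^+ n) ->
  exists l C, forall n, N (u n - l) <= C * 2^-1 ^+ n.

Lemma fast_complete_cvg (V : normedModType K) :
  fast_complete (@nrm R k V) ->
  forall F : set_system V, ProperFilter F -> cauchy F -> cvg F.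
Proof.
move=> hV F FF /cauchyP Fc.
have r0 n : 0 < of_real k (2^-1 ^+ n.+1 : R).
  by rewrite -(of_real0 R k) ltr_of_real half_exp_gt0.
have /choice[u hu] : forall n, exists x, F (ball x (of_real k (2^-1 ^+ n.+1 : R))).
  by move=> n; exact: Fc.
have ballE (x y : V) n : ball x (of_real k (2^-1 ^+ n.+1 : R)) y ->
    nrm (x - y) < 2^-1 ^+ n.+1.
  by rewrite -ball_normE /ball_/= -nrmE ltr_of_real.
have [l [C hl]] : exists l C, forall n, nrm (u n - l) <= C * 2^-1 ^+ n.
  apply: hV => n i ni.
  have /filter_ex[z [/ballE h1 /ballE h2]] :
      F (ball (u n) (of_real k (2^-1 ^+ n.+1 : R)) `&`
         ball (u i) (of_real k (2^-1 ^+ i.+1 : R))) by apply: filterI.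
  have := ler_nrmD (u n - z) (z - u i); rewrite addrA subrK (nrmBC z).
  have hi : 2^-1 ^+ i.+1 <= 2^-1 ^+ n.+1 :> R by apply: ler_wiXn2l => //; lra.
  move: h1 h2 hi; rewrite !exprS; lra.
apply/cvg_ex; exists l; apply/cvgrPdist_lt => e e0.
have re0 := real_part_gt0 e0.
have [n hn] := half_exp_small (C + 1) re0.
have {}hn := hn n (leqnn n).
apply: filterS _ (hu n) => y /ballE hy /=.
rewrite -[ltRHS](ge0_of_real (ltW e0)) -nrmE ltr_of_real; apply: le_lt_trans hn.
rewrite (_ : l - y = (l - u n) + (u n - y)); last by rewrite addrA subrK.
rewrite (le_trans (ler_nrmD _ _)) // mulrDl mul1r lerD //; first by rewrite nrmBC.
apply: (le_trans (ltW hy)); rewrite exprS ler_piMl // ?ltW ?half_exp_gt0 //.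
lra.
Qed.

Lemma banach_fast_complete (X : completeNormedModType K) (u : nat -> X) (C : R) :
  (forall n i, (n <= i)%N -> nrm (u n - u i) <= C * 2^-1 ^+ n) ->
  exists l, forall n, nrm (u n - l) <= C * 2^-1 ^+ n.
Proof.
move=> hu; have uc : cvg (u n @[n --> \oo]).
  apply: cauchy_cvg; apply/cauchyP => e e0.
  have [n hn] := half_exp_small C (real_part_gt0 e0).
  exists (u n); exists n => // i /= ni.
  rewrite -ball_normE /ball_ /= -nrmE -[ltRHS](ge0_of_real (ltW e0)) ltr_of_real.
  by rewrite (le_lt_trans (hu _ _ ni)) // hn.
exists (lim (u n @[n --> \oo])) => n.
apply/ler_addgt0Pr => e e0.
have e0' : 0 < of_real k e by rewrite -(of_real0 R k) ltr_of_real.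
have /cvgrPdist_lt/(_ _ e0') [m _ hm] := uc.
have := hm (maxn m n) (leq_maxl _ _); rewrite -nrmE ltr_of_real => h1.
have h2 := hu n _ (leq_maxr m n).
set l := lim _ in h1 *.
rewrite (_ : u n - l = (u n - u (maxn m n)) + (u (maxn m n) - l)); last first.
  by rewrite addrA subrK.
by rewrite (le_trans (ler_nrmD _ _)) // lerD // nrmBC ltW.
Qed.

End CompleteFromFastCauchy.

Section BanachOf.
Variables (R : realType) (k : scalar_kind).
Local Notation K := (scalars R k).

Record banach_norm (V : lmodType K) (N : V -> R) : Prop := BanachNorm {
  bn_ge0 : forall x, 0 <= N x;
  bn_triangle : forall x y, N (x + y) <= N x + N y;
  bn_scale : forall a x, N (a *: x) <= nrm a * N x;
  bn_eq0 : forall x, N x = 0 -> x = 0;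
  bn_complete : fast_complete N }.

(* The Banach space with underlying module V and norm N (nrm_banach_of). *)
Definition banach_of (V : lmodType K) (N : V -> R) (h : banach_norm N) : Type := V.

Section Instances.
Variables (V : lmodType K) (N : V -> R) (h : banach_norm N).
Local Notation B := (banach_of h).

HB.instance Definition _ := GRing.Lmodule.on B.

Let norm (x : B) : K := of_real k (N x).

Let normD x y : norm (x + y) <= norm x + norm y.
Proof. by rewrite /norm -of_realD ler_of_real; exact: (bn_triangle h). Qed.

Let normZ a x : norm (a *: x) = `|a| * norm x.
Proof.
rewrite /norm -nrmE -of_realM; congr of_real; apply: le_anti.
rewrite (bn_scale h) /=; have [->|a0] := eqVneq a 0.
  by rewrite nrm0 mul0r (bn_ge0 h).
have {1}-> : x = a^-1 *: (a *: x) by rewrite scalerA mulVf // scale1r.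
rewrite (le_trans (ler_wpM2l (nrm_ge0 _) (bn_scale h _ _))) //.
by rewrite mulrA -nrmM mulfV // nrm1 mul1r.
Qed.

Let norm_eq0 x : norm x = 0 -> x = 0.
Proof.
move=> h0; apply: (bn_eq0 h); apply: (can_inj (@of_realK R k)).
by rewrite of_real0.
Qed.

HB.instance Definition _ := @Lmodule_isNormed.Build K B norm normD normZ norm_eq0.

Lemma nrm_banach_of (x : B) : nrm x = N x.
Proof. exact: of_realK. Qed.

Let complete (F : set_system B) : ProperFilter F -> cauchy F -> cvg F.
Proof.
apply: fast_complete_cvg => u hu.
have [n i ni|l [C hl]] := @bn_complete _ _ h u.
  by rewrite -nrm_banach_of hu.
by exists l, C => n; rewrite nrm_banach_of hl.
Qed.

HB.instance Definition _ := Uniform_isComplete.Build B complete.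

End Instances.

End BanachOf.

Lemma minkowski2 (R : realType) (a b c d s t : R) : 0 <= s -> 0 <= t ->
  a ^+ 2 + b ^+ 2 <= s ^+ 2 -> c ^+ 2 + d ^+ 2 <= t ^+ 2 ->
  (a + c) ^+ 2 + (b + d) ^+ 2 <= (s + t) ^+ 2.
Proof.
move=> s0 t0 hs ht.
have h : a * c + b * d <= s * t.
  have [h0|h0] := leP (a * c + b * d) 0; first by rewrite (le_trans h0) ?mulr_ge0.
  have p0 := ltW h0; rewrite -ler_sqr ?nnegrE ?mulr_ge0 //.
  have h1 : (a * c + b * d) ^+ 2 <= (a ^+ 2 + b ^+ 2) * (c ^+ 2 + d ^+ 2).
    rewrite -subr_ge0.
    have -> : (a ^+ 2 + b ^+ 2) * (c ^+ 2 + d ^+ 2) - (a * c + b * d) ^+ 2 =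
              (a * d - b * c) ^+ 2 by ring.
    exact: sqr_ge0.
  by rewrite (le_trans h1) // exprMn ler_pM ?addr_ge0 ?sqr_ge0.
by rewrite !sqrrD; lra.
Qed.

Section L2Prod.
Variables (R : realType) (k : scalar_kind).
Local Notation K := (scalars R k).
Variables X Y : completeNormedModType K.

Definition l2prod_norm (z : X * Y) : R :=
  Num.sqrt (nrm z.1 ^+ 2 + nrm z.2 ^+ 2).

Lemma sqr_l2prod_norm z : l2prod_norm z ^+ 2 = nrm z.1 ^+ 2 + nrm z.2 ^+ 2.
Proof. by rewrite sqr_sqrtr // addr_ge0 ?sqr_ge0. Qed.

Lemma l2prod_norm_le z C : 0 <= C ->
  nrm z.1 ^+ 2 + nrm z.2 ^+ 2 <= C ^+ 2 -> l2prod_norm z <= C.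
Proof.
by move=> C0; rewrite -sqr_l2prod_norm ler_sqr ?nnegrE ?sqrtr_ge0.
Qed.

Lemma nrm_fst_le z : nrm z.1 <= l2prod_norm z.
Proof.
rewrite -ler_sqr ?nnegrE ?sqrtr_ge0 ?nrm_ge0 // sqr_l2prod_norm.
by rewrite lerDl sqr_ge0.
Qed.

Lemma nrm_snd_le z : nrm z.2 <= l2prod_norm z.
Proof.
rewrite -ler_sqr ?nnegrE ?sqrtr_ge0 ?nrm_ge0 // sqr_l2prod_norm.
by rewrite lerDr sqr_ge0.
Qed.

Lemma l2prod_banach_norm : @banach_norm R k (X * Y)%type l2prod_norm.
Proof.
split=> [z|z w|a z|z z0|u hu].
- exact: sqrtr_ge0.
- apply: l2prod_norm_le; first by rewrite addr_ge0 ?sqrtr_ge0.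
  apply: (@le_trans _ _ ((nrm z.1 + nrm w.1) ^+ 2 + (nrm z.2 + nrm w.2) ^+ 2)).
    by rewrite lerD // ler_sqr ?nnegrE ?addr_ge0 ?nrm_ge0 // ler_nrmD.
  by apply: minkowski2; rewrite ?sqrtr_ge0 // sqr_l2prod_norm.
- apply: l2prod_norm_le; first by rewrite mulr_ge0 ?sqrtr_ge0 ?nrm_ge0.
  by rewrite exprMn sqr_l2prod_norm /= !nrmZ !exprMn mulrDr.
- have h1 := nrm_fst_le z; have h2 := nrm_snd_le z; rewrite z0 in h1 h2.
  rewrite (surjective_pairing z); congr pair; apply: nrm0_eq0; apply: le_anti.
    by rewrite h1 nrm_ge0.
  by rewrite h2 nrm_ge0.
- have [l1 h1] : exists l, forall n, nrm ((u n).1 - l) <= 1 * 2^-1 ^+ n.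
    apply: banach_fast_complete => n i ni; rewrite mul1r.
    exact: le_trans (nrm_fst_le (u n - u i)) (hu _ _ ni).
  have [l2 h2] : exists l, forall n, nrm ((u n).2 - l) <= 1 * 2^-1 ^+ n.
    apply: banach_fast_complete => n i ni; rewrite mul1r.
    exact: le_trans (nrm_snd_le (u n - u i)) (hu _ _ ni).
  exists (l1, l2), 2 => n; have e0 := half_exp_gt0 R n.
  apply: l2prod_norm_le; first by rewrite mulr_ge0 // ltW.
  move: (h1 n) (h2 n); rewrite !mul1r => {}h1 {}h2 /=.
  have := lerXn2r 2 (nrm_ge0 _) (ltW e0) h1.
  have := lerXn2r 2 (nrm_ge0 _) (ltW e0) h2.
  have := sqr_ge0 ((2^-1 : R) ^+ n); rewrite exprMn; lra.
Qed.

Definition l2prod : completeNormedModType K := banach_of l2prod_banach_norm.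

(* The identification of X with a subspace of the direct sum. *)
Definition l2inl : X -> l2prod := fun x => (x, 0).

Lemma nrm_l2prod (z : l2prod) :
  nrm z = Num.sqrt (nrm (z : X * Y).1 ^+ 2 + nrm (z : X * Y).2 ^+ 2).
Proof. exact: nrm_banach_of. Qed.

End L2Prod.

Arguments l2inl {R k} X Y x.

Section L2Sum.
Variables (R : realType) (k : scalar_kind).
Local Notation K := (scalars R k).
Variable E : nat -> completeNormedModType K.

(* All sequences x with x n in E n, with pointwise operations. *)
Definition seqs : Type := forall n, E n.

HB.instance Definition _ := gen_eqMixin seqs.
HB.instance Definition _ := gen_choiceMixin seqs.

Let addsA : associative (fun x y : seqs => (fun n => x n + y n) : seqs).
Proof. by move=> x y z; apply: functional_extensionality_dep => n; rewrite addrA. Qed.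
Let addsC : commutative (fun x y : seqs => (fun n => x n + y n) : seqs).
Proof. by move=> x y; apply: functional_extensionality_dep => n; rewrite addrC. Qed.
Let add0s : left_id ((fun=> 0) : seqs) (fun x y : seqs => (fun n => x n + y n) : seqs).
Proof. by move=> x; apply: functional_extensionality_dep => n; rewrite add0r. Qed.
Let addNs : left_inverse ((fun=> 0) : seqs) (fun x : seqs => (fun n => - x n) : seqs)
   (fun x y : seqs => (fun n => x n + y n) : seqs).
Proof. by move=> x; apply: functional_extensionality_dep => n; rewrite addNr. Qed.

HB.instance Definition _ := GRing.isZmodule.Build seqs addsA addsC add0s addNs.

Let scale (a : K) (x : seqs) : seqs := fun n => a *: x n.
Let scalesA a b x : scale a (scale b x) = scale (a * b) x.
Proof. by apply: functional_extensionality_dep => n; rewrite /scale scalerA. Qed.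
Let scale1s : left_id 1 scale.
Proof. by move=> x; apply: functional_extensionality_dep => n; rewrite /scale scale1r. Qed.
Let scalesDr : right_distributive scale +%R.
Proof. by move=> a x y; apply: functional_extensionality_dep => n; rewrite /scale scalerDr. Qed.
Let scalesDl x : {morph scale^~ x : a b / a + b}.
Proof. by move=> a b; apply: functional_extensionality_dep => n; rewrite /scale scalerDl. Qed.

HB.instance Definition _ :=
  GRing.Zmodule_isLmodule.Build K seqs scalesA scale1s scalesDr scalesDl.

Definition sqnorms (x : seqs) : nat -> R := fun n => nrm (x n) ^+ 2.

Definition square_summable : {pred seqs} :=
  fun x => `[< cvgn (series (sqnorms x)) >].

Lemma sqnorms_ge0 x n : 0 <= sqnorms x n.
Proof. exact: sqr_ge0. Qed.

Lemma nondecreasing_sqnorms x : nondecreasing_seq (series (sqnorms x)).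
Proof. by apply: nondecreasing_series => n _ _; exact: sqnorms_ge0. Qed.

Lemma series_sqnorms_ge0 x n : 0 <= series (sqnorms x) n.
Proof. by apply: sumr_ge0 => *; exact: sqnorms_ge0. Qed.

Lemma seriesSqS x n :
  series (sqnorms x) n.+1 = series (sqnorms x) n + nrm (x n) ^+ 2.
Proof. by rewrite /series /= big_nat_recr. Qed.

Lemma square_summableP x C :
  (forall n, series (sqnorms x) n <= C) -> x \in square_summable.
Proof.
move=> h; apply/asboolP; apply: nondecreasing_is_cvgn.
  exact: nondecreasing_sqnorms.
by exists C => _ [n _ <-].
Qed.

Lemma minkowski_sqnorms x y n s t : 0 <= s -> 0 <= t ->
  series (sqnorms x) n <= s ^+ 2 -> series (sqnorms y) n <= t ^+ 2 ->
  series (sqnorms (x + y)) n <= (s + t) ^+ 2.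
Proof.
elim: n s t => [|n IH] s t s0 t0.
  by rewrite /series /= !big_geq // => _ _; exact: sqr_ge0.
rewrite !seriesSqS => hs ht.
have := IH _ _ (sqrtr_ge0 (series (sqnorms x) n)) (sqrtr_ge0 (series (sqnorms y) n)).
rewrite !sqr_sqrtr ?series_sqnorms_ge0 // => /(_ (lexx _) (lexx _)) h.
apply: (@le_trans _ _ ((Num.sqrt (series (sqnorms x) n) +
  Num.sqrt (series (sqnorms y) n)) ^+ 2 + (nrm (x n) + nrm (y n)) ^+ 2)).
  by rewrite lerD // ler_sqr ?nnegrE ?addr_ge0 ?nrm_ge0 // ler_nrmD.
by apply: minkowski2; rewrite // sqr_sqrtr ?series_sqnorms_ge0.
Qed.

Lemma series_sqnormsZ a x n :
  series (sqnorms (a *: x)) n = nrm a ^+ 2 * series (sqnorms x) n.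
Proof.
rewrite /series /= mulr_sumr; apply: eq_bigr => i _.
by rewrite /sqnorms nrmZ exprMn.
Qed.

Lemma square_summable_bound x : x \in square_summable ->
  forall n, series (sqnorms x) n <= limn (series (sqnorms x)).
Proof.
move/asboolP => h n; apply: nondecreasing_cvgn_le => //.
exact: nondecreasing_sqnorms.
Qed.

Lemma square_summable_closed : submod_closed square_summable.
Proof.
split=> [|a x y hx hy].
  apply: (@square_summableP _ 0) => n; rewrite /series /= big1 // => i _.
  by rewrite /sqnorms nrm0 expr0n.
pose s := nrm a * Num.sqrt (limn (series (sqnorms x))).
pose t := Num.sqrt (limn (series (sqnorms y))).
have l0 z : z \in square_summable -> 0 <= limn (series (sqnorms z)).
  move=> hz; apply: le_trans (square_summable_bound hz 0).
  exact: series_sqnorms_ge0.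
apply: (@square_summableP _ ((s + t) ^+ 2)) => n.
apply: minkowski_sqnorms; rewrite ?mulr_ge0 ?nrm_ge0 ?sqrtr_ge0 //.
  by rewrite series_sqnormsZ exprMn sqr_sqrtr ?l0 // ler_wpM2l ?sqr_ge0 //
     square_summable_bound.
by rewrite sqr_sqrtr ?l0 // square_summable_bound.
Qed.

HB.instance Definition _ :=
  GRing.isSubmodClosed.Build K seqs square_summable square_summable_closed.

Record l2seqs := L2Seqs { l2val :> seqs ; l2valP : l2val \in square_summable }.

HB.instance Definition _ := [isSub for l2val].
HB.instance Definition _ := [Choice of l2seqs by <:].
HB.instance Definition _ := [SubChoice_isSubLmodule of l2seqs by <:].

Definition l2norm (x : l2seqs) : R := Num.sqrt (limn (series (sqnorms x))).

Lemma sqr_l2norm x : l2norm x ^+ 2 = limn (series (sqnorms x)).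
Proof.
rewrite sqr_sqrtr // (le_trans _ (square_summable_bound (l2valP x) 0)) //.
exact: series_sqnorms_ge0.
Qed.

Lemma series_le_l2norm (x : l2seqs) n : series (sqnorms x) n <= l2norm x ^+ 2.
Proof. by rewrite sqr_l2norm; exact/square_summable_bound/l2valP. Qed.

Lemma l2norm_le (x : l2seqs) C : 0 <= C ->
  (forall n, series (sqnorms x) n <= C ^+ 2) -> l2norm x <= C.
Proof.
move=> C0 h; rewrite -ler_sqr ?nnegrE ?sqrtr_ge0 // sqr_l2norm.
apply: limr_le; first exact/asboolP/l2valP.
by apply: nearW.
Qed.

Lemma coord_le_l2norm (x : l2seqs) n : nrm (l2val x n) <= l2norm x.
Proof.
rewrite -ler_sqr ?nnegrE ?sqrtr_ge0 ?nrm_ge0 //.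
apply: le_trans (series_le_l2norm x n.+1).
by rewrite seriesSqS lerDr series_sqnorms_ge0.
Qed.

Lemma l2_banach_norm : @banach_norm R k l2seqs l2norm.
Proof.
split=> [x|x y|a x|x x0|u hu].
- exact: sqrtr_ge0.
- apply: l2norm_le => [|n]; first by rewrite addr_ge0 ?sqrtr_ge0.
  by apply: minkowski_sqnorms; rewrite ?sqrtr_ge0 // series_le_l2norm.
- apply: l2norm_le => [|n]; first by rewrite mulr_ge0 ?sqrtr_ge0 ?nrm_ge0.
  by rewrite series_sqnormsZ exprMn ler_wpM2l ?sqr_ge0 // series_le_l2norm.
- apply/val_inj/functional_extensionality_dep => n; apply: nrm0_eq0.
  by apply: le_anti; rewrite nrm_ge0 -x0 coord_le_l2norm.
- have lex m : exists l : E m, forall n, nrm (l2val (u n) m - l) <= 1 * 2^-1 ^+ n.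
    apply: (@banach_fast_complete _ _ _ (fun n => l2val (u n) m)) => n i ni.
    by rewrite mul1r; exact: le_trans (coord_le_l2norm (u n - u i) m) (hu _ _ ni).
  pose l : seqs := fun m => sval (cid (lex m)).
  have hl m n : nrm (l2val (u n) m - l m) <= 2^-1 ^+ n.
    by rewrite -[leRHS]mul1r; exact: (svalP (cid (lex m))).
  have e0 n := half_exp_gt0 R n.
  have hS n M : series (sqnorms (l2val (u n) - l)) M <= (2^-1 ^+ n) ^+ 2.
    rewrite -[leLHS]sqr_sqrtr ?series_sqnorms_ge0 // ler_sqr ?nnegrE ?sqrtr_ge0 //;
      last exact: ltW.
    apply/ler_addgt0Pr => e ee0.
    have [N hN] := half_exp_small M%:R ee0.
    pose i := maxn n N.
    rewrite -ler_sqr ?nnegrE ?sqrtr_ge0 ?addr_ge0 ?(ltW (e0 n)) ?(ltW ee0) //.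
    rewrite sqr_sqrtr ?series_sqnorms_ge0 //.
    rewrite (_ : l2val (u n) - l =
      l2val (u n - u i) + (l2val (u i) - l)); last first.
      by rewrite [l2val (u n - u i)]/= addrA subrK.
    apply: minkowski_sqnorms; rewrite ?(ltW (e0 n)) ?(ltW ee0) //.
      apply: le_trans (series_le_l2norm _ _) _.
      by rewrite ler_sqr ?nnegrE ?sqrtr_ge0 ?(ltW (e0 n)) // hu // leq_maxl.
    apply: (@le_trans _ _ ((M%:R * 2^-1 ^+ i) ^+ 2)); last first.
      rewrite ler_sqr ?nnegrE ?(ltW ee0) ?mulr_ge0 ?(ltW (e0 i)) //.
      by rewrite ltW // hN // leq_maxr.
    apply: (@le_trans _ _ (\sum_(0 <= m < M) (2^-1 ^+ i) ^+ 2)).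
      apply: ler_sum => m _; rewrite /sqnorms.
      by rewrite ler_sqr ?nnegrE ?nrm_ge0 ?(ltW (e0 i)) //; exact: hl.
    rewrite sumr_const_nat subn0 exprMn -[leLHS]mulr_natl ler_wpM2r ?sqr_ge0 //.
    by rewrite -natrX ler_nat; case: (M) => // M'; rewrite expnS expn1 leq_pmulr.
  have lP : l \in square_summable.
    rewrite (_ : l = l2val (u 0) - (l2val (u 0) - l)); last first.
      by rewrite opprB addrC subrK.
    by rewrite rpredB ?l2valP //; apply: square_summableP => M; exact: hS.
  exists (L2Seqs lP), 1 => n; rewrite mul1r; apply: l2norm_le => [|M].
    by rewrite ltW // half_exp_gt0.
  exact: hS.
Qed.

Definition l2sum : completeNormedModType K := banach_of l2_banach_norm.

Lemma nrm_l2sum (x : l2sum) :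
  nrm x = Num.sqrt (limn (series (fun n => nrm (l2val x n) ^+ 2))).
Proof. exact: nrm_banach_of. Qed.

End L2Sum.

Section Linf.
Variables (R : realType) (k : scalar_kind).
Local Notation K := (scalars R k).
Variables (I : Type) (X : completeNormedModType K).

Definition norm_values (x : I -> X) : set R := range (fun i => nrm (x i)).

Definition bounded_family : {pred I -> X} :=
  fun x => `[< has_ubound (norm_values x) >].

Lemma bounded_familyP (x : I -> X) :
  reflect (exists C, forall i, nrm (x i) <= C) (x \in bounded_family).
Proof.
apply: (iffP idP) => [/asboolP[C hC]|[C hC]].
  by exists C => i; apply: hC; exists i.
by apply/asboolP; exists C => _ [i _ <-].
Qed.

Lemma bounded_family_closed : submod_closed bounded_family.
Proof.
split=> [|a x y /bounded_familyP[C hC] /bounded_familyP[D hD]].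
  by apply/bounded_familyP; exists 0 => i; rewrite nrm0.
apply/bounded_familyP; exists (nrm a * C + D) => i.
by rewrite (le_trans (ler_nrmD _ _)) // nrmZ lerD // ler_wpM2l ?nrm_ge0.
Qed.

HB.instance Definition _ :=
  GRing.isSubmodClosed.Build K (I -> X) bounded_family bounded_family_closed.

Record bounded_families := BoundedFamily {
  linf_val :> I -> X ; linf_valP : linf_val \in bounded_family }.

HB.instance Definition _ := [isSub for linf_val].
HB.instance Definition _ := [Choice of bounded_families by <:].
HB.instance Definition _ := [SubChoice_isSubLmodule of bounded_families by <:].

(* When I is empty this is sup set0 = 0. *)
Definition sup_norm (x : bounded_families) : R := sup (norm_values x).

Lemma le_sup_norm (x : bounded_families) i : nrm (x i) <= sup_norm x.
Proof.
apply: sup_upper_bound; last by exists i.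
split; first by exists (nrm (x i)), i.
exact/asboolP/linf_valP.
Qed.

Lemma sup_norm_ge0 (x : bounded_families) : 0 <= sup_norm x.
Proof.
have [[_ [i _ _]]|] := pselect (norm_values x !=set0).
  exact: le_trans (nrm_ge0 _) (le_sup_norm x i).
by move/set0P/negP; rewrite negbK /sup_norm => /eqP->; rewrite sup0.
Qed.

Lemma sup_norm_le (x : bounded_families) C : 0 <= C ->
  (forall i, nrm (x i) <= C) -> sup_norm x <= C.
Proof.
move=> C0 hC; have [h|] := pselect (norm_values x !=set0).
  by apply: ge_sup => // _ [i _ <-].
by move/set0P/negP; rewrite negbK /sup_norm => /eqP->; rewrite sup0.
Qed.

Lemma linf_banach_norm : @banach_norm R k bounded_families sup_norm.
Proof.
split=> [x|x y|a x|x x0|u hu].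
- exact: sup_norm_ge0.
- apply: sup_norm_le => [|i]; first by rewrite addr_ge0 ?sup_norm_ge0.
  by rewrite (le_trans (ler_nrmD _ _)) // lerD // le_sup_norm.
- apply: sup_norm_le => [|i]; first by rewrite mulr_ge0 ?sup_norm_ge0 ?nrm_ge0.
  by rewrite nrmZ ler_wpM2l ?nrm_ge0 // le_sup_norm.
- apply/val_inj/funext => i; apply: nrm0_eq0.
  by apply: le_anti; rewrite nrm_ge0 -x0 le_sup_norm.
- have /boolp.choice[l hl] i : exists l, forall n, nrm (u n i - l) <= 1 * 2^-1 ^+ n.
    apply: banach_fast_complete => n j nj; rewrite mul1r.
    exact: le_trans (le_sup_norm (u n - u j) i) (hu _ _ nj).
  have lP : l \in bounded_family.
    apply/bounded_familyP; exists (sup_norm (u 0) + 1 * 2^-1 ^+ 0) => i.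
    rewrite (_ : l i = u 0 i - (u 0 i - l i)); last by rewrite opprB addrC subrK.
    by rewrite (le_trans (ler_nrmD _ _)) // nrmN lerD // le_sup_norm.
  exists (BoundedFamily lP), 1 => n; apply: sup_norm_le => [|i].
    by rewrite mul1r ltW // half_exp_gt0.
  exact: hl.
Qed.

Definition linf : completeNormedModType K := banach_of linf_banach_norm.

Lemma nrm_linf (x : linf) :
  nrm x = sup (range (fun i => nrm (linf_val x i))).
Proof. exact: nrm_banach_of. Qed.

End Linf.

Section QuotientLmodule.
Variables (K : pzRingType) (V : lmodType K) (S : submodClosed V).

Let S_zmod_closed : zmod_closed S.
Proof.
split=> [|x y Sx Sy]; first exact: rpred0.
by rewrite rpredD // -scaleN1r rpredZ.
Qed.

Let S_zmod : zmodClosed V :=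
  HB.pack (GRing.SubmodClosed.sort S)
    (GRing.isZmodClosed.Build V (GRing.SubmodClosed.sort S) S_zmod_closed).

(* ring_quotient provides the additive group V / S; the scalar action is added
   here. *)
Definition quot : Type := {ideal_quot S_zmod}.
HB.instance Definition _ := GRing.Zmodule.on quot.

Definition quot_pi : V -> quot := \pi_({ideal_quot S_zmod})%qT.
Definition quot_repr : quot -> V := @repr _ {ideal_quot S_zmod}.

Lemma quot_reprK : cancel quot_repr quot_pi.
Proof. by move=> q; exact: reprK. Qed.

Lemma quot_piP x y : quot_pi x = quot_pi y <-> x - y \in S.
Proof.
have -> : (x - y \in S) = (quot_pi x == quot_pi y :> {ideal_quot S_zmod}).
  exact: (Quotient.idealrBE S_zmod x y).
by split=> [->|/eqP].
Qed.

Lemma quot_piD : {morph quot_pi : x y / x + y}.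
Proof. by move=> x y; rewrite /quot_pi; exact: raddfD. Qed.

Lemma quot_piN : {morph quot_pi : x / - x}.
Proof. by move=> x; rewrite /quot_pi; exact: raddfN. Qed.

Let scale (a : K) (q : quot) : quot := quot_pi (a *: quot_repr q).

Let scale_pi a x : scale a (quot_pi x) = quot_pi (a *: x).
Proof.
apply/quot_piP; rewrite -scalerBr rpredZ //.
by apply/quot_piP; rewrite quot_reprK.
Qed.

Let scaleA a b q : scale a (scale b q) = scale (a * b) q.
Proof. by rewrite -[q]quot_reprK !scale_pi scalerA. Qed.
Let scale1 : left_id 1 scale.
Proof. by move=> q; rewrite -[q]quot_reprK !scale_pi scale1r. Qed.
Let scaleDr : right_distributive scale +%R.
Proof.
move=> a p q; rewrite -[q]quot_reprK -[p]quot_reprK -quot_piD !scale_pi.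
by rewrite scalerDr quot_piD.
Qed.
Let scaleDl q : {morph scale^~ q : a b / a + b}.
Proof.
by move=> a b; rewrite -[q]quot_reprK !scale_pi scalerDl quot_piD.
Qed.

HB.instance Definition _ :=
  GRing.Zmodule_isLmodule.Build K quot scaleA scale1 scaleDr scaleDl.

Lemma quot_piZ a x : quot_pi (a *: x) = a *: quot_pi x.
Proof. by rewrite -scale_pi. Qed.

End QuotientLmodule.

Section BanachQuotient.
Variables (R : realType) (k : scalar_kind).
Local Notation K := (scalars R k).
Variables (V : completeNormedModType K) (S : submodClosed V).
Hypothesis S_closed : closed [set x | x \in S].

(* The quotient norm: infimum of the norms of the representatives. *)
Definition quot_norm (q : quot S) : R :=
  inf [set nrm x | x in [set x | quot_pi S x = q]].

Lemma quot_norm_has_inf q : has_inf [set nrm x | x in [set x | quot_pi S x = q]].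
Proof.
split; first by exists (nrm (quot_repr q)), (quot_repr q) => //; exact: quot_reprK.
by exists 0 => _ [x _ <-]; exact: nrm_ge0.
Qed.

Lemma quot_norm_le x : quot_norm (quot_pi S x) <= nrm x.
Proof. by apply: ge_inf; [case: (quot_norm_has_inf (quot_pi S x))|exists x]. Qed.

Lemma quot_norm_lift q e : 0 < e ->
  exists2 x, quot_pi S x = q & nrm x < quot_norm q + e.
Proof.
move=> e0; have [_ [x xq <-] h] := inf_adherent e0 (quot_norm_has_inf q).
by exists x.
Qed.

Lemma quot_norm_ge0 q : 0 <= quot_norm q.
Proof.
apply: lb_le_inf; first by case: (quot_norm_has_inf q).
by move=> _ [x _ <-]; exact: nrm_ge0.
Qed.

Lemma quot_banach_norm : @banach_norm R k (quot S) quot_norm.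
Proof.
split=> [q|p q|a q|q q0|u hu].
- exact: quot_norm_ge0.
- apply/ler_addgt0Pr => e e0.
  have e20 : 0 < e / 2 by rewrite divr_gt0.
  have [x <- hx] := quot_norm_lift p e20.
  have [y <- hy] := quot_norm_lift q e20.
  rewrite -quot_piD (le_trans (quot_norm_le _)) // (le_trans (ler_nrmD _ _)) //.
  by move: hx hy; lra.
- apply/ler_addgt0Pr => e e0.
  have a0 := nrm_ge0 a.
  have e20 : 0 < e / (nrm a + 1) by rewrite divr_gt0 // ltr_wpDl.
  have [x <- hx] := quot_norm_lift q e20.
  rewrite -quot_piZ (le_trans (quot_norm_le _)) // nrmZ.
  apply: (le_trans (ler_wpM2l a0 (ltW hx))); rewrite mulrDr lerD2l.
  by rewrite mulrCA ler_piMr ?(ltW e0) // ler_pdivrMr ?ltr_wpDl // mul1r lerDl.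
- have [x xq] : exists x, quot_pi S x = q by exists (quot_repr q); exact: quot_reprK.
  rewrite -xq -[RHS](_ : quot_pi S 0 = 0); last by rewrite /quot_pi; exact: raddf0.
  apply/quot_piP; rewrite subr0.
  suff : closure [set x | x \in S] x by move/S_closed.
  move=> B /nbhs_ballP[e /= e0 eB].
  have [y yq] := quot_norm_lift q (real_part_gt0 e0).
  rewrite q0 add0r => hy; exists (x - y); split.
    by rewrite /=; apply/quot_piP; rewrite xq yq.
  apply: eB; rewrite -ball_normE /ball_ /= opprB addrC subrK.
  by rewrite -nrmE -(ge0_of_real (ltW e0)) ltr_of_real.
- have /boolp.choice[d hd] n : exists d,
      quot_pi S d = u n - u n.+1 /\ nrm d <= 2 * 2^-1 ^+ n.
    have [d dq hd] := quot_norm_lift (u n - u n.+1) (half_exp_gt0 R n).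
    exists d; split => //; apply: (le_trans (ltW hd)).
    by have := hu n n.+1 (leqnSn _); lra.
  pose x n := quot_repr (u 0%N) - \sum_(i < n) d i.
  have xS n : x n.+1 = x n - d n by rewrite /x big_ord_recr /= opprD addrA.
  have xu n : quot_pi S (x n) = u n.
    elim: n => [|n IH]; first by rewrite /x big_ord0 subr0 quot_reprK.
    rewrite xS quot_piD IH quot_piN (hd n).1.
    by rewrite opprB addrC subrK.
  have [l hl] : exists l, forall n, nrm (x n - l) <= 4 * 2^-1 ^+ n.
    apply: banach_fast_complete => n i /subnK <-.
    have h m : nrm (x n - x (m + n)%N) <= 4 * 2^-1 ^+ n - 4 * 2^-1 ^+ (m + n).
      elim: m => [|m IH]; first by rewrite add0n !subrr nrm0.
      have -> : x n - x (m.+1 + n)%N = (x n - x (m + n)%N) + d (m + n)%N.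
        by rewrite addSn xS opprB addrA addrAC.
      rewrite (le_trans (ler_nrmD _ _)) //.
      by have := (hd (m + n)%N).2; rewrite addSn exprS; move: IH; lra.
    apply: le_trans (h _) _; rewrite gerBl mulr_ge0 // ltW //.
    exact: half_exp_gt0.
  exists (quot_pi S l), 4 => n.
  rewrite -xu -quot_piN -quot_piD; exact: le_trans (quot_norm_le _) (hl n).
Qed.

Definition banach_quot : completeNormedModType K := banach_of quot_banach_norm.

Lemma nrm_banach_quot (q : banach_quot) :
  nrm q = inf [set nrm x | x in [set x | quot_pi S x = q]].
Proof. exact: nrm_banach_of. Qed.

End BanachQuotient.

Section Ultrapower.
Variables (R : realType) (k : scalar_kind).
Local Notation K := (scalars R k).
Variables (I : Type) (U : set_system I) (UU : UltraFilter U).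
Variable X : completeNormedModType K.

(* The bounded families whose norms tend to 0 along U; the ultrafilter
   hypothesis is an argument only so that ultra_null carries a canonical
   submodule structure. *)
Definition ultra_null of UltraFilter U : {pred linf I X} :=
  fun x => `[< nrm (linf_val x i) @[i --> U] --> (0 : R) >].

Local Notation null := (ultra_null UU).

Lemma ultra_nullP (x : linf I X) :
  reflect (forall e, 0 < e -> \forall i \near U, nrm (linf_val x i) < e)
          (x \in null).
Proof.
have E i : `|0 - nrm (linf_val x i)| = nrm (linf_val x i).
  by rewrite sub0r normrN ger0_norm ?nrm_ge0.
apply: (iffP idP) => [/asboolP/cvgrPdist_lt h e /h|h].
  by apply: filterS => i; rewrite E.
apply/asboolP/cvgrPdist_lt => e /h.
by apply: filterS => i; rewrite E.
Qed.

Lemma ultra_null_submod : submod_closed null.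
Proof.
split=> [|a x y /ultra_nullP hx /ultra_nullP hy].
  by apply/ultra_nullP => e e0; apply: nearW => i; rewrite nrm0.
apply/ultra_nullP => e e0.
have a0 := nrm_ge0 a.
have e1 : 0 < e / 2 / (nrm a + 1) by rewrite !divr_gt0 // ltr_wpDl.
have e2 : 0 < e / 2 by rewrite divr_gt0.
apply: filterS2 (hx _ e1) (hy _ e2) => i h1 h2.
rewrite (le_lt_trans (ler_nrmD _ _)) // nrmZ.
rewrite [ltRHS](splitr e) ler_ltD //.
apply: (le_trans (ler_wpM2l a0 (ltW h1))).
by rewrite mulrCA ler_piMr ?(ltW e2) // ler_pdivrMr ?ltr_wpDl // mul1r lerDl.
Qed.

HB.instance Definition _ :=
  GRing.isSubmodClosed.Build K (linf I X) null ultra_null_submod.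

Lemma ultra_null_closed : closed [set x | x \in null].
Proof.
move=> x hx; apply/ultra_nullP => e e0.
have e2 : 0 < e / 2 by rewrite divr_gt0.
have /hx[y [/= /ultra_nullP/(_ _ e2) hy]] : nbhs x (ball x (of_real k (e / 2))).
  by apply: nbhsx_ballx; rewrite -(of_real0 R k) ltr_of_real.
rewrite -ball_normE /ball_ /= -nrmE ltr_of_real => hxy.
apply: filterS hy => i hi.
rewrite (_ : linf_val x i = linf_val (x - y) i + linf_val y i); last first.
  by rewrite /= subrK.
rewrite (le_lt_trans (ler_nrmD _ _)) // [ltRHS]splitr ltrD //.
apply: le_lt_trans hxy; rewrite nrm_banach_of; exact: le_sup_norm.
Qed.

Definition ultrapower : completeNormedModType K :=
  banach_quot ultra_null_closed.

End Ultrapower.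

Local Open Scope card_scope.

Section BanachNotions.
Variables (R : realType) (k : scalar_kind).
Local Notation K := (scalars R k).

(* The form is linear in its first argument and conjugate-linear in the second;
   completeness and the choice of dimension (possibly 0) come from H. *)
Definition hilbert (H : completeNormedModType K) :=
  exists dot : {dot H for @conj_scalar R k}, forall x, dot x x = `|x| ^+ 2.

(* T need not be surjective. *)
Definition isometric (X Y : normedModType K) (T : X -> Y) :=
  forall x, `|T x| = `|x|.

Definition linearly_isometric (X Y : completeNormedModType K) :=
  exists2 T : {linear X -> Y}, isometric T & range T = setT.

Definition is_basis (V : lmodType K) (b : seq V) :=
  (forall v : V, exists c : 'I_(size b) -> K, v = \sum_i c i *: b`_i) /\
  (forall c : 'I_(size b) -> K,
     \sum_i c i *: b`_i = 0 -> forall i, c i = 0).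

Definition finite_dimensional (V : lmodType K) := exists b : seq V, is_basis b.

Definition lp_pair (p : R) (X : normedModType K) (x y : X) :=
  forall t : R, nrm (x + of_real k t *: y) `^ p = 1 + `|t| `^ p.

Definition elementarily_equivalent (X Y : completeNormedModType K) :=
  exists (I J : Type) (U : set_system I) (V : set_system J)
    (UU : UltraFilter U) (VV : UltraFilter V),
    linearly_isometric (ultrapower UU X) (ultrapower VV Y).

(* kappa, a cardinal represented by a type, is the least cardinality of a dense
   subset of X. *)
Definition density_character (X : topologicalType) (kappa : Type) :=
  (exists2 D : set X, dense D & D #= [set: kappa]) /\
  (forall D : set X, dense D -> [set: kappa] #<= D).

Definition uncountably_categorical (X : completeNormedModType K) :=
  ~ finite_dimensional X /\
  exists kappa : Type, [/\ ~ countable [set: kappa],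
    exists Y : completeNormedModType K,
      elementarily_equivalent X Y /\ density_character Y kappa
    & forall Y Z : completeNormedModType K,
      elementarily_equivalent X Y -> density_character Y kappa ->
      elementarily_equivalent X Z -> density_character Z kappa ->
      linearly_isometric Y Z].

End BanachNotions.

(* Main.v *)
(** Put c_n = 2^(2/p_n - 1), so that c_n > 1 and c_n tends to 1.  Condition (a)
    gives |x+y|^2 + |x-y|^2 <= 2 c_n (|x|^2 + |y|^2) in E_n, and l_(p_n)-pairs
    give equality.

    Ultrapowers.  Since E_n is finite dimensional, a bounded family in E has a
    coordinatewise limit along an ultrafilter; this is a projection of E_U onto
    the diagonal copy of E.  The elements of its kernel H live, in the limit, on
    the coordinates n >= N for every N, hence do not interact with E, and they
    satisfy the parallelogram law because c_n tends to 1.  So E_U = E + H with H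
    Hilbert by Jordan-von Neumann; the same holds for the ultrapowers of E + H.

    Rigidity.  Let T : E -> E + H be isometric.  Treat the values of c_n in
    decreasing order.  The vectors of E_n are l2-orthogonal to the E_m with
    c_m > c_n, which T already maps onto themselves, so the image of an
    l_(p_n)-pair has no such component; as it saturates the constant c_n it can
    only have components in the E_m with c_m = c_n.  These are finitely many
    and finite dimensional, so T maps their sum isometrically onto itself.

    Categoricity.  If T : E_U -> Y_V is an isometry, the map j = T^-1 o diag
    embeds Y in M = E_U.  Rigidity for E -> M = Y_V -> M_V shows that j (Y)
    contains E, so Y = E + H with H Hilbert.  As E is separable, an uncountable
    density character of Y is the cardinality of an orthonormal basis of H,
    which determines Y.  Finally the nonseparable space E_U is elementarily
    equivalent to E for every nonprincipal ultrafilter U on the integers. *)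

Require Import Defs.
From HB Require Import structures.
From mathcomp Require Import all_boot all_order all_algebra.
From mathcomp Require Import complex.
From mathcomp Require Import all_classical reals topology normedtype.
From mathcomp Require Import sequences exp.
From mathcomp Require Import ring lra.

Set Implicit Arguments.
Unset Strict Implicit.
Unset Printing Implicit Defensive.

Import Order.TTheory GRing.Theory Num.Theory.
Import numFieldNormedType.Exports.

Local Open Scope classical_set_scope.
Local Open Scope ring_scope.

(** * Limits along filters and ultrafilters *)

Section FilterLimits.
Variables (R : realType) (I : Type) (U : set_system I) (UF : ProperFilter U).

Lemma cvg_real_unique (f : I -> R) (a b : R) :
  f i @[i --> U] --> a -> f i @[i --> U] --> b -> a = b.
Proof. exact: (@cvg_unique _ (@Rhausdorff R)). Qed.

Lemma eq_cvg_real (f g : I -> R) (a : R) :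
  f =1 g -> f i @[i --> U] --> a -> g i @[i --> U] --> a.
Proof. by move=> /funext ->. Qed.

Lemma cvg_real_cst (a : R) : a @[_ --> U] --> a.
Proof. exact: cvg_cst. Qed.

Lemma cvg_realD (f g : I -> R) (a b : R) :
  f i @[i --> U] --> a -> g i @[i --> U] --> b ->
  (f i + g i) @[i --> U] --> a + b.
Proof. by move=> fa gb; apply: cvgD. Qed.

Lemma cvg_realB (f g : I -> R) (a b : R) :
  f i @[i --> U] --> a -> g i @[i --> U] --> b ->
  (f i - g i) @[i --> U] --> a - b.
Proof. by move=> fa gb; apply: cvgB. Qed.

Lemma cvg_realZ (f : I -> R) (c a : R) :
  f i @[i --> U] --> a -> (c * f i) @[i --> U] --> c * a.
Proof. by move=> fa; apply: cvgMl_tmp. Qed.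

Lemma cvg_dist0 (f : I -> R) (a : R) :
  f i @[i --> U] --> a -> `|f i - a| @[i --> U] --> (0 : R).
Proof.
move=> fa; rewrite -(normr0 R) -(subrr a); apply: cvg_norm.
by apply: cvgB => //; exact: cvg_cst.
Qed.

Lemma le_cvg_real (f g : I -> R) (a b : R) :
  f i @[i --> U] --> a -> g i @[i --> U] --> b ->
  (\forall i \near U, f i <= g i) -> a <= b.
Proof.
move=> fa gb fg; apply/ler_addgt0Pr => e e0.
have e2 : 0 < e / 2 by rewrite divr_gt0.
have /cvgrPdist_lt/(_ _ e2) h1 := fa; have /cvgrPdist_lt/(_ _ e2) h2 := gb.
have [i [[h3 h4] h5]] := @filter_ex _ U UF _ (filterI (filterI h1 h2) fg).
move: h3 h4 h5; rewrite !ltr_norml; lra.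
Qed.

Lemma le_cvg_cst (f : I -> R) (a b : R) :
  f i @[i --> U] --> a -> (\forall i \near U, f i <= b) -> a <= b.
Proof. by move=> fa; apply: le_cvg_real fa _; exact: cvg_cst. Qed.

Lemma ge_cvg_cst (f : I -> R) (a b : R) :
  f i @[i --> U] --> a -> (\forall i \near U, b <= f i) -> b <= a.
Proof. by move=> fa; apply: le_cvg_real fa; exact: cvg_cst. Qed.

Lemma cvg0_le (f g : I -> R) :
  g i @[i --> U] --> 0 -> (forall i, `|f i| <= g i) -> f i @[i --> U] --> 0.
Proof.
move=> /cvgrPdist_lt g0 fg; apply/cvgrPdist_lt => e /g0.
apply: filterS => i; rewrite !sub0r !normrN.
by apply: le_lt_trans; apply: le_trans (fg i) (ler_norm _).
Qed.

Lemma cvg0_approx (f : I -> R) :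
  (forall e, 0 < e -> \forall i \near U, `|f i| <= e) -> f i @[i --> U] --> 0.
Proof.
move=> h; apply/cvgrPdist_lt => e e0.
apply: filterS (h (e / 2) _); last by rewrite divr_gt0.
by move=> i; rewrite sub0r normrN => /le_lt_trans; apply; lra.
Qed.

Lemma cvg_sqr (f : I -> R) (a : R) :
  f i @[i --> U] --> a -> f i ^+ 2 @[i --> U] --> a ^+ 2.
Proof. by move=> fa; rewrite expr2; under eq_fun do rewrite expr2; exact: cvgM. Qed.

Lemma cvg_real_sum (J : Type) (r : seq J) (f : J -> I -> R) (a : J -> R) :
  (forall j, f j i @[i --> U] --> a j) ->
  (\sum_(j <- r) f j i) @[i --> U] --> \sum_(j <- r) a j.
Proof.
move=> h; elim: r => [|j r IH].
  by under eq_fun do rewrite big_nil; rewrite big_nil; exact: cvg_cst.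
by under eq_fun do rewrite big_cons; rewrite big_cons; exact: cvg_realD.
Qed.

End FilterLimits.

Section UltraLimits.
Variables (R : realType) (k : scalar_kind).
Local Notation K := (scalars R k).
Variables (I : Type) (U : set_system I) (UU : UltraFilter U).
Let UP : ProperFilter U := ultra_proper.

(** Compactness of the segment gives the image filter a cluster point, and an ultrafilter converges
    to each of its cluster points. *)
Lemma bounded_ultra_cvg (f : I -> R) (C : R) :
  (forall i, `|f i| <= C) -> exists l : R, f i @[i --> U] --> l.
Proof.
move=> fC.
have [] := @segment_compact R (- C) C (fmap f U) _.
  by apply: (@filterE _ U) => i; rewrite /= in_itv /= -ler_norml; exact: fC.
move=> l [_ cl]; exists l => B Bl.
have [//|nB] := in_ultra_setVsetC (f @^-1` B) UU.
by have [y []] := cl (~` B) B nB Bl.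
Qed.

Lemma nrm_complexE (z : scalars R ComplexScalars) :
  nrm z = Num.sqrt (complex.Re (z : R[i]) ^+ 2 + complex.Im (z : R[i]) ^+ 2).
Proof. by have /(congr1 (@complex.Re R)) := normc_def (z : R[i]); case: z. Qed.

Lemma nrm_complex_le (z : scalars R ComplexScalars) :
  nrm z <= `|complex.Re (z : R[i])| + `|complex.Im (z : R[i])|.
Proof.
rewrite nrm_complexE; case: z => x y /=.
rewrite -ler_sqr ?nnegrE ?sqrtr_ge0 ?addr_ge0 // sqr_sqrtr ?addr_ge0 ?sqr_ge0 //.
rewrite [leRHS]sqrrD !real_normK ?num_real // lerD2r lerDl.
by rewrite mulrn_wge0 // mulr_ge0.
Qed.

Lemma scalar_ultra_cvg (f : I -> K) (C : R) :
  (forall i, nrm (f i) <= C) -> exists l : K, nrm (f i - l) @[i --> U] --> (0 : R).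
Proof.
case: k f => f fC.
  have [l hl] := bounded_ultra_cvg fC.
  by exists l; exact: cvg_dist0.
have reC i : `|complex.Re (f i)| <= C /\ `|complex.Im (f i)| <= C.
  have := fC i; rewrite nrm_complexE => h.
  by split; apply: le_trans h; rewrite -sqrtr_sqr ler_sqrt ?addr_ge0 ?sqr_ge0 //
    ?lerDl ?lerDr sqr_ge0.
have [a ha] := bounded_ultra_cvg (fun i => (reC i).1).
have [b hb] := bounded_ultra_cvg (fun i => (reC i).2).
exists (a +i* b)%C.
apply: (@cvg0_le _ _ _ UP _ (fun i => `|complex.Re (f i) - a| + `|complex.Im (f i) - b|)).
  by have := cvg_realD UP (cvg_dist0 UP ha) (cvg_dist0 UP hb); rewrite addr0.
move=> i; rewrite ger0_norm ?nrm_ge0 //; apply: le_trans (nrm_complex_le _) _.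
by case: (f i).
Qed.

End UltraLimits.

Lemma nonprincipal_ultrafilter :
  exists2 U : set_system nat, UltraFilter U & forall n, U [set i | (n <= i)%N].
Proof.
have [U [UU hU]] := ultraFilterLemma (@eventually_filter).
by exists U => // n; apply: hU; exists n.
Qed.

Section NormLimits.
Variables (R : realType) (k : scalar_kind).
Local Notation K := (scalars R k).
Variable V : normedModType K.
Implicit Types x y : V.

Lemma nrm_of_real (a : R) : nrm (of_real k a) = `|a|.
Proof. by rewrite /nrm norm_of_real of_realK. Qed.

Lemma ler_nrm_dist x y : `|nrm x - nrm y| <= nrm (x - y).
Proof.
have h1 := ler_nrmD (x - y) y; have h2 := ler_nrmD (y - x) x.
by rewrite !subrK (nrmBC y) in h1 h2; rewrite ler_norml; lra.
Qed.

Section Along.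
Variables (I : Type) (U : set_system I) (UF : ProperFilter U).
Implicit Types u v : I -> V.

(** Since [nrm] is real-valued, convergence in norm becomes a limit in R, whatever the scalar
    field. *)
Definition nrm_cvg u x := nrm (u i - x) @[i --> U] --> (0 : R).

Lemma nrm_cvg_cst x : nrm_cvg (fun=> x) x.
Proof. by rewrite /nrm_cvg subrr nrm0; exact: cvg_cst. Qed.

Lemma nrm_cvgD u v x y :
  nrm_cvg u x -> nrm_cvg v y -> nrm_cvg (fun i => u i + v i) (x + y).
Proof.
move=> hu hv; apply: (cvg0_le UF _ (g := fun i => nrm (u i - x) + nrm (v i - y))).
  by have := cvg_realD UF hu hv; rewrite addr0.
move=> i; rewrite ger0_norm ?nrm_ge0 // opprD addrACA.
exact: ler_nrmD.
Qed.

Lemma nrm_cvgZ a u x : nrm_cvg u x -> nrm_cvg (fun i => a *: u i) (a *: x).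
Proof.
move=> hu; have := cvg_realZ UF (c := nrm a) hu; rewrite mulr0.
by apply: eq_cvg_real => i; rewrite -scalerBr nrmZ.
Qed.

Lemma nrm_cvgB u v x y :
  nrm_cvg u x -> nrm_cvg v y -> nrm_cvg (fun i => u i - v i) (x - y).
Proof.
move=> hu /(nrm_cvgZ (-1)) hv; rewrite -scaleN1r.
by under eq_fun do rewrite -scaleN1r; exact: nrm_cvgD.
Qed.

Lemma nrm_cvg_sum (J : Type) (r : seq J) (u : J -> I -> V) (x : J -> V) :
  (forall j, nrm_cvg (u j) (x j)) ->
  nrm_cvg (fun i => \sum_(j <- r) u j i) (\sum_(j <- r) x j).
Proof.
move=> h; elim: r => [|j r IH].
  by under eq_fun do rewrite big_nil; rewrite big_nil; exact: nrm_cvg_cst.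
by under eq_fun do rewrite big_cons; rewrite big_cons; exact: nrm_cvgD.
Qed.

Lemma nrm_cvg_nrm u x : nrm_cvg u x -> nrm (u i) @[i --> U] --> nrm x.
Proof.
move=> hu; apply/(@cvgrPdist_lt _ _ _ U) => e e0.
have /(@cvgrPdist_lt _ _ _ U)/(_ _ e0) := hu.
apply: filterS => i; rewrite sub0r normrN ger0_norm ?nrm_ge0 //.
by apply: le_lt_trans; rewrite nrmBC; exact: ler_nrm_dist.
Qed.

Lemma nrm_cvg_unique u x y : nrm_cvg u x -> nrm_cvg u y -> x = y.
Proof.
move=> hx hy; have h := nrm_cvg_nrm (nrm_cvgB hx hy).
apply/eqP; rewrite -subr_eq0; apply/eqP/nrm0_eq0.
apply: (cvg_real_unique UF h).
by under eq_fun do rewrite subrr nrm0; exact: cvg_cst.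
Qed.

End Along.

Lemma nrm_cvgZl (I : Type) (U : set_system I) (UF : ProperFilter U)
  (c : I -> K) (a : K) x :
  nrm (c i - a) @[i --> U] --> (0 : R) -> nrm_cvg U (fun i => c i *: x) (a *: x).
Proof.
move=> hc; have := cvg_realZ UF (c := nrm x) hc; rewrite mulr0.
by apply: eq_cvg_real => i; rewrite -scalerBl nrmZ mulrC.
Qed.

(** * Compactness in finite dimensional spaces *)

Section Basis.
Variables (b : seq V) (b_basis : is_basis b).

(** Equivalence of norms. Were there no such d, coefficient vectors of l1-norm 1 with combinations
    of norm at most 2^-n would exist. Along a nonprincipal ultrafilter they would converge to a
    vanishing combination with coefficients of l1-norm 1, against independence. *)
Lemma basis_coord_bound : exists2 d : R, 0 < d &
  forall c : 'I_(size b) -> K,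
    d * \sum_i nrm (c i) <= nrm (\sum_i c i *: b`_i).
Proof.
apply: contrapT => nd.
have /choice[c hc] : forall n, exists c : 'I_(size b) -> K,
    \sum_i nrm (c i) = 1 /\ nrm (\sum_i c i *: b`_i) <= 2^-1 ^+ n.
  move=> n; apply: contrapT => nc; apply: nd.
  exists (2^-1 ^+ n); first exact: half_exp_gt0.
  move=> c; have [s0|s0] := eqVneq (\sum_i nrm (c i)) 0.
    by rewrite s0 mulr0 nrm_ge0.
  rewrite leNgt; apply/negP => h; apply: nc.
  set s := \sum_i nrm (c i) in s0 h *.
  have s_gt0 : 0 < s by rewrite lt_neqAle eq_sym s0 sumr_ge0 // => i _; exact: nrm_ge0.
  exists (fun i => of_real k s^-1 * c i); split.
    under eq_bigr do rewrite nrmM nrm_of_real ger0_norm ?invr_ge0 ?(ltW s_gt0) //.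
    by rewrite -mulr_sumr mulVf.
  under eq_bigr do rewrite -scalerA.
  rewrite -scaler_sumr nrmZ nrm_of_real ger0_norm ?invr_ge0 ?(ltW s_gt0) //.
  by rewrite mulrC ler_pdivrMr // ltW.
have [U UU hU] := nonprincipal_ultrafilter.
have UP := @ultra_proper _ _ UU.
have cC n i : nrm (c n i) <= 1.
  rewrite -(hc n).1 (bigD1 i) //= lerDl sumr_ge0 // => j _; exact: nrm_ge0.
have /choice[l hl] : forall i, exists l : K, nrm (c n i - l) @[n --> U] --> (0 : R).
  by move=> i; apply: (scalar_ultra_cvg UU (C := 1)) => n; exact: cC.
have l0 : \sum_i l i *: b`_i = 0.
  apply: (nrm_cvg_unique UP (u := fun n => \sum_i c n i *: b`_i)).
    by apply: nrm_cvg_sum => i; exact: nrm_cvgZl.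
  apply: cvg0_approx => e e0; have [N hN] := half_exp_small 1 e0.
  apply: filterS (hU N) => n /= /hN; rewrite mul1r subr0 ger0_norm ?nrm_ge0 //.
  by move=> /ltW; apply: le_trans; exact: (hc n).2.
have {}l0 i : l i = 0 by exact: (b_basis.2 _ l0).
have : (0 : R) = 1.
  apply: (@cvg_real_unique _ _ U UP (fun n => \sum_i nrm (c n i))).
    have := cvg_real_sum UP (r := index_enum 'I_(size b))
      (f := fun i n => nrm (c n i)) (a := fun=> 0).
    rewrite big1 //; apply=> i; have := hl i; rewrite l0.
    by under eq_fun do rewrite subr0.
  by under eq_fun do rewrite (hc _).1; exact: cvg_cst.
by move/eqP; rewrite eq_sym oner_eq0.
Qed.

(** By [basis_coord_bound] the coordinates stay bounded, so each of them converges along U. *)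
Lemma basis_ultra_cvg (I : Type) (U : set_system I) (UU : UltraFilter U)
  (u : I -> V) (C : R) : (forall i, nrm (u i) <= C) -> exists x, nrm_cvg U u x.
Proof.
move=> uC; have UP := @ultra_proper _ _ UU.
have /choice[c hc] : forall i, exists c : 'I_(size b) -> K, u i = \sum_j c j *: b`_j.
  by move=> i; exact: b_basis.1.
have [d d0 hd] := basis_coord_bound.
have cC i j : nrm (c i j) <= C / d.
  rewrite ler_pdivlMr // mulrC; apply: le_trans (uC i); rewrite hc.
  apply: le_trans (hd _); rewrite ler_pM2l // (bigD1 j) //= lerDl.
  by rewrite sumr_ge0 // => *; exact: nrm_ge0.
have /choice[l hl] : forall j, exists l : K, nrm (c i j - l) @[i --> U] --> (0 : R).
  by move=> j; apply: (scalar_ultra_cvg UU (C := C / d)) => i; exact: cC.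
exists (\sum_j l j *: b`_j); rewrite (funext hc).
by apply: nrm_cvg_sum => j; exact: nrm_cvgZl.
Qed.

End Basis.

End NormLimits.

(** * Ultrapowers *)

Section UltrapowerClasses.
Variables (R : realType) (k : scalar_kind).
Local Notation K := (scalars R k).
Variables (I : Type) (U : set_system I) (UU : UltraFilter U).
Let UP : ProperFilter U := @ultra_proper _ _ UU.
Variable X : completeNormedModType K.
Implicit Types (x y : linf I X) (q : ultrapower UU X).

Definition uclass x : ultrapower UU X := quot_pi (ultra_null UU) x.

Lemma uclassD x y : uclass (x + y) = uclass x + uclass y.
Proof. exact: quot_piD. Qed.

Lemma uclassZ a x : uclass (a *: x) = a *: uclass x.
Proof. exact: quot_piZ. Qed.

Lemma uclassB x y : uclass (x - y) = uclass x - uclass y.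
Proof. by rewrite uclassD -[- y]scaleN1r uclassZ scaleN1r. Qed.

Lemma uclass_surj q : exists x, uclass x = q.
Proof. by exists (quot_repr q); exact: quot_reprK. Qed.

Lemma uclass_eq x y :
  uclass x = uclass y <-> nrm (linf_val x i - linf_val y i) @[i --> U] --> (0 : R).
Proof.
split=> [/quot_piP/asboolP//|h].
by apply/quot_piP/asboolP.
Qed.

Lemma linf_bound x : exists C, forall i, nrm (linf_val x i) <= C.
Proof. exact/bounded_familyP/linf_valP. Qed.

Definition bfamily (f : I -> X) (h : exists C, forall i, nrm (f i) <= C) : linf I X :=
  BoundedFamily (introT (bounded_familyP f) h).

Lemma nrm_linf_le x C : 0 <= C -> (forall i, nrm (linf_val x i) <= C) -> nrm x <= C.
Proof. by move=> C0 h; rewrite nrm_banach_of; exact: sup_norm_le. Qed.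

Lemma nrm_uclass x : nrm (linf_val x i) @[i --> U] --> nrm (uclass x).
Proof.
have [C hC] := linf_bound x.
have [l hl] := @bounded_ultra_cvg R _ _ UU (fun i => nrm (linf_val x i)) C
  (fun i => ltac:(by rewrite ger0_norm ?nrm_ge0)).
suff <- : l = nrm (uclass x) by [].
have l0 : 0 <= l by apply: (ge_cvg_cst UP hl); apply: filterE => i; exact: nrm_ge0.
rewrite nrm_banach_of; apply: le_anti; apply/andP; split; last first.
  apply/ler_addgt0Pr => e e0.
  (* Cutting the family off where its norm reaches l + e changes it only outside a set of U, so the
     class is the same and its sup norm is at most l + e. *)
  pose f i := if nrm (linf_val x i) < l + e then linf_val x i else 0.
  have fle i : nrm (f i) <= l + e.
    by rewrite /f; case: ifPn => [/ltW//|_]; rewrite nrm0 addr_ge0 // ltW.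
  pose y := bfamily (ex_intro _ (l + e) fle).
  have -> : uclass x = uclass y.
    apply/uclass_eq; apply: cvg0_approx => d d0.
    have /(@cvgrPdist_lt _ _ _ U)/(_ _ e0) := hl.
    apply: filterS => i h; rewrite /= /f ifT ?subrr ?nrm0 ?normr0 ?(ltW d0) //.
    by move: h; rewrite ltr_norml; lra.
  apply: le_trans (quot_norm_le _ _) _; apply: nrm_linf_le => //.
  by rewrite addr_ge0 // ltW.
(* Conversely, the norms along any other representative have the same limit l, and its sup norm
   bounds them. *)
apply: lb_le_inf; first by have [] := quot_norm_has_inf (uclass x).
move=> _ [y /= /uclass_eq yx <-].
apply: (@le_cvg_cst _ _ _ UP (fun i => nrm (linf_val y i)) l (nrm y)); last first.
  by apply: filterE => i; rewrite nrm_banach_of; exact: le_sup_norm.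
have := cvg_realD UP hl yx.
rewrite addr0 => h; apply/(@cvgrPdist_lt _ _ _ U) => e e0.
have e2 : 0 < e / 2 by rewrite divr_gt0.
have /(@cvgrPdist_lt _ _ _ U)/(_ _ e2) h1 := hl.
have /(@cvgrPdist_lt _ _ _ U)/(_ _ e2) h2 := yx.
apply: filterS2 h1 h2 => i; rewrite sub0r normrN (ger0_norm (nrm_ge0 _)).
have := ler_nrm_dist (linf_val y i) (linf_val x i).
by rewrite ler_norml !ltr_norml; lra.
Qed.

Lemma nrm_uclass_eq x (l : R) : nrm (linf_val x i) @[i --> U] --> l -> nrm (uclass x) = l.
Proof. by move=> h; exact: (cvg_real_unique UP (@nrm_uclass x) h). Qed.

Let diag_subproof (z : X) : exists C, forall i : I, nrm z <= C.
Proof. by exists (nrm z). Qed.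

Definition udiag (z : X) : ultrapower UU X := uclass (bfamily (diag_subproof z)).

Lemma udiag_is_linear : linear udiag.
Proof.
by move=> a y z; rewrite /udiag -uclassZ -uclassD; congr uclass; apply/val_inj.
Qed.

HB.instance Definition _ :=
  GRing.isLinear.Build K X (ultrapower UU X) _ udiag udiag_is_linear.

Lemma nrm_udiag z : nrm (udiag z) = nrm z.
Proof. by apply: nrm_uclass_eq; exact: cvg_cst. Qed.

Lemma uclass_udiag x z : uclass x = udiag z <-> nrm_cvg U (linf_val x) z.
Proof. exact: uclass_eq. Qed.

End UltrapowerClasses.

(** * Square-summable sums *)

Section L2SumTheory.
Variables (R : realType) (k : scalar_kind).
Local Notation K := (scalars R k).
Variable E : nat -> completeNormedModType K.
Local Notation F := (l2sum E).
Implicit Types x y z : F.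

Definition coord n (x : F) : E n := l2val x n.

Arguments coord : simpl never.

Lemma coord_is_linear n : linear (coord n).
Proof. by []. Qed.

HB.instance Definition _ n := GRing.isLinear.Build K F (E n) _ (coord n) (coord_is_linear n).

Lemma l2sum_ext x y : (forall n, coord n x = coord n y) -> x = y.
Proof. by move=> h; apply/val_inj/functional_extensionality_dep. Qed.

Definition l2partial x N := \sum_(0 <= m < N) nrm (coord m x) ^+ 2.

Lemma l2partial_cvg x : l2partial x N @[N --> \oo] --> nrm x ^+ 2.
Proof.
have -> : nrm x ^+ 2 = limn (l2partial x).
  by rewrite nrm_banach_of sqr_l2norm.
exact/asboolP/l2valP.
Qed.

Lemma l2partial_le x N : l2partial x N <= nrm x ^+ 2.
Proof. by rewrite nrm_banach_of; exact: series_le_l2norm. Qed.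

Lemma nrm_coord_le n x : nrm (coord n x) <= nrm x.
Proof. by rewrite [leRHS]nrm_banach_of; exact: coord_le_l2norm. Qed.

(** Elements of F are built from coordinates through this lemma: one bound on the partial sums
    yields both summability and the norm estimate. *)
Lemma l2sum_of_bound (f : forall n, E n) (C : R) :
  (forall N, \sum_(0 <= m < N) nrm (f m) ^+ 2 <= C) ->
  exists2 x : F, forall n, coord n x = f n & nrm x ^+ 2 <= C.
Proof.
move=> h; exists (L2Seqs (square_summableP (x := f) h)) => //.
apply: (le_cvg_cst (@eventually_filter) (@l2partial_cvg _)).
exact: (@filterE _ \oo).
Qed.

Lemma sqr_nrm_le_coordwise (C : R) x y u v :
  (forall n, nrm (coord n x) ^+ 2 + nrm (coord n y) ^+ 2 <=
     C * (nrm (coord n u) ^+ 2 + nrm (coord n v) ^+ 2)) ->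
  nrm x ^+ 2 + nrm y ^+ 2 <= C * (nrm u ^+ 2 + nrm v ^+ 2).
Proof.
move=> h; have P := @eventually_filter.
apply: (le_cvg_real P (cvg_realD P (@l2partial_cvg x) (@l2partial_cvg y))
  (cvg_realZ P (cvg_realD P (@l2partial_cvg u) (@l2partial_cvg v)))).
apply: filterE => N; rewrite /l2partial -!big_split mulr_sumr /=.
exact: ler_sum.
Qed.

Lemma sqr_nrm_eq_coordwise x y z :
  (forall n, nrm (coord n x) ^+ 2 = nrm (coord n y) ^+ 2 + nrm (coord n z) ^+ 2) ->
  nrm x ^+ 2 = nrm y ^+ 2 + nrm z ^+ 2.
Proof.
move=> h; have P := @eventually_filter.
apply: (cvg_real_unique P (@l2partial_cvg x)).
apply: eq_cvg_real (cvg_realD P (@l2partial_cvg y) (@l2partial_cvg z)) => N.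
by rewrite /l2partial -big_split; apply: eq_bigr.
Qed.

Lemma trunc_exists N x : exists2 y : F,
  forall n, coord n y = (if (n < N)%N then coord n x else 0) & nrm y ^+ 2 <= nrm x ^+ 2.
Proof.
apply: l2sum_of_bound => M.
apply: le_trans (l2partial_le x M); apply: ler_sum => n _.
by case: ifP => // _; rewrite nrm0 expr0n sqr_ge0.
Qed.

Definition trunc N x : F := s2val (cid2 (trunc_exists N x)).

Lemma coord_trunc N x n : coord n (trunc N x) = if (n < N)%N then coord n x else 0.
Proof. exact: (s2valP (cid2 (trunc_exists N x))). Qed.

Lemma trunc0 N : trunc N 0 = 0.
Proof. by apply: l2sum_ext => n; rewrite coord_trunc raddf0; case: ifP. Qed.

Lemma truncD N x y : trunc N (x + y) = trunc N x + trunc N y.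
Proof.
apply: l2sum_ext => n; rewrite raddfD /= !coord_trunc.
by case: ifP => _; rewrite ?raddfD ?addr0.
Qed.

Lemma sqr_nrm_trunc N x : nrm x ^+ 2 = nrm (trunc N x) ^+ 2 + nrm (x - trunc N x) ^+ 2.
Proof.
apply: sqr_nrm_eq_coordwise => n; rewrite raddfB /= coord_trunc.
by case: ifP => _; rewrite ?subrr ?subr0 nrm0 expr0n ?addr0 ?add0r.
Qed.

(** Only the first N coordinates of w meet x, so the tail of w splits off orthogonally. *)
Lemma sqr_nrm_trunc_orth N x w : trunc N x = x ->
  nrm (x + w) ^+ 2 = nrm (x + trunc N w) ^+ 2 + nrm (w - trunc N w) ^+ 2.
Proof.
move=> xN; rewrite (sqr_nrm_trunc N) truncD xN.
by rewrite opprD addrACA subrr add0r.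
Qed.

Lemma trunc_approx x (e : R) : 0 < e -> exists N, nrm (x - trunc N x) < e.
Proof.
move=> e0; have e2 : 0 < e ^+ 2 by rewrite exprn_gt0.
have /cvgrPdist_lt/(_ _ e2) [N _ /(_ N (leqnn N)) /= hN] := @l2partial_cvg x.
exists N; rewrite -ltr_sqr ?nnegrE ?nrm_ge0 ?(ltW e0) //.
have := sqr_nrm_trunc N x; have := l2partial_le (trunc N x) N.
have -> : l2partial (trunc N x) N = l2partial x N.
  by apply: eq_big_nat => n /andP[_ nN]; rewrite coord_trunc nN.
by move: hN; rewrite ltr_norml; lra.
Qed.

Lemma truncK N x : trunc N (trunc N x) = trunc N x.
Proof. by apply: l2sum_ext => n; rewrite !coord_trunc; case: (n < N)%N. Qed.

Lemma inj_exists n (z : E n) : exists2 y : F,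
  coord n y = z /\ (forall m, m != n -> coord m y = 0) & nrm y <= nrm z.
Proof.
pose f : forall m, E m := eqtype.dfwith (T := fun m => E m) (fun m => 0) z.
have fn : f n = z by exact: dfwith_in.
have fm m : m != n -> f m = 0 by move=> mn; rewrite /f dfwith_out // eq_sym.
have [y hy yz] : exists2 x : F, forall n, coord n x = f n & nrm x ^+ 2 <= nrm z ^+ 2.
  apply: l2sum_of_bound => N.
  have f0 m : m != n -> nrm (f m) ^+ 2 = 0 by move=> mn; rewrite fm // nrm0 expr0n.
  rewrite big_mkord; have [nN|Nn] := ltnP n N.
    rewrite (bigD1 (Ordinal nN)) //= fn big1 ?addr0 // => m mn.
    by apply: f0; apply: contra_neq mn => h; apply/val_inj.
  rewrite big1 ?sqr_ge0 // => m _; apply: f0.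
  by rewrite ltn_eqF // (leq_trans _ Nn).
exists y; first by split=> [|m mn]; rewrite hy ?fn ?fm.
by rewrite -ler_sqr ?nnegrE ?nrm_ge0.
Qed.

Definition inj n (z : E n) : F := s2val (cid2 (inj_exists z)).

Lemma coord_inj n (z : E n) : coord n (inj z) = z.
Proof. exact: (s2valP (cid2 (inj_exists z))).1. Qed.

Lemma coord_inj_neq n (z : E n) m : m != n -> coord m (inj z) = 0.
Proof. exact: (s2valP (cid2 (inj_exists z))).2. Qed.

Lemma nrm_inj n (z : E n) : nrm (inj z) = nrm z.
Proof.
apply: le_anti; rewrite (s2valP' (cid2 (inj_exists z))) /=.
by rewrite -{1}(coord_inj z) nrm_coord_le.
Qed.

Lemma inj_is_linear n : linear (@inj n).
Proof.
move=> a x y; apply: l2sum_ext => m; rewrite linearP /=.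
have [->|mn] := eqVneq m n; first by rewrite !coord_inj.
by rewrite !coord_inj_neq // scaler0 addr0.
Qed.

HB.instance Definition _ n := GRing.isLinear.Build K (E n) F _ (@inj n) (@inj_is_linear n).

Lemma sqr_nrm_split n x :
  nrm x ^+ 2 = nrm (coord n x) ^+ 2 + nrm (x - inj (coord n x)) ^+ 2.
Proof.
rewrite -(nrm_inj (coord n x)); apply: sqr_nrm_eq_coordwise => m.
rewrite raddfB /=; have [->|mn] := eqVneq m n.
  by rewrite !coord_inj subrr nrm0 expr0n addr0.
by rewrite !coord_inj_neq // subr0 nrm0 expr0n add0r.
Qed.

Lemma trunc_sum N x : trunc N x = \sum_(m < N) inj (coord m x).
Proof.
apply: l2sum_ext => n; rewrite raddf_sum coord_trunc /=.
case: ltnP => nN.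
  rewrite (bigD1 (Ordinal nN)) //= coord_inj big1 ?addr0 // => m mn.
  by apply: coord_inj_neq; rewrite eq_sym; apply: contra_neq mn => h; apply/val_inj.
by rewrite big1 // => m _; apply: coord_inj_neq; rewrite gtn_eqF // (leq_trans _ nN).
Qed.

End L2SumTheory.

Arguments coord {R k E} n x : simpl never.
Arguments inj {R k E n} z : simpl never.
Arguments trunc {R k E} N x : simpl never.

(** Bookkeeping for [coord_cvg0_par]. D and B mark the sum and the difference of two vectors; t, s
    and k are the squared norms of the head, of the tail and of the Hilbert part. The Hilbert part
    has constant 1, which is at most C. *)
Lemma le_par_parts (R : realType) (C tD sD kD tB sB kB pu ku pv kv : R) :
  1 <= C -> 0 <= ku -> 0 <= kv ->
  sD + sB <= 2 * C * (pu + pv) -> kD + kB <= 2 * (ku + kv) ->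
  tD + sD + kD + (tB + sB + kB) <= 2 * C * (pu + ku + (pv + kv)) + (tD + tB).
Proof.
move=> C1 u0 v0 hs hk.
have : 0 <= (C - 1) * (ku + kv) by rewrite mulr_ge0 ?subr_ge0 ?addr_ge0.
lra.
Qed.

Lemma ler_dist_sqr (R : realType) (a b s d : R) : 0 <= a -> 0 <= b ->
  `|a - b| <= d -> a + b <= s -> `|a ^+ 2 - b ^+ 2| <= d * s.
Proof.
by move=> a0 b0 hd hs; rewrite subr_sqr normrM ler_pM // ger0_norm ?addr_ge0.
Qed.

(** * Hilbert extensions of a Banach space *)

Section HilbertExtension.
Variables (R : realType) (k : scalar_kind).
Local Notation K := (scalars R k).
Variables F M : completeNormedModType K.

(* M is, through io, the l2-sum of F and of the Hilbert space ker pr; the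
   parallelogram inequality on ker pr forces the parallelogram identity. *)
Record hilbert_extension (io : {linear F -> M}) (pr : {linear M -> F}) : Prop :=
  HilbertExtension {
    hextK : cancel io pr;
    hext_pyth : forall x, nrm x ^+ 2 = nrm (pr x) ^+ 2 + nrm (x - io (pr x)) ^+ 2;
    hext_par : forall u v, pr u = 0 -> pr v = 0 ->
      nrm (u + v) ^+ 2 + nrm (u - v) ^+ 2 <= 2 * (nrm u ^+ 2 + nrm v ^+ 2) }.

Variables (io : {linear F -> M}) (pr : {linear M -> F}).
Hypothesis ext : hilbert_extension io pr.

Lemma nrm_hext_io e : nrm (io e) = nrm e.
Proof.
apply/eqP; rewrite -(eqrXn2 (n := 2)) ?nrm_ge0 // (hext_pyth ext) (hextK ext).
by rewrite subrr nrm0 expr0n addr0.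
Qed.

Lemma nrm_hext_pr x : nrm (pr x) <= nrm x.
Proof.
by rewrite -ler_sqr ?nnegrE ?nrm_ge0 // (hext_pyth ext x) lerDl sqr_ge0.
Qed.

Lemma hext_pr_sub x : pr (x - io (pr x)) = 0.
Proof. by rewrite raddfB /= (hextK ext) subrr. Qed.

Lemma hext_sub_io x e :
  nrm (x - io e) ^+ 2 = nrm (pr x - e) ^+ 2 + nrm (x - io (pr x)) ^+ 2.
Proof.
rewrite (hext_pyth ext (x - io e)) raddfB /= (hextK ext); congr (_ + nrm _ ^+ 2).
by rewrite raddfB /= opprB addrA subrK.
Qed.

Lemma hext_par_sub u v :
  nrm ((u + v) - io (pr (u + v))) ^+ 2 + nrm ((u - v) - io (pr (u - v))) ^+ 2 <=
  2 * (nrm (u - io (pr u)) ^+ 2 + nrm (v - io (pr v)) ^+ 2).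
Proof.
rewrite (raddfD pr) (raddfB pr) (raddfD io) (raddfB io).
rewrite opprD addrACA (opprD (io (pr u))) (addrACA u (- v)) -(opprD v).
exact: (hext_par ext (hext_pr_sub u) (hext_pr_sub v)).
Qed.

End HilbertExtension.

(** * Ultrapowers of Hilbert extensions *)

Section UltraExtension.
Variables (R : realType) (k : scalar_kind).
Local Notation K := (scalars R k).
Variable E : nat -> completeNormedModType K.
Local Notation F := (l2sum E).
Hypothesis E_fd : forall n, finite_dimensional (E n).
Variables (I : Type) (U : set_system I) (UU : UltraFilter U).
Let UP : ProperFilter U := @ultra_proper _ _ UU.

Definition coord_cvg (u : I -> F) (z : F) :=
  forall n, nrm_cvg U (fun i => coord n (u i)) (coord n z).

(** Each coordinate converges because E n is finite dimensional, and the bound on the partial sums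
    of squares passes to the limit. *)
Lemma coord_cvg_exists (u : I -> F) (C : R) :
  (forall i, nrm (u i) <= C) -> exists z, coord_cvg u z.
Proof.
move=> uC.
have zex n : exists x, nrm_cvg U (fun i => coord n (u i)) x.
  have [b hb] := E_fd n.
  apply: (basis_ultra_cvg hb UU (C := C)) => i.
  exact: le_trans (nrm_coord_le _ _) (uC i).
pose z n := projT1 (cid (zex n)).
have hz n : nrm_cvg U (fun i => coord n (u i)) (z n) := projT2 (cid (zex n)).
have [] := @l2sum_of_bound _ _ E z (C ^+ 2).
  move=> N; apply: (@le_cvg_cst _ _ _ UP (fun i => l2partial (u i) N)).
    by apply: (cvg_real_sum UP) => n; exact: (cvg_sqr UP (nrm_cvg_nrm UP (hz n))).
  apply: (@filterE _ U) => i; apply: le_trans (l2partial_le _ _) _.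
  have C0 := le_trans (nrm_ge0 _) (uC i).
  by rewrite ler_sqr ?nnegrE ?nrm_ge0.
by move=> y hy _; exists y => n; rewrite hy.
Qed.

Lemma coord_cvg_unique u y z : coord_cvg u y -> coord_cvg u z -> y = z.
Proof.
move=> hy hz; apply: l2sum_ext => n; exact: (nrm_cvg_unique UP (hy n) (hz n)).
Qed.

Lemma coord_cvgD u v y z :
  coord_cvg u y -> coord_cvg v z -> coord_cvg (fun i => u i + v i) (y + z).
Proof.
by move=> hy hz n; exact: (nrm_cvgD UP (hy n) (hz n)).
Qed.

Lemma coord_cvgZ a u y : coord_cvg u y -> coord_cvg (fun i => a *: u i) (a *: y).
Proof.
by move=> hy n; rewrite linearZ; apply: eq_cvg_real (nrm_cvgZ UP a (hy n)) => i; rewrite linearZ.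
Qed.

Lemma coord_cvg_cst y : coord_cvg (fun=> y) y.
Proof. by move=> n; exact: nrm_cvg_cst. Qed.

Lemma nrm_cvg_coord u y : nrm_cvg U u y -> coord_cvg u y.
Proof.
move=> hu n; apply: (cvg0_le UP hu) => i; rewrite ger0_norm ?nrm_ge0 //.
by rewrite -raddfB; exact: nrm_coord_le.
Qed.

(** On finitely many coordinates coordinatewise convergence is norm convergence. *)
Lemma coord_cvg_trunc N u y : coord_cvg u y ->
  nrm_cvg U (fun i => trunc N (u i)) (trunc N y).
Proof.
move=> hu; rewrite trunc_sum; under eq_fun do rewrite trunc_sum.
apply: (nrm_cvg_sum UP) => n; apply: eq_cvg_real (hu n) => i.
by rewrite -(raddfB (@inj _ _ E n)) nrm_inj.
Qed.

(* A Brezis-Lieb type splitting: in the limit, z and w do not interact. *)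
Lemma coord_cvg_split (z : F) (w : I -> F) (C : R) :
  (forall i, nrm (w i) <= C) -> coord_cvg w 0 ->
  (nrm (z + w i) ^+ 2 - nrm (w i) ^+ 2) @[i --> U] --> nrm z ^+ 2.
Proof.
move=> wC w0.
have C0 : 0 <= C.
  by have [i _] := @filter_ex _ U UP _ filterT; exact: le_trans (nrm_ge0 _) (wC i).
suff : (nrm (z + w i) ^+ 2 - nrm (w i) ^+ 2 - nrm z ^+ 2) @[i --> U] --> (0 : R).
  move=> h; have := cvg_realD UP h (cvg_real_cst UP (a := nrm z ^+ 2)); rewrite add0r.
  by apply: eq_cvg_real => i; rewrite subrK.
apply: cvg0_approx => e e0.
have z0 := nrm_ge0 z.
have s0 : 0 < 4 * nrm z + 2 * C + 1 by lra.
(* Replacing z by a finitely supported z' within d costs at most d * (2 * nrm z + 2 * C) in one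
   square and d * (2 * nrm z) in the other; this choice keeps the total below e / 2. *)
have [d d0 h4] : exists2 d : R, 0 < d & d * (4 * nrm z + 2 * C + 1) = e / 2.
  exists (e / 2 / (4 * nrm z + 2 * C + 1)); first by rewrite !divr_gt0.
  by rewrite divfK // gt_eqF.
have [N [z' [z'N z'z hN]]] : exists N z',
    [/\ trunc N z' = z', nrm z' <= nrm z & nrm (z - z') < d].
  have [N hN] := trunc_approx z d0; exists N, (trunc N z); split; rewrite ?truncK //.
  by rewrite -ler_sqr ?nnegrE ?nrm_ge0 // (sqr_nrm_trunc N z) lerDl sqr_ge0.
have tw := coord_cvg_trunc N w0.
rewrite trunc0 in tw.
have h1 : (nrm (z' + trunc N (w i)) ^+ 2 - nrm (trunc N (w i)) ^+ 2) @[i --> U]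
    --> nrm z' ^+ 2.
  have a1 := cvg_sqr UP (nrm_cvg_nrm UP (nrm_cvgD UP (nrm_cvg_cst UP z') tw)).
  have a2 := cvg_sqr UP (nrm_cvg_nrm UP tw).
  by have := cvg_realB UP a1 a2; rewrite addr0 nrm0 expr0n subr0.
have e2 : 0 < e / 2 by rewrite divr_gt0.
have /(@cvgrPdist_lt _ _ _ U)/(_ _ e2) := h1.
apply: filterS => i.
(* The tail of w i contributes equally to both squares and cancels; the remaining heads converge in
   norm. *)
have ez : nrm (z' + w i) ^+ 2 - nrm (w i) ^+ 2 =
    nrm (z' + trunc N (w i)) ^+ 2 - nrm (trunc N (w i)) ^+ 2.
  rewrite (sqr_nrm_trunc_orth (w i) z'N) (sqr_nrm_trunc N (w i)); ring.
rewrite -ez => h.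
have h2 : `|nrm (z + w i) ^+ 2 - nrm (z' + w i) ^+ 2| <= d * (2 * nrm z + 2 * C).
  apply: ler_dist_sqr; rewrite ?nrm_ge0 //.
    apply: le_trans (ler_nrm_dist _ _) _.
    by rewrite opprD addrACA subrr addr0 ltW.
  by move: (ler_nrmD z (w i)) (ler_nrmD z' (w i)) (wC i) z'z; lra.
have h3 : `|nrm z ^+ 2 - nrm z' ^+ 2| <= d * (2 * nrm z).
  apply: ler_dist_sqr; rewrite ?nrm_ge0 //.
    by apply: le_trans (ler_nrm_dist _ _) _; rewrite ltW.
  by move: z'z; lra.
by move: h h2 h3 h4 d0; rewrite !ler_norml ltr_norml; lra.
Qed.

Variable c : nat -> R.
Hypothesis c_cvg : c n @[n --> \oo] --> (1 : R).
Hypothesis c_par : forall n (x y : E n),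
  nrm (x + y) ^+ 2 + nrm (x - y) ^+ 2 <= 2 * c n * (nrm x ^+ 2 + nrm y ^+ 2).

(** Only coordinates from N on survive on the left, and each has constant at most C. As c n tends to
    1, far tails are almost Hilbertian. *)
Lemma tail_par (C : R) N (x y : F) : 0 <= C -> (forall n, (N <= n)%N -> c n <= C) ->
  nrm ((x + y) - trunc N (x + y)) ^+ 2 + nrm ((x - y) - trunc N (x - y)) ^+ 2 <=
  2 * C * (nrm x ^+ 2 + nrm y ^+ 2).
Proof.
move=> C0 hC; apply: sqr_nrm_le_coordwise => n; rewrite !raddfB !raddfD /=.
rewrite !coord_trunc !raddfB !raddfD /=.
have s0 : 0 <= nrm (coord n x) ^+ 2 + nrm (coord n y) ^+ 2 by rewrite addr_ge0 ?sqr_ge0.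
case: ltnP => nN; first by rewrite !subrr nrm0 expr0n addr0 !mulr_ge0.
rewrite !subr0; apply: le_trans (c_par _ _) _.
by rewrite ler_wpM2r // ler_wpM2l // hC.
Qed.

Variable M : completeNormedModType K.
Variables (io : {linear F -> M}) (pr : {linear M -> F}).
Hypothesis ext : hilbert_extension io pr.

(** The heads of pr u and pr v vanish along U, the tails satisfy [tail_par] with constant 1 + d, and
    the Hilbert parts have constant 1; d is arbitrarily small. *)
Lemma coord_cvg0_par (u v : I -> M) (a b s t : R) :
  coord_cvg (pr \o u) 0 -> coord_cvg (pr \o v) 0 ->
  nrm (u i) ^+ 2 @[i --> U] --> a -> nrm (v i) ^+ 2 @[i --> U] --> b ->
  nrm (u i + v i) ^+ 2 @[i --> U] --> s -> nrm (u i - v i) ^+ 2 @[i --> U] --> t ->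
  s + t <= 2 * (a + b).
Proof.
move=> u0 v0 ua vb us vt.
have ab0 : 0 <= a + b.
  by apply: (ge_cvg_cst UP (cvg_realD UP ua vb)); apply: (@filterE _ U) => i;
    rewrite addr_ge0 ?sqr_ge0.
apply/ler_addgt0Pr => e e0.
have s0 : 0 < 2 * (a + b) + 1 by lra.
have [d d0 h4] : exists2 d : R, 0 < d & d * (2 * (a + b) + 1) = e.
  by exists (e / (2 * (a + b) + 1)); rewrite ?divr_gt0 // divfK // gt_eqF.
have /cvgrPdist_lt/(_ _ d0) [N _ hN] := c_cvg.
have hC n : (N <= n)%N -> c n <= 1 + d.
  by move=> /hN /=; rewrite ltr_norml; lra.
have C0 : 0 <= 1 + d by lra.
have tD : nrm (trunc N (pr (u i) + pr (v i))) ^+ 2 @[i --> U] --> (0 : R).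
  have := cvg_sqr UP (nrm_cvg_nrm UP (coord_cvg_trunc N (coord_cvgD u0 v0))).
  by rewrite addr0 trunc0 nrm0 expr0n.
have tB : nrm (trunc N (pr (u i) - pr (v i))) ^+ 2 @[i --> U] --> (0 : R).
  have := cvg_sqr UP (nrm_cvg_nrm UP (coord_cvg_trunc N
    (coord_cvgD u0 (coord_cvgZ (-1) v0)))).
  rewrite scaler0 addr0 trunc0 nrm0 expr0n.
  by apply: eq_cvg_real => i; rewrite scaleN1r.
have h : s + t <= 2 * (1 + d) * (a + b) + (0 + 0).
  apply: (le_cvg_real UP (cvg_realD UP us vt) (cvg_realD UP
    (cvg_realZ UP (c := 2 * (1 + d)) (cvg_realD UP ua vb)) (cvg_realD UP tD tB))).
  apply: (@filterE _ U) => i.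
  rewrite (hext_pyth ext (u i + v i)) (hext_pyth ext (u i - v i)).
  rewrite (sqr_nrm_trunc N (pr (u i + v i))) (sqr_nrm_trunc N (pr (u i - v i))).
  rewrite (hext_pyth ext (u i)) (hext_pyth ext (v i)).
  have := tail_par (pr (u i)) (pr (v i)) C0 hC; rewrite -raddfD -raddfB => hs.
  by apply: le_par_parts (hext_par_sub ext _ _); rewrite ?sqr_ge0 // lerDl ltW.
by move: h h4 d0; lra.
Qed.

(** The base is a Hilbert extension M of F, not only F itself, because [elementary_extension] takes
    an ultrapower of an ultrapower. The projection sends the class of x to the coordinatewise limit
    of the pr (x i). *)
Theorem ultrapower_extension :
  exists (io' : {linear F -> ultrapower UU M}) (pr' : {linear ultrapower UU M -> F}),
    hilbert_extension io' pr' /\ forall e, io' e = udiag UU (io e).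
Proof.
have /choice[p hp] : forall q : ultrapower UU M, exists z,
    forall x, uclass UU x = q -> coord_cvg (fun i => pr (linf_val x i)) z.
  move=> q; have [x <-] := uclass_surj q; have [C hC] := linf_bound x.
  have [i|z hz] := @coord_cvg_exists (fun i => pr (linf_val x i)) C.
    exact: le_trans (nrm_hext_pr ext _) (hC i).
  (* The limit does not depend on the representative, as pr is a contraction. *)
  exists z => y /uclass_eq yx.
  have yx0 : coord_cvg (fun i => pr (linf_val y i) - pr (linf_val x i)) 0.
    apply: nrm_cvg_coord; apply: (cvg0_le UP yx) => i.
    rewrite subr0 ger0_norm ?nrm_ge0 // -raddfB; exact: nrm_hext_pr ext _.
  have := coord_cvgD yx0 hz; rewrite add0r.
  by under eq_fun do rewrite subrK.
have p_linear : linear p.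
  move=> a q r; have [x xq] := uclass_surj q; have [y yr] := uclass_surj r.
  have h := hp (a *: q + r) (a *: x + y); rewrite uclassD uclassZ xq yr in h.
  apply: coord_cvg_unique (h erefl) _.
  have -> : (fun i => pr (linf_val (a *: x + y) i)) =
      (fun i => a *: pr (linf_val x i) + pr (linf_val y i)).
    by apply/funext => i; rewrite -linearP.
  by apply: coord_cvgD (hp _ _ yr); apply: coord_cvgZ; exact: hp.
pose pr' : {linear ultrapower UU M -> F} :=
  HB.pack p (GRing.isLinear.Build K (ultrapower UU M) F _ p p_linear).
pose io' : {linear F -> ultrapower UU M} := (udiag UU (X := M) \o io).
exists io', pr'; split=> //; split.
- move=> e; apply: (coord_cvg_unique (hp _ _ erefl)) => /=.
  by rewrite (hextK ext); exact: coord_cvg_cst.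
(* Write x i = io z + y i. Then pr (y i) tends coordinatewise to 0, and [coord_cvg_split] separates
   nrm z ^+ 2 from its squared norm; the Hilbert part of x i is that of y i. *)
- move=> q /=; have [x xq] := uclass_surj q; have hz := hp _ _ xq.
  set z := p q in hz *; have [C hC] := linf_bound x.
  pose y i := linf_val x i - io z.
  have [D hD] : exists D, forall i, nrm (y i) <= D.
    exists (C + nrm (io z)) => i; rewrite (le_trans (ler_nrmD _ _)) // nrmN lerD //.
  have yq : uclass UU (bfamily (ex_intro _ D hD)) = q - udiag UU (io z).
    by rewrite -xq -uclassB; congr uclass; apply/val_inj.
  have n1 := cvg_sqr UP (@nrm_uclass _ _ _ _ UU _ x); rewrite xq in n1.
  have n2 := cvg_sqr UP (@nrm_uclass _ _ _ _ UU _ (bfamily (ex_intro _ D hD))).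
  rewrite yq /= in n2.
  apply: (cvg_real_unique UP n1).
  pose w i := pr (y i).
  have wC i : nrm (w i) <= D by exact: le_trans (nrm_hext_pr ext _) (hD i).
  have w0 : coord_cvg w 0.
    have := coord_cvgD hz (coord_cvg_cst (- z)); rewrite subrr.
    by rewrite /w /y; under [X in _ -> coord_cvg X _]eq_fun do rewrite raddfB /= (hextK ext).
  apply: eq_cvg_real (cvg_realD UP (@coord_cvg_split z w D wC w0) n2) => i.
  rewrite (hext_pyth ext (y i)) -/(w i) (hext_pyth ext (linf_val x i)).
  have -> : pr (linf_val x i) = z + w i by rewrite /w raddfB /= (hextK ext) addrC subrK.
  by rewrite (raddfD io) opprD (addrA (linf_val x i)) -/(y i) addrA subrK.
- move=> q r /= q0 r0.
  have [x xq] := uclass_surj q; have [y yr] := uclass_surj r.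
  have hx := hp _ _ xq; have hy := hp _ _ yr; rewrite q0 in hx; rewrite r0 in hy.
  have nx := cvg_sqr UP (@nrm_uclass _ _ _ _ UU _ x).
  have ny := cvg_sqr UP (@nrm_uclass _ _ _ _ UU _ y).
  have nD := cvg_sqr UP (@nrm_uclass _ _ _ _ UU _ (x + y)).
  have nB := cvg_sqr UP (@nrm_uclass _ _ _ _ UU _ (x - y)).
  rewrite uclassD xq yr in nD; rewrite uclassB xq yr in nB.
  rewrite xq in nx; rewrite yr in ny.
  exact: coord_cvg0_par hx hy nx ny nD nB.
Qed.

End UltraExtension.

(** * Rigidity *)

Section IsometricRange.
Variables (R : realType) (k : scalar_kind).
Local Notation K := (scalars R k).
Variables (X : completeNormedModType K) (Y : normedModType K).
Variable T : {linear X -> Y}.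
Hypothesis T_iso : forall x, nrm (T x) = nrm x.

Lemma isometric_inj : injective T.
Proof.
move=> x y /eqP; rewrite -subr_eq0 -raddfB => /eqP h.
by apply/eqP; rewrite -subr_eq0; apply/eqP/nrm0_eq0; rewrite -T_iso h nrm0.
Qed.

(** Approximate preimages under an isometry form a Cauchy sequence. The rate is recorded so that
    closed conditions on the u n pass to the preimage. *)
Lemma isometric_range_seq (y : Y) (u : nat -> X) :
  (forall n, nrm (y - T (u n)) <= 2^-1 ^+ n) ->
  exists2 x, T x = y & forall n, nrm (u n - x) <= 2 * 2^-1 ^+ n.
Proof.
move=> hu.
have [x hx] : exists x, forall n, nrm (u n - x) <= 2 * 2^-1 ^+ n.
  apply: banach_fast_complete => n i ni; rewrite -T_iso raddfB /=.
  rewrite (_ : T (u n) - T (u i) = (y - T (u i)) - (y - T (u n))); last first.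
    by rewrite opprB [RHS]addrC addrA subrK.
  rewrite (le_trans (ler_nrmD _ _)) // nrmN mulr_natl mulr2n lerD //.
  by apply: le_trans (hu i) _; apply: ler_wiXn2l => //; lra.
exists x => //; apply/eqP; rewrite -subr_eq0; apply/eqP/nrm0_eq0/le_anti.
rewrite nrm_ge0 andbT; apply/ler_addgt0Pr => e e0; rewrite add0r.
have [N /(_ N (leqnn N)) hN] := half_exp_small 3 e0.
apply: le_trans (ltW hN).
rewrite (_ : T x - y = (T x - T (u N)) - (y - T (u N))); last first.
  by rewrite opprB addrA subrK.
rewrite (le_trans (ler_nrmD _ _)) // nrmN -raddfB T_iso nrmBC.
by have := hx N; have := hu N; lra.
Qed.

Lemma isometric_range_closed (y : Y) :
  (forall e, 0 < e -> exists x, nrm (y - T x) < e) -> exists x, T x = y.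
Proof.
move=> h; have /choice[u hu] n : exists x, nrm (y - T x) <= 2^-1 ^+ n.
  by have [x hx] := h _ (half_exp_gt0 R n); exists x; exact: ltW.
by have [x] := isometric_range_seq hu; exists x.
Qed.

End IsometricRange.

Lemma sqr_le1 (R : realType) (a : R) : 0 <= a -> a <= 1 -> a ^+ 2 <= 1.
Proof. by move=> a0 a1; rewrite -[leRHS](expr1n _ 2) ler_sqr ?nnegrE. Qed.

Lemma weighted_sqr_eq0 (R : realType) (s t a b : R) :
  0 < s -> 0 <= t -> s * a ^+ 2 + t * b ^+ 2 <= 0 -> a = 0.
Proof.
move=> s0 t0 h; apply/eqP; rewrite -sqrf_eq0; apply/eqP/le_anti.
rewrite sqr_ge0 andbT -(pmulr_rle0 _ s0); apply: le_trans h.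
by rewrite lerDl mulr_ge0 ?sqr_ge0.
Qed.

(** In [coord_above], p2 is the squared norm of pr X, a2 and d2 are those of its m-th coordinate and
    of the rest, and k2 that of the Hilbert part; the equations force 2 * a2 = 0. *)
Lemma orth_arith (R : realType) (x2 a2 d2 k2 p2 : R) :
  x2 + a2 = d2 + k2 -> x2 = p2 + k2 -> p2 = a2 + d2 -> a2 <= 0.
Proof. lra. Qed.

(** Here xm, x' and kx are the squared norms of the m-th coordinate, of the other coordinates and of
    the Hilbert part of one vector, and ym, y' and ky those of the other. The lower bound 4 * cn
    leaves no slack, whereas a part with constant cm or 1 in place of cn loses its weight times cn -
    cm or cn - 1. *)
Lemma saturation_arith (R : realType)
  (cn cm x2 y2 xm ym x' y' kx ky sD sB kD kB : R) :
  x2 <= 1 -> y2 <= 1 -> x2 = xm + x' + kx -> y2 = ym + y' + ky ->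
  0 <= xm -> 0 <= kx -> cm <= cn -> 1 <= cn ->
  sD + sB <= 2 * cm * (xm + ym) + 2 * cn * (x' + y') -> kD + kB <= 2 * (kx + ky) ->
  4 * cn <= sD + kD + (sB + kB) ->
  (cn - cm) * ym + (cn - 1) * ky <= 0.
Proof.
move=> x1 y1 ex ey xm0 kx0 mn n1 hs hk h.
have h1 : 0 <= (cn - cm) * xm by rewrite mulr_ge0 // subr_ge0.
have h2 : 0 <= (cn - 1) * kx by rewrite mulr_ge0 // subr_ge0.
have h3 : cn * x2 <= cn by rewrite ler_piMr // (le_trans _ n1).
have h4 : cn * y2 <= cn by rewrite ler_piMr // (le_trans _ n1).
move: h1 h2 h3 h4; rewrite ex ey; lra.
Qed.

Section Rigidity.
Variables (R : realType) (k : scalar_kind).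
Local Notation K := (scalars R k).
Variable E : nat -> completeNormedModType K.
Local Notation F := (l2sum E).
Hypothesis E_fd : forall n, finite_dimensional (E n).
Variable c : nat -> R.
Hypothesis c_gt1 : forall n, 1 < c n.
Hypothesis c_cvg : c n @[n --> \oo] --> (1 : R).
Hypothesis c_par : forall n (x y : E n),
  nrm (x + y) ^+ 2 + nrm (x - y) ^+ 2 <= 2 * c n * (nrm x ^+ 2 + nrm y ^+ 2).
Hypothesis c_pair : forall n, exists2 B : seq (E n), is_basis B &
  forall y, y \in B -> exists x : E n, [/\ nrm x <= 1, nrm y <= 1 &
    4 * c n <= nrm (x + y) ^+ 2 + nrm (x - y) ^+ 2].
Variable M : completeNormedModType K.
Variables (io : {linear F -> M}) (pr : {linear M -> F}).
Hypothesis ext : hilbert_extension io pr.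
Variable T : {linear F -> M}.
Hypothesis T_iso : forall x, nrm (T x) = nrm x.

(** Different indices may share a value of c, and T may mix them; the blocks treated one at a time
    are therefore the sums of all E m with equal c m. *)
Definition level n (w : F) := forall m, c m != c n -> coord m w = 0.

Definition level_onto n :=
  forall z : E n, exists2 w, level n w & T w = io (inj z).

Lemma level_inj n (z : E n) : level n (inj z).
Proof. by move=> m mn; apply: coord_inj_neq; apply: contra_neq mn => ->. Qed.

Lemma levelD n u v : level n u -> level n v -> level n (u + v).
Proof. by move=> hu hv m mn; rewrite raddfD /= hu // hv // addr0. Qed.

Lemma levelZ n a u : level n u -> level n (a *: u).
Proof. by move=> hu m mn; rewrite linearZ /= hu // scaler0. Qed.

Lemma level0 n : level n 0.
Proof. by move=> m _; rewrite raddf0. Qed.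

(** Coordinates with a constant above c n vanish, so c n serves for all of them; the m-th one keeps
    its own constant, in order to detect the loss when c m < c n. *)
Lemma level_par n (p q : F) m :
  (forall l, c n < c l -> coord l p = 0) -> (forall l, c n < c l -> coord l q = 0) ->
  nrm (p + q) ^+ 2 + nrm (p - q) ^+ 2 <=
  2 * c m * (nrm (coord m p) ^+ 2 + nrm (coord m q) ^+ 2) +
  2 * c n * (nrm (p - inj (coord m p)) ^+ 2 + nrm (q - inj (coord m q)) ^+ 2).
Proof.
move=> hp hq; rewrite (sqr_nrm_split m (p + q)) (sqr_nrm_split m (p - q)).
rewrite addrACA (raddfD (coord m)) (raddfB (coord m)) /=.
apply: lerD; first exact: c_par.
rewrite (raddfD (@inj _ _ E m)) (raddfB (@inj _ _ E m)) opprD (addrACA p q).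
rewrite (opprD (inj (coord m p))) (addrACA p (- q)) -(opprD q).
apply: sqr_nrm_le_coordwise => l.
rewrite (raddfD (coord l)) (raddfB (coord l) (p - _) (q - _)).
have a0 (x : F) : (forall i, c n < c i -> coord i x = 0) ->
    l = m \/ c n < c l -> coord l (x - inj (coord m x)) = 0.
  move=> hx [->|nl]; first by rewrite raddfB /= coord_inj subrr.
  have [<-|lm] := eqVneq l m; first by rewrite raddfB /= coord_inj subrr.
  by rewrite raddfB /= hx // coord_inj_neq // subrr.
have [cl|cl] := pselect (l = m \/ c n < c l).
  by rewrite /= !a0 // subrr addr0 nrm0 expr0n addr0 mulr0.
apply: le_trans (c_par _ _) _; rewrite ler_wpM2r ?addr_ge0 ?sqr_ge0 // ler_wpM2l //.
by rewrite leNgt; apply/negP => h; apply: cl; right.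
Qed.

Section Step.
Variable n : nat.
Hypothesis above : forall m, c n < c m -> level_onto m.

(* w is l2-orthogonal to inj x, so T w = io (inj a) is l2-orthogonal to
   T (inj x), whose m-th coordinate is a. *)
Lemma coord_above (x : E n) m : c n < c m -> coord m (pr (T (inj x))) = 0.
Proof.
move=> nm; set X := T (inj x); set a := coord m (pr X).
have [w lw Tw] := above nm a.
have wn : coord n w = 0 by apply: lw; rewrite lt_eqF.
have e1 : nrm (inj x - w) ^+ 2 = nrm x ^+ 2 + nrm w ^+ 2.
  rewrite (sqr_nrm_split n) raddfB /= coord_inj wn subr0 addrC [inj x - w]addrC addrK.
  by rewrite addrC nrmN.
have e2 := hext_sub_io ext X (inj a).
have e3 := hext_pyth ext X.
have e4 := sqr_nrm_split m (pr X); rewrite -/a in e4.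
have nX : nrm X = nrm x by rewrite T_iso nrm_inj.
have nw : nrm w = nrm a by rewrite -T_iso Tw (nrm_hext_io ext) nrm_inj.
have e5 : nrm (X - io (inj a)) = nrm (inj x - w) by rewrite -Tw -raddfB T_iso.
rewrite nX in e3; rewrite e5 e1 nw in e2.
apply: nrm0_eq0; apply/eqP; rewrite -sqrf_eq0; apply/eqP/le_anti.
by rewrite sqr_ge0 andbT; exact: orth_arith e2 e3 e4.
Qed.

Lemma saturated_level (x y : E n) m : nrm x <= 1 -> nrm y <= 1 ->
  4 * c n <= nrm (x + y) ^+ 2 + nrm (x - y) ^+ 2 -> c m <= c n ->
  (c n - c m) * nrm (coord m (pr (T (inj y)))) ^+ 2 +
  (c n - 1) * nrm (T (inj y) - io (pr (T (inj y)))) ^+ 2 <= 0.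
Proof.
move=> x1 y1 hxy mn; have ax := coord_above x; have ay := coord_above y.
have nX : nrm (T (inj x)) = nrm x by rewrite T_iso nrm_inj.
have nY : nrm (T (inj y)) = nrm y by rewrite T_iso nrm_inj.
have {hxy} : 4 * c n <= nrm (T (inj x) + T (inj y)) ^+ 2 + nrm (T (inj x) - T (inj y)) ^+ 2.
  by rewrite -(raddfD T) -(raddfB T) !T_iso -(raddfD (@inj _ _ E n))
    -(raddfB (@inj _ _ E n)) !nrm_inj.
move: (T (inj x)) (T (inj y)) ax ay nX nY => X Y ax ay nX nY.
rewrite (hext_pyth ext (X + Y)) (hext_pyth ext (X - Y)) => h.
have hk := hext_par_sub ext X Y.
have hs := level_par m ax ay; rewrite -(raddfD pr) -(raddfB pr) in hs.
have eX := hext_pyth ext X; have eY := hext_pyth ext Y.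
rewrite (sqr_nrm_split m (pr X)) nX in eX; rewrite (sqr_nrm_split m (pr Y)) nY in eY.
exact: (saturation_arith (sqr_le1 (nrm_ge0 x) x1) (sqr_le1 (nrm_ge0 y) y1) eX eY
  (sqr_ge0 _) (sqr_ge0 _) mn (ltW (c_gt1 n)) hs hk h).
Qed.

(* The pair saturates the parallelogram defect c n, which no coordinate m with
   c m < c n and no vector of ker pr can do. *)
Lemma pair_level (x y : E n) : nrm x <= 1 -> nrm y <= 1 ->
  4 * c n <= nrm (x + y) ^+ 2 + nrm (x - y) ^+ 2 ->
  level n (pr (T (inj y))) /\ T (inj y) = io (pr (T (inj y))).
Proof.
move=> x1 y1 hxy.
have h m := saturated_level (m := m) x1 y1 hxy.
split=> [m mn|].
  have [cm|cm|cm] := ltgtP (c n) (c m); first exact: coord_above.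
    apply: nrm0_eq0; apply: weighted_sqr_eq0 (h m (ltW cm)); rewrite ?subr_gt0 //.
    by rewrite subr_ge0 ltW.
  by rewrite -cm eqxx in mn.
apply/eqP; rewrite -subr_eq0; apply/eqP/nrm0_eq0.
have := h n (lexx _); rewrite addrC; apply: weighted_sqr_eq0; rewrite ?subr_gt0 //.
by rewrite subrr.
Qed.

(** The conclusion is linear in y, and condition (b) puts every vector of some basis into a
    saturating pair. *)
Lemma level_image (y : E n) :
  level n (pr (T (inj y))) /\ T (inj y) = io (pr (T (inj y))).
Proof.
have [B hB Bp] := c_pair n.
have [a ->] := hB.1 y.
elim/big_ind: _ => [|u v [u1 u2] [v1 v2]|i _].
- by rewrite !raddf0; split=> //; exact: level0.
- rewrite (raddfD (@inj _ _ E n)) (raddfD T) (raddfD pr) (raddfD io) /= -u2 -v2.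
  by split=> //; exact: levelD.
- have [x [x1 y1 hxy]] := Bp _ (mem_nth 0 (ltn_ord i)).
  have [h1 h2] := pair_level x1 y1 hxy.
  rewrite (linearZZ (@inj _ _ E n)) (linearZZ T) (linearZZ pr) (linearZZ io) /= -h2.
  by split=> //; exact: levelZ.
Qed.

End Step.

Section Onto.
Variable n : nat.
Hypothesis image : forall m, c m = c n -> forall y : E m,
  level n (pr (T (inj y))) /\ T (inj y) = io (pr (T (inj y))).

(** As c tends to 1 < c n, only finitely many indices share the value c n. *)
Lemma level_bound : exists N, forall w, level n w -> trunc N w = w.
Proof.
have e0 : 0 < c n - 1 by rewrite subr_gt0.
have /cvgrPdist_lt/(_ _ e0) [N _ hN] := c_cvg.
exists N => w lw; apply: l2sum_ext => m; rewrite coord_trunc; case: ltnP => // Nm.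
rewrite lw //; have := hN m Nm; rewrite /= ltr_norml => /andP[h _].
by rewrite lt_eqF //; move: h; rewrite opprB ltrD2l ltrN2.
Qed.

Lemma level_self w : level n w ->
  level n (pr (T w)) /\ T w = io (pr (T w)).
Proof.
have [N hN] := level_bound; move=> lw; rewrite -(hN w lw) trunc_sum.
elim/big_ind: _ => [|u v [u1 u2] [v1 v2]|m _].
- by rewrite !raddf0; split=> //; exact: level0.
- by rewrite (raddfD T) (raddfD pr) (raddfD io) /= -u2 -v2; split=> //; exact: levelD.
- have [e|/eqP ne] := eqVneq (c m) (c n); first exact: image.
  rewrite lw; last exact/eqP.
  by rewrite !raddf0; split=> //; exact: level0.
Qed.

Let S (w : F) := pr (T w).

Let SB u v : S (u - v) = S u - S v.
Proof. by rewrite /S (raddfB T) (raddfB pr). Qed.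

Let nrmS w : level n w -> nrm (S w) = nrm w.
Proof.
by move=> lw; rewrite -(nrm_hext_io ext) -(level_self lw).2 T_iso.
Qed.

(* An isometry of a finite dimensional space is onto: by compactness the orbit
   of a vector returns close to it. *)
Lemma level_recurrent w (e : R) : level n w -> 0 < e ->
  exists2 v, level n v & nrm (w - S v) < e.
Proof.
move=> lw e0; have [N hN] := level_bound.
have [U UU hU] := nonprincipal_ultrafilter; have UP := @ultra_proper _ _ UU.
have liter j : level n (iter j S w).
  by elim: j => //= j lj; exact: (level_self lj).1.
have niter j : nrm (iter j S w) = nrm w by elim: j => //= j <-; exact: nrmS.
have [z hz] := @coord_cvg_exists _ _ _ E_fd _ _ UU (fun j => iter j S w) (nrm w)
  (fun j => ltac:(by rewrite niter)).
have e2 : 0 < e / 2 by rewrite divr_gt0.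
have h := coord_cvg_trunc UU N hz.
have {}h : U [set j | nrm (iter j S w - trunc N z) < e / 2].
  have /(@cvgrPdist_lt _ _ _ U)/(_ _ e2) := h.
  by apply: filterS => j /=; rewrite hN // sub0r normrN ger0_norm ?nrm_ge0.
(* Two iterates with i < j close to the limit are close to each other. Since S is isometric on the
   level, cancelling i steps shows that w is close to its iterate of order j - i, which is S v for v
   the iterate of order j - i - 1. *)
have [i /= hi] := @filter_ex _ U UP _ h.
have [j [/= hj ij]] := @filter_ex _ U UP _ (filterI h (hU i.+1)).
exists (iter (j - i.+1) S w) => //; rewrite -iterS -subSn // subSS.
have back l : nrm (iter l S w - iter (l + (j - i)) S w) = nrm (w - iter (j - i) S w).
  elim: l => // l <-; rewrite addSn !iterS -SB nrmS //.
  move=> m mn; rewrite raddfB /= !liter ?subrr //.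
rewrite -(back i) subnKC ?(ltnW ij) //.
rewrite (_ : iter i S w - iter j S w =
  (iter i S w - trunc N z) + (trunc N z - iter j S w)); last by rewrite addrA subrK.
apply: le_lt_trans (ler_nrmD _ _) _; rewrite [ltRHS]splitr ltrD //.
by rewrite nrmBC.
Qed.

(** By recurrence io (inj z) is a limit of images T v with v in the level. The preimages converge,
    and their limit stays in the level. *)
Lemma level_onto_step : level_onto n.
Proof.
move=> z.
have /choice[u hu] j : exists v, level n v /\ nrm (io (inj z) - T v) <= 2^-1 ^+ j.
  have [v lv hv] := level_recurrent (level_inj z) (half_exp_gt0 R j).
  exists v; split=> //; rewrite (level_self lv).2 -(raddfB io) (nrm_hext_io ext).
  exact: ltW.
have [w Tw hw] := isometric_range_seq T_iso (fun j => (hu j).2).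
exists w => // m mn; apply: nrm0_eq0; apply/le_anti; rewrite nrm_ge0 andbT.
apply/ler_addgt0Pr => e e0; rewrite add0r.
have [N /(_ N (leqnn N)) hN] := half_exp_small 2 e0.
apply: le_trans (ltW hN); apply: le_trans (hw N).
have -> : coord m w = - coord m (u N - w).
  by rewrite (raddfB (coord m)) /= ((hu N).1 m mn) sub0r opprK.
by rewrite nrmN nrm_coord_le.
Qed.

End Onto.

(** Induction over the values of c in decreasing order, in the form of a counterexample with the
    largest value. It exists because only finitely many indices m have c m >= c n. *)
Lemma all_level_onto n : level_onto n.
Proof.
apply: contrapT => bad.
have e0 : 0 < c n - 1 by rewrite subr_gt0.
have /cvgrPdist_lt/(_ _ e0) [N _ hN] := c_cvg.
(* All indices with value at least c n, including n, lie below this bound, so maximizing over a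
   finite ordinal suffices. *)
have small m : (maxn N n.+1 <= m)%N -> c m < c n.
  rewrite geq_max => /andP[Nm _]; have := hN m Nm.
  by rewrite /= ltr_norml => /andP[h _]; move: h; rewrite opprB ltrD2l ltrN2.
have nN : (n < maxn N n.+1)%N by rewrite leq_maxr.
have badn : `[< ~ level_onto (Ordinal nN) >] by exact/asboolP.
case: (@arg_maxP _ R _ (Ordinal nN) (fun i => `[< ~ level_onto i >])
  (fun i => c i) badn) => i /asboolP badi maxi.
apply: badi; apply: level_onto_step => m cm y.
have lm : level m =1 level i by move=> w; rewrite /level cm.
rewrite -lm; apply: level_image => l ml; apply: contrapT => badl.
have cnl : c n < c l.
  by apply: le_lt_trans ml; rewrite cm; exact: maxi badn.
have lN : (l < maxn N n.+1)%N.
  by rewrite ltnNge; apply/negP => /small; rewrite ltNge ltW.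
by have := maxi (Ordinal lN) (asboolT badl); rewrite /= leNgt -cm ml.
Qed.

(** On truncations the Hilbert part of T x is zero, and truncations are dense, which gives one
    inclusion. For the other, the range of T is closed and contains the images under io of all
    truncations. *)
Theorem rigidity : range T = range io.
Proof.
have img n (y : E n) : T (inj y) = io (pr (T (inj y))).
  by have [] := level_image (fun m _ => all_level_onto (n := m)) y.
apply/seteqP; split=> _ [x _ <-].
  exists (pr (T x)) => //; apply/eqP; rewrite eq_sym -subr_eq0; apply/eqP/nrm0_eq0/le_anti.
  rewrite nrm_ge0 andbT; apply/ler_addgt0Pr => e e0; rewrite add0r.
  have [N hN] := trunc_approx x e0.
  have tr : T (trunc N x) = io (pr (T (trunc N x))).
    rewrite trunc_sum !raddf_sum; apply: eq_bigr => m _; exact: img.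
  have -> : T x - io (pr (T x)) =
      T (x - trunc N x) - io (pr (T (x - trunc N x))).
    rewrite (raddfB T) (raddfB pr) (raddfB io) /= -tr.
    by rewrite opprB [RHS]addrA subrK.
  apply: le_trans (ltW hN); rewrite -(T_iso (x - _)) -ler_sqr ?nnegrE ?nrm_ge0 //.
  by rewrite [leRHS](hext_pyth ext) lerDr sqr_ge0.
have [w <-] : exists w, T w = io x; last by exists w.
apply: (isometric_range_closed T_iso) => e e0.
have [N hN] := trunc_approx x e0.
have /choice[w hw] (m : 'I_N) : exists w, T w = io (inj (coord m x)).
  by have [w _ Tw] := all_level_onto (coord m x); exists w.
exists (\sum_m w m); rewrite raddf_sum /= (eq_bigr _ (fun m _ => hw m)).
by rewrite -raddf_sum -trunc_sum -(raddfB io) (nrm_hext_io ext).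
Qed.

End Rigidity.

(** * Inner products *)

Section InnerProduct.
Variables (R : realType) (k : scalar_kind).
Local Notation K := (scalars R k).

Lemma conj_scalarD : {morph @conj_scalar R k : a b / a + b}.
Proof. by rewrite /conj_scalar; case: k => //; exact: rmorphD. Qed.

Lemma conj_scalarM : {morph @conj_scalar R k : a b / a * b}.
Proof. by rewrite /conj_scalar; case: k => //; exact: rmorphM. Qed.

Lemma conj_of_real (a : R) : conj_scalar (of_real k a) = of_real k a.
Proof. by rewrite /conj_scalar /of_real; case: k => //=; rewrite oppr0. Qed.

Lemma mul_conj_scalar (a : K) : a * conj_scalar a = of_real k (nrm a ^+ 2).
Proof.
rewrite expr2 of_realM nrmE; move: a; rewrite /conj_scalar; case: k => a /=.
  by rewrite -normrM ger0_norm // -expr2 sqr_ge0.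
by rewrite -expr2 sqr_normc.
Qed.

Variable H : completeNormedModType K.

(** An unbundled form of the structure in [hilbert], so that a form defined by polarization can be
    tested as a plain function. Conjugate-linearity in the second argument follows from [ipC]. *)
Record inner_product (d : H -> H -> K) : Prop := InnerProduct {
  ipP : forall a x y z, d (a *: x + y) z = a * d x z + d y z;
  ipC : forall x y, d x y = conj_scalar (d y x);
  ip_nrm : forall x, d x x = of_real k (nrm x ^+ 2) }.

Lemma hilbert_inner_product : hilbert H -> exists d, inner_product d.
Proof.
case=> dot hdot; exists dot; split.
- by move=> a x y z; rewrite linearDl linearZl_LR.
- move=> x y; have := @hermitian_subproof _ _ _ _ dot x y.
  by rewrite expr0 mul1r.
- by move=> x; rewrite hdot -nrmE !expr2 of_realM.
Qed.

Section Theory.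
Variable d : H -> H -> K.
Hypothesis dP : inner_product d.

Lemma ipDl x y z : d (x + y) z = d x z + d y z.
Proof. by have := ipP dP 1 x y z; rewrite scale1r mul1r. Qed.

Lemma ip0l z : d 0 z = 0.
Proof. by apply: (addrI (d 0 z)); rewrite -ipDl !addr0. Qed.

Lemma ipZl a x z : d (a *: x) z = a * d x z.
Proof. by have := ipP dP a x 0 z; rewrite ip0l !addr0. Qed.

Lemma ipNl x z : d (- x) z = - d x z.
Proof. by rewrite -scaleN1r ipZl mulN1r. Qed.

Lemma ipDr x y z : d z (x + y) = d z x + d z y.
Proof. by rewrite ipC // ipDl conj_scalarD -!ipC. Qed.

Lemma ipZr a x z : d z (a *: x) = conj_scalar a * d z x.
Proof. by rewrite ipC // ipZl conj_scalarM -ipC. Qed.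

Lemma ipNr x z : d z (- x) = - d z x.
Proof.
apply/eqP; rewrite -subr_eq0 opprK -ipDr addNr; apply/eqP.
by rewrite ipC // ip0l -(of_real0 R k) conj_of_real.
Qed.

Lemma ip_parallelogram (x y : H) :
  nrm (x + y) ^+ 2 + nrm (x - y) ^+ 2 = 2 * (nrm x ^+ 2 + nrm y ^+ 2).
Proof.
apply: (can_inj (@of_realK R k)); rewrite of_realM !of_realD -!(ip_nrm dP).
rewrite !ipDl !ipDr !ipNl !ipNr opprK addrACA [d x x + _ + _]addrACA.
rewrite !of_real1; ring.
Qed.

Lemma inner_product_hilbert : hilbert H.
Proof.
have addl z : zmod_morphism (d ^~ z) by move=> x y; rewrite ipDl ipNl.
have addr z : zmod_morphism (d z) by move=> x y; rewrite ipDr ipNr.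
have scal z : scalable_for *%R (d ^~ z) by move=> a x; exact: ipZl.
have scar z : scalable_for (@conj_scalar R k \; *%R) (d z) by move=> a x; exact: ipZr.
have dC x y : d x y = (-1) ^+ false * conj_scalar (d y x).
  by rewrite expr0 mul1r; exact: ipC.
have dpos x : x != 0 -> 0 < d x x.
  move=> x0; rewrite ip_nrm // -(of_real0 R k) ltr_of_real exprn_gt0 //.
  rewrite lt_neqAle nrm_ge0 andbT eq_sym; apply: contra_neq x0.
  exact: nrm0_eq0.
pose dot : {dot H for @conj_scalar R k} := HB.pack d
  (isBilinear.Build K H H K *%R (@conj_scalar R k \; *%R) d
    addl addr scal scar)
  (isHermitianSesquilinear.Build K H false (@conj_scalar R k) d dC)
  (isDotProduct.Build K H d dpos).
by exists dot => x; rewrite /= ip_nrm // !expr2 of_realM nrmE.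
Qed.

End Theory.
End InnerProduct.

(** An additive g with g 1 = 0 is invariant under integer translations, so the bound on [0, 1] holds
    everywhere; at 2^N t it reads 2^N |g t| <= C. *)
Lemma bounded_additive_eq0 (R : realType) (g : R -> R) (C : R) :
  zmod_morphism g -> g 1 = 0 -> (forall t, 0 <= t -> t <= 1 -> `|g t| <= C) ->
  forall t, g t = 0.
Proof.
move=> gB g1 gC t.
pose G : {additive R -> R} := HB.pack g (GRing.isZmodMorphism.Build R R g gB).
apply/eqP; rewrite -normr_eq0; apply/eqP/le_anti; rewrite normr_ge0 andbT.
apply/ler_addgt0Pr => e e0; rewrite add0r.
have [N /(_ N (leqnn N)) hN] := half_exp_small C e0.
apply: le_trans (ltW hN); rewrite exprVn ler_pdivlMr ?exprn_gt0 // -natrX.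
rewrite -(ger0_norm (ler0n R _)) -normrM mulr_natr -[g t]/(G t) -raddfMn.
set s := t *+ _.
have -> : G s = G (s - (Num.floor s)%:~R).
  by rewrite raddfB raddfMz (_ : G 1 = 0) ?mul0rz ?subr0.
have := Num.Theory.floor_itv s; rewrite intrD => /andP[h1 h2].
by apply: gC; rewrite ?subr_ge0 // lerBlDl ltW.
Qed.

(** * The Jordan-von Neumann theorem *)

Section JordanVonNeumann.
Variables (R : realType) (k : scalar_kind).
Local Notation K := (scalars R k).
Variable H : completeNormedModType K.
Hypothesis par : forall u v : H,
  nrm (u + v) ^+ 2 + nrm (u - v) ^+ 2 <= 2 * (nrm u ^+ 2 + nrm v ^+ 2).
Implicit Types x y z u v : H.

Lemma double_scale x : x + x = of_real k 2 *: x.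
Proof.
have -> : of_real k 2 = (1 + 1 : K) by rewrite -(of_real1 R k) -of_realD.
by rewrite scalerDl scale1r.
Qed.

(** The reverse inequality is the hypothesis at u + v and u - v, whose sum and difference are 2u and
    2v. *)
Lemma parallelogram u v :
  nrm (u + v) ^+ 2 + nrm (u - v) ^+ 2 = 2 * (nrm u ^+ 2 + nrm v ^+ 2).
Proof.
apply: le_anti; rewrite par /=.
have := par (u + v) (u - v).
rewrite addrACA subrr addr0 opprD opprK addrACA subrr add0r !double_scale !nrmZ.
rewrite !exprMn nrm_of_real ger0_norm //.
move: (nrm u ^+ 2) (nrm v ^+ 2) (nrm (u + v) ^+ 2) (nrm (u - v) ^+ 2) => a b s t; lra.
Qed.

(** Polarization: the real part of the inner product to be constructed. *)
Definition polar x y : R := (nrm (x + y) ^+ 2 - nrm (x - y) ^+ 2) / 4.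

Lemma polarC x y : polar x y = polar y x.
Proof. by rewrite /polar (addrC x) (nrmBC x). Qed.

Lemma polarNl x y : polar (- x) y = - polar x y.
Proof.
by rewrite /polar -opprD nrmN (addrC (- x)) (nrmBC y) -[RHS]mulNr opprB.
Qed.

Lemma polarD_sub x y z : polar (x + y) z + polar (x - y) z = 2 * polar x z.
Proof.
have h1 := parallelogram (x + z) y; have h2 := parallelogram (x - z) y.
rewrite /polar (addrAC x y z) (addrAC x y (- z)) (addrAC x (- y) z) (addrAC x (- y) (- z)).
move: h1 h2; move: (nrm (x + z + y)) (nrm (x + z - y)) (nrm (x - z + y)) (nrm (x - z - y)).
move: (nrm (x + z)) (nrm (x - z)) (nrm y) => a b c s t u v; lra.
Qed.

(** Adding [polarD_sub] to its version with x and y exchanged cancels the terms in x - y. *)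
Lemma polarDl x y z : polar (x + y) z = polar x z + polar y z.
Proof.
have h1 := polarD_sub x y z; have h2 := polarD_sub y x z.
rewrite -(opprB x) polarNl addrC (addrC y) in h2.
move: h1 h2; move: (polar (x + y) z) (polar (x - y) z) (polar x z) (polar y z).
move=> a b c s; lra.
Qed.

Lemma polar_bound x y : `|polar x y| <= (nrm x + nrm y) ^+ 2.
Proof.
have h1 := ler_nrmD x y; have h2 := ler_nrmD x (- y); rewrite nrmN in h2.
have h3 : nrm (x + y) ^+ 2 <= (nrm x + nrm y) ^+ 2.
  by rewrite ler_sqr ?nnegrE ?addr_ge0 ?nrm_ge0.
have h4 : nrm (x - y) ^+ 2 <= (nrm x + nrm y) ^+ 2.
  by rewrite ler_sqr ?nnegrE ?addr_ge0 ?nrm_ge0.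
have h5 := sqr_ge0 (nrm (x + y)); have h6 := sqr_ge0 (nrm (x - y)).
rewrite /polar ler_norml; move: h3 h4 h5 h6.
move: (nrm (x + y) ^+ 2) (nrm (x - y) ^+ 2) ((nrm x + nrm y) ^+ 2) => a b c; lra.
Qed.

(** The defect of homogeneity is additive in t, vanishes at 1 and is bounded on [0, 1], so
    [bounded_additive_eq0] applies. *)
Lemma polarZl (t : R) x z : polar (of_real k t *: x) z = t * polar x z.
Proof.
apply/eqP; rewrite -subr_eq0; apply/eqP.
pose g (t : R) := polar (of_real k t *: x) z - t * polar x z.
apply: (@bounded_additive_eq0 R g ((nrm x + nrm z) ^+ 2 + `|polar x z|)).
- move=> s u; rewrite /g.
  have -> : of_real k (s - u) = of_real k s + - of_real k u.
    apply/eqP; rewrite eq_sym subr_eq -of_realD subrK //.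
  by rewrite scalerDl scaleNr polarDl polarNl; ring.
- by rewrite /g of_real1 scale1r mul1r subrr.
- move=> s s0 s1; rewrite /g; apply: le_trans (ler_normB _ _) _; apply: lerD.
    apply: le_trans (polar_bound _ _) _.
    rewrite ler_sqr ?nnegrE ?addr_ge0 ?nrm_ge0 // nrmZ nrm_of_real ger0_norm //.
    by rewrite lerD2r ler_piMl ?nrm_ge0.
  by rewrite normrM (ger0_norm s0) ler_piMl.
Qed.

Lemma polar_self x : polar x x = nrm x ^+ 2.
Proof.
rewrite /polar subrr nrm0 double_scale nrmZ nrm_of_real ger0_norm //.
by rewrite exprMn expr0n subr0; field.
Qed.

Lemma polar_unit (a : K) x y : nrm a = 1 -> polar (a *: x) (a *: y) = polar x y.
Proof. by move=> a1; rewrite /polar -scalerDr -scalerBr !nrmZ a1 !mul1r. Qed.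

End JordanVonNeumann.

Lemma jordan_von_neumann (R : realType) (k : scalar_kind)
  (H : completeNormedModType (scalars R k)) :
  (forall u v : H,
    nrm (u + v) ^+ 2 + nrm (u - v) ^+ 2 <= 2 * (nrm u ^+ 2 + nrm v ^+ 2)) ->
  hilbert H.
Proof.
case: k H => H par.
  apply: (@inner_product_hilbert _ _ _ (@polar R RealScalars H)); split.
  - by move=> a x y z; rewrite polarDl // -(polarZl par a).
  - by move=> x y; rewrite polarC.
  - by move=> x; rewrite polar_self.
pose i : scalars R ComplexScalars := 'i%C.
have i1 : nrm i = 1 by rewrite nrm_complexE /= expr0n expr1n add0r sqrtr1.
have ii (x : H) : i *: (i *: x) = - x.
  rewrite scalerA -scaleN1r; congr (_ *: x).
  by have := sqr_i R; rewrite expr2.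
have polarNr (x y : H) : polar x (- y) = - polar x y.
  by rewrite polarC polarNl polarC.
have ir (x y : H) : polar (i *: x) y = - polar x (i *: y).
  by rewrite -(polar_unit _ _ i1) ii polarNl.
(* For a form conjugate-linear in its second argument, the imaginary part at (x, y) is the real part
   at (x, i y). *)
pose d (x y : H) : scalars R ComplexScalars := (polar x y +i* polar x (i *: y))%C.
apply: (@inner_product_hilbert _ _ _ d); split.
- move=> a x y z; rewrite /d !polarDl //.
  have -> : a *: x = of_real ComplexScalars (complex.Re (a : R[i])) *: x +
      i *: (of_real ComplexScalars (complex.Im (a : R[i])) *: x).
    rewrite scalerA -scalerDl; congr (_ *: x).
    by case: a => p q; apply/eqP; rewrite eq_complex /=; apply/andP; split; apply/eqP; simpc; ring.
  rewrite !polarDl // !ir !polarZl // ii polarNr.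
  case: a => p q; apply/eqP; rewrite eq_complex /=; apply/andP; split; apply/eqP; ring.
- move=> x y; rewrite /d; apply/eqP; rewrite eq_complex /=; apply/andP; split.
    by rewrite polarC.
  by rewrite -ir polarC.
- move=> x; rewrite /d polar_self //.
  have -> : polar x (i *: x) = 0; last by [].
  have := ir x x; rewrite polarC; move: (polar _ _) => a; lra.
Qed.

Lemma nrm_eq_norm (R : realType) (k : scalar_kind)
  (X Y : normedModType (scalars R k)) (x : X) (y : Y) :
  nrm x = nrm y <-> `|x| = `|y|.
Proof. by split=> [h|h]; [rewrite -!nrmE h|rewrite /nrm h]. Qed.

(** * Splitting off the Hilbert summand *)

Section Kernel.
Variables (R : realType) (k : scalar_kind).
Local Notation K := (scalars R k).
Variables F M : completeNormedModType K.
Variable pr : {linear M -> F}.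
Hypothesis pr_le : forall x, nrm (pr x) <= nrm x.

Definition kernel_pred : {pred M} := fun x => pr x == 0.

Lemma kernel_closed : submod_closed kernel_pred.
Proof.
split=> [|a x y /eqP hx /eqP hy]; first by rewrite unfold_in raddf0.
by rewrite unfold_in linearP hx hy scaler0 addr0.
Qed.

HB.instance Definition _ :=
  GRing.isSubmodClosed.Build K M kernel_pred kernel_closed.

Record kernel_vec := KernelVec { kval :> M ; kvalP : kval \in kernel_pred }.

HB.instance Definition _ := [isSub for kval].
HB.instance Definition _ := [Choice of kernel_vec by <:].
HB.instance Definition _ := [SubChoice_isSubLmodule of kernel_vec by <:].

Lemma kernel_banach_norm : @banach_norm R k kernel_vec (fun x => nrm (kval x)).
Proof.
split=> [x|x y|a x|x x0|u hu].
- exact: nrm_ge0.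
- exact: ler_nrmD.
- by rewrite nrmZ.
- exact/val_inj/nrm0_eq0.
- have [l hl] : exists l, forall n, nrm (kval (u n) - l) <= 1 * 2^-1 ^+ n.
    by apply: banach_fast_complete => n i ni; rewrite mul1r; exact: hu.
  have lP : l \in kernel_pred.
    apply/eqP/nrm0_eq0/le_anti; rewrite nrm_ge0 andbT.
    apply/ler_addgt0Pr => e e0; rewrite add0r.
    have [N /(_ N (leqnn N)) hN] := half_exp_small 1 e0.
    apply: le_trans (ltW hN); apply: le_trans (hl N).
    have /eqP uN := kvalP (u N).
    rewrite -nrmN -[- pr l]add0r -uN -raddfB; exact: pr_le.
  by exists (KernelVec lP), 1.
Qed.

Definition kernel_space : completeNormedModType K := banach_of kernel_banach_norm.

End Kernel.

Section Splitting.
Variables (R : realType) (k : scalar_kind).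
Local Notation K := (scalars R k).
Variables F M : completeNormedModType K.

(** H is the kernel of pr, a Hilbert space by Jordan-von Neumann, and x is sent to its two
    components pr x and x - io (pr x). *)
Lemma hilbert_extension_split (io : {linear F -> M}) (pr : {linear M -> F}) :
  hilbert_extension io pr ->
  exists2 H : completeNormedModType K, hilbert H & linearly_isometric M (l2prod F H).
Proof.
move=> ext; pose H := kernel_space (nrm_hext_pr ext); exists H.
  apply: jordan_von_neumann => u v; rewrite !nrm_banach_of.
  by apply: (hext_par ext); apply/eqP/kvalP.
have nH (h : H) : nrm h = nrm (kval (h : kernel_vec pr)) by exact: nrm_banach_of.
have hk x : x - io (pr x) \in kernel_pred pr by apply/eqP; exact: hext_pr_sub.
pose T x : l2prod F H := (pr x, KernelVec (hk x)).
have T_linear : linear T.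
  move=> a x y; congr pair; first exact: linearP.
  apply/val_inj; rewrite /= (linearP pr) (linearP io) opprD addrACA.
  by rewrite -scalerBr.
pose T' : {linear M -> l2prod F H} :=
  HB.pack T (GRing.isLinear.Build K M (l2prod F H) _ T T_linear).
exists T'.
  move=> x; apply/nrm_eq_norm; rewrite nrm_l2prod /= nH.
  by rewrite -(hext_pyth ext) sqrtr_sqr ger0_norm ?nrm_ge0.
apply/seteqP; split=> // -[e [h hP]] _.
have /eqP h0 := hP.
exists (io e + h) => //=; congr pair.
  by rewrite raddfD /= (hextK ext) h0 addr0.
by apply/val_inj; rewrite /= raddfD /= (hextK ext) h0 addr0 addrC addKr.
Qed.

Lemma l2prod_extension (H : completeNormedModType K) : hilbert H ->
  exists (io : {linear F -> l2prod F H}) (pr : {linear l2prod F H -> F}),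
    hilbert_extension io pr /\ forall e, io e = l2inl F H e.
Proof.
move=> /hilbert_inner_product[d dP].
have io_linear : linear (l2inl F H).
  by move=> a x y; congr pair; rewrite /= scaler0 addr0.
have pr_linear : linear (fst : l2prod F H -> F) by [].
pose io : {linear F -> l2prod F H} :=
  HB.pack (l2inl F H) (GRing.isLinear.Build K F (l2prod F H) _ _ io_linear).
pose pr : {linear l2prod F H -> F} := HB.pack (fst : l2prod F H -> F)
  (GRing.isLinear.Build K (l2prod F H) F _ _ pr_linear).
exists io, pr; split=> //; split=> //.
- move=> x; rewrite !nrm_l2prod !sqr_sqrtr ?addr_ge0 ?sqr_ge0 //=.
  by rewrite subrr nrm0 expr0n add0r subr0.
- move=> u v /= u0 v0; rewrite !nrm_l2prod !sqr_sqrtr ?addr_ge0 ?sqr_ge0 //=.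
  rewrite u0 v0 addr0 subrr nrm0 expr0n !add0r.
  by rewrite (ip_parallelogram dP).
Qed.

Lemma self_extension : exists (io pr : {linear F -> F}),
  hilbert_extension io pr /\ forall e, io e = e.
Proof.
exists idfun, idfun; split=> //; split=> //=.
  by move=> x; rewrite subrr nrm0 expr0n addr0.
by move=> u v -> ->; rewrite addr0 subrr nrm0 expr0n addr0 mulr0.
Qed.

End Splitting.

(** * The elementary class *)

Section LinearIsometries.
Variables (R : realType) (k : scalar_kind).
Local Notation K := (scalars R k).
Implicit Types X Y Z : completeNormedModType K.

Lemma isometry_inverse X Y (T : {linear X -> Y}) :
  (forall x, nrm (T x) = nrm x) -> range T = setT ->
  exists2 G : {linear Y -> X}, forall y, nrm (G y) = nrm y & cancel T G /\ cancel G T.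
Proof.
move=> Tiso Tonto.
have /choice[g hg] y : exists x, T x = y.
  have : range T y by rewrite Tonto.
  by case=> x _ <-; exists x.
have g_linear : linear g.
  by move=> a x y; apply: (isometric_inj Tiso); rewrite linearP /= !hg.
exists (HB.pack_for {linear Y -> X} g (GRing.isLinear.Build K Y X _ g g_linear)).
  by move=> y; rewrite -Tiso /= hg.
by split=> // x; apply: (isometric_inj Tiso); rewrite hg.
Qed.

Lemma linearly_isometric_sym X Y : linearly_isometric X Y -> linearly_isometric Y X.
Proof.
case=> T Tiso Tonto.
have [G Giso [TG GT]] := isometry_inverse (fun x => (nrm_eq_norm _ _).2 (Tiso x)) Tonto.
exists G => [y|]; first exact/nrm_eq_norm.
by apply/seteqP; split=> // x _; exists (T x).
Qed.

Lemma linearly_isometric_trans X Y Z :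
  linearly_isometric X Y -> linearly_isometric Y Z -> linearly_isometric X Z.
Proof.
move=> [S Siso Sonto] [T Tiso Tonto]; exists (T \o S)%FUN.
  by move=> x; rewrite /= Tiso Siso.
apply/seteqP; split=> // z _; have : range T z by rewrite Tonto.
case=> y _ <-; have : range S y by rewrite Sonto.
by case=> x _ <-; exists x.
Qed.

Lemma ultrapower_map (I : Type) (U : set_system I) (UU : UltraFilter U) X Y
  (j : {linear X -> Y}) : (forall x, nrm (j x) = nrm x) ->
  exists2 f : {linear ultrapower UU X -> ultrapower UU Y},
    forall q, nrm (f q) = nrm q &
    forall (x : linf I X) (y : linf I Y),
      (forall i, linf_val y i = j (linf_val x i)) -> f (uclass UU x) = uclass UU y.
Proof.
move=> jiso; have UP := @ultra_proper _ _ UU.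
have jb (x : linf I X) : exists C, forall i, nrm (j (linf_val x i)) <= C.
  by have [C hC] := linf_bound x; exists C => i; rewrite jiso.
pose f (q : ultrapower UU X) := uclass UU (bfamily (jb (quot_repr q))).
have fE (x : linf I X) (y : linf I Y) :
    (forall i, linf_val y i = j (linf_val x i)) -> f (uclass UU x) = uclass UU y.
  move=> yx; apply/uclass_eq => /=.
  have /uclass_eq : uclass UU (quot_repr (uclass UU x)) = uclass UU x.
    exact: quot_reprK.
  by apply: eq_cvg_real => i; rewrite yx -(raddfB j) jiso.
have f_linear : linear f.
  move=> a p q; have [x <-] := uclass_surj p; have [y <-] := uclass_surj q.
  rewrite (fE x (bfamily (jb x))) // (fE y (bfamily (jb y))) //.
  rewrite -!uclassZ -!uclassD; apply: fE => i /=.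
  by rewrite (linearP j).
pose f' : {linear ultrapower UU X -> ultrapower UU Y} :=
  HB.pack f (GRing.isLinear.Build K (ultrapower UU X) (ultrapower UU Y) _ f f_linear).
exists f' => //= q; have [x <-] := uclass_surj q.
rewrite (fE x (bfamily (jb x))) //; apply: nrm_uclass_eq.
by apply: eq_cvg_real (@nrm_uclass _ _ _ _ UU _ x) => i; rewrite /= jiso.
Qed.

(* X_U is isometric to its own ultrapower along the principal ultrafilter on a
   point. *)
Lemma elementarily_equivalent_ultrapower (I : Type) (U : set_system I)
  (UU : UltraFilter U) X : elementarily_equivalent X (ultrapower UU X).
Proof.
pose VV := @principal_filter_ultra unit tt.
exists I, unit, U, _, UU, VV.
exists (udiag VV (X := ultrapower UU X)) => [x|].
  by apply/nrm_eq_norm; exact: nrm_udiag.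
apply/seteqP; split=> // q _; have [x <-] := uclass_surj q.
exists (linf_val x tt) => //; symmetry; apply/uclass_udiag.
apply: cvg0_approx => e e0; apply/principal_filterP.
by rewrite /= subrr nrm0 normr0 ltW.
Qed.

End LinearIsometries.

Section ElementaryClass.
Variables (R : realType) (k : scalar_kind).
Local Notation K := (scalars R k).
Variable E : nat -> completeNormedModType K.
Local Notation F := (l2sum E).
Hypothesis E_fd : forall n, finite_dimensional (E n).
Variable c : nat -> R.
Hypothesis c_gt1 : forall n, 1 < c n.
Hypothesis c_cvg : c n @[n --> \oo] --> (1 : R).
Hypothesis c_par : forall n (x y : E n),
  nrm (x + y) ^+ 2 + nrm (x - y) ^+ 2 <= 2 * c n * (nrm x ^+ 2 + nrm y ^+ 2).
Hypothesis c_pair : forall n, exists2 B : seq (E n), is_basis B &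
  forall y, y \in B -> exists x : E n, [/\ nrm x <= 1, nrm y <= 1 &
    4 * c n <= nrm (x + y) ^+ 2 + nrm (x - y) ^+ 2].

(* With j : Y -> M := F_U the isometry T^-1 o diag, rigidity applied to
   F -> M ~ Y_V -> M_V shows that the copy of F in M lies in the range of j. *)
Theorem elementary_extension (Y : completeNormedModType K) :
  elementarily_equivalent F Y ->
  exists (io : {linear F -> Y}) (pr : {linear Y -> F}), hilbert_extension io pr.
Proof.
case=> I [J [U [V [UU [VV [T Tiso Tonto]]]]]].
have VP := @ultra_proper _ _ VV.
have Tnrm x : nrm (T x) = nrm x by apply/nrm_eq_norm.
have [G Gnrm [TG GT]] := isometry_inverse Tnrm Tonto.
have [io [pr [ext _]]] := self_extension F.
have [io0 [pr0 [ext0 _]]] := ultrapower_extension E_fd UU c_cvg c_par ext.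
have [io1 [pr1 [ext1 io1E]]] := ultrapower_extension E_fd VV c_cvg c_par ext0.
pose j : {linear Y -> ultrapower UU F} := (G \o udiag VV (X := Y))%FUN.
have jnrm y : nrm (j y) = nrm y by rewrite /= Gnrm nrm_udiag.
have [jV jVnrm jVE] := ultrapower_map VV jnrm.
pose P : {linear F -> ultrapower VV (ultrapower UU F)} := (jV \o (T \o io0))%FUN.
have Pnrm x : nrm (P x) = nrm x by rewrite /= jVnrm Tnrm (nrm_hext_io ext0).
have rP := rigidity E_fd c_gt1 c_cvg c_par c_pair ext1 Pnrm.
have /choice[s hs] e : exists y, j y = io0 e.
  have [y yT] := uclass_surj (T (io0 e)); have [C hC] := linf_bound y.
  have jb : exists C, forall i, nrm (j (linf_val y i)) <= C.
    by exists C => i; rewrite jnrm.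
  (* By rigidity the class of the j (y i) in M_V is diagonal over the copy of F, so the j (y i)
     converge along V to some io0 e'. The range of j is closed, hence io0 e' = j y0. *)
  have : range io1 (P e) by rewrite -rP; exists e.
  case=> e' _; rewrite /= -yT (jVE y (bfamily jb)) // io1E => h.
  have /uclass_udiag {}h := esym h.
  have [y0 jy0] : exists y0, j y0 = io0 e'.
    apply: (isometric_range_closed jnrm) => d d0.
    have /(@cvgrPdist_lt _ _ _ V)/(_ _ d0) hd := h.
    have [i hi] := @filter_ex _ V VP _ hd; exists (linf_val y i).
    by move: hi; rewrite /= sub0r normrN ger0_norm ?nrm_ge0 // nrmBC.
  (* As j is isometric, the y i converge to y0; so T (io0 e) is the diagonal class of y0, and
     applying G gives j y0 = io0 e. *)
  exists y0; rewrite -[RHS]TG -yT /=; congr (G _); symmetry; apply/uclass_udiag.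
  by apply: eq_cvg_real h => i; rewrite -jy0 -(raddfB j) jnrm.
have s_linear : linear s.
  move=> a x y; apply: (isometric_inj jnrm).
  by rewrite (linearP j) /= -![G _]/(j _) !hs linearP.
pose s' : {linear F -> Y} := HB.pack s (GRing.isLinear.Build K F Y _ s s_linear).
(* The range of j contains the copy of F, so the decomposition of M restricts to it. *)
exists s', (pr0 \o j)%FUN; split.
- by move=> e; rewrite -[RHS](hextK ext0) -hs.
- move=> y; rewrite -jnrm (hext_pyth ext0) /= -hs; congr (_ + _ ^+ 2).
  by rewrite -[G _]/(j _) -(raddfB j) jnrm.
- move=> u v u0 v0.
  by have := hext_par ext0 u0 v0; rewrite -(raddfD j) -(raddfB j) !jnrm.
Qed.

End ElementaryClass.

(** * Cardinal arithmetic *)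

Definition embeds (A B : Type) := exists f : A -> B, injective f.

Lemma embeds_trans (A B C : Type) : embeds A B -> embeds B C -> embeds A C.
Proof. by move=> [f hf] [g hg]; exists (g \o f); exact: inj_comp. Qed.

Lemma embeds_prod (A B C D : Type) :
  embeds A B -> embeds C D -> embeds (A * C) (B * D).
Proof.
move=> [f hf] [g hg]; exists (fun p => (f p.1, g p.2)).
by move=> [a c] [a' c'] [/hf -> /hg ->].
Qed.

Lemma embeds_count (A : countType) : embeds A nat.
Proof. by exists pickle; exact: pcan_inj pickleK. Qed.

Lemma card_leE (T U : Type) (A : set T) (B : set U) :
  (A #<= B)%card <-> embeds A B.
Proof.
split=> [/card_leP/injfunPex[f _ hf]|[f hf]].
  by exists f => x y; apply: hf; rewrite inE.
by apply/card_leP/injfunPex; exists f => // x y _ _; exact: hf.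
Qed.

Lemma embeds_setT (T : Type) : embeds [set: T] T /\ embeds T [set: T].
Proof.
split; first by exists val; exact: val_inj.
by exists (fun x => exist _ x (mem_set I)) => x y [].
Qed.

Lemma card_leTE (T U : Type) : ([set: T] #<= [set: U])%card <-> embeds T U.
Proof.
have [Tl Tr] := embeds_setT T; have [Ul Ur] := embeds_setT U.
split=> [/card_leE h|h]; first exact: embeds_trans Tr (embeds_trans h Ul).
by apply/card_leE; exact: embeds_trans Tl (embeds_trans h Ur).
Qed.

(** Zorn's lemma for graphs of partial injections. If a maximal one misses a point on each side, the
    pair of these points can be added. *)
Lemma embeds_total (A B : Type) : embeds A B \/ embeds B A.
Proof.
pose P (G : set (A * B)) :=
  (forall a b b', G (a, b) -> G (a, b') -> b = b') /\
  (forall a a' b, G (a, b) -> G (a', b) -> a = a').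
have [|G [[G1 G2] Gmax]] := @Zorn_bigcup _ P.
  move=> C CP Ctot.
  have two p q : (\bigcup_(X in C) X) p -> (\bigcup_(X in C) X) q ->
      exists2 X, P X & X p /\ X q.
    move=> [X CX Xp] [Y CY Yq].
    have [XY|YX] := Ctot _ _ CX CY; first by exists Y; [exact: CP|split=> //; exact: XY].
    by exists X; [exact: CP|split=> //; exact: YX].
  split=> [a b b' h h'|a a' b h h']; have [X [X1 X2] [x y]] := two _ _ h h'.
    exact: X1 x y.
  exact: X2 x y.
have [/choice[f hf]|/existsNP[a0 ha0]] := pselect (forall a, exists b, G (a, b)).
  by left; exists f => a a' e; apply: (G2 _ _ (f a)) => //; rewrite e.
have [/choice[g hg]|/existsNP[b0 hb0]] := pselect (forall b, exists a, G (a, b)).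
  by right; exists g => b b' e; apply: (G1 (g b)) => //; rewrite e.
exfalso; apply: (Gmax (G `|` [set (a0, b0)])).
  split; first by move=> q Hq; left.
  by move=> /(_ (a0, b0)) h; apply: ha0; exists b0; apply: h; right.
split=> [a b b'|a a' b].
- move=> [h|/pair_equal_spec[ea eb]] [h'|/pair_equal_spec[ea' eb']].
  + exact: G1 h h'.
  + by exfalso; apply: ha0; exists b; rewrite -ea'.
  + by exfalso; apply: ha0; exists b'; rewrite -ea.
  + by rewrite eb eb'.
- move=> [h|/pair_equal_spec[ea eb]] [h'|/pair_equal_spec[ea' eb']].
  + exact: G2 h h'.
  + by exfalso; apply: hb0; exists a; rewrite -eb'.
  + by exfalso; apply: hb0; exists a'; rewrite -eb.
  + by rewrite ea ea'.
Qed.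

(** * Squares of infinite cardinals *)

Section Square.
Variable A : Type.
Implicit Type G : set ((A * A) * A).

(** G is meant as the graph of an injection of S * S into S; S is read off from the diagonal of its
    domain. *)
Definition carrier G : set A := [set x | exists z, G ((x, x), z)].

Definition square_injection G :=
  [/\ forall p z z', G (p, z) -> G (p, z') -> z = z',
      forall p p' z, G (p, z) -> G (p', z) -> p = p',
      forall x y z, G ((x, y), z) -> [/\ carrier G x, carrier G y & carrier G z] &
      forall x y, carrier G x -> carrier G y -> exists z, G ((x, y), z)].

(** Any two entries of the union lie in one member of the chain together with G0. Adjoining G0 keeps
    its carrier inside every carrier met by Zorn's lemma. *)
Lemma square_injection_chain (C : set (set ((A * A) * A))) G0 :
  square_injection G0 -> (forall X, C X -> square_injection (X `|` G0)) ->
  total_on C subset -> square_injection ((\bigcup_(X in C) X) `|` G0).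
Proof.
move=> hG0 CP Ctot; set W := _ `|` G0.
have sub X : C X -> X `|` G0 `<=` W.
  by move=> CX p [Xp|]; [left; exists X|right].
have two p q : W p -> W q ->
    exists Y, [/\ square_injection Y, Y `<=` W, Y p & Y q].
  move=> [[X CX Xp]|Gp] [[Y CY Yq]|Gq].
  - have [XY|YX] := Ctot _ _ CX CY.
      exists (Y `|` G0); split; [exact: CP|exact: sub|left; exact: XY|by left].
    exists (X `|` G0); split; [exact: CP|exact: sub|by left|left; exact: YX].
  - by exists (X `|` G0); split; [exact: CP|exact: sub|left|right].
  - by exists (Y `|` G0); split; [exact: CP|exact: sub|right|left].
  - by exists G0; split=> // p' ?; right.
have up Y x : Y `<=` W -> carrier Y x -> carrier W x.
  by move=> YW [z hz]; exists z; exact: YW.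
split.
- by move=> p z z' h h'; have [Y [[Y1 _ _ _] _ a b]] := two _ _ h h'; exact: Y1 a b.
- by move=> p p' z h h'; have [Y [[_ Y2 _ _] _ a b]] := two _ _ h h'; exact: Y2 a b.
- move=> x y z h; have [Y [[_ _ Y3 _] YW a _]] := two _ _ h h.
  by have [cx cy cz] := Y3 _ _ _ a; split; exact: up YW _.
- move=> x y [z h] [z' h']; have [Y [[_ _ _ Y4] YW a b]] := two _ _ h h'.
  have [w hw] := Y4 x y (ex_intro _ _ a) (ex_intro _ _ b).
  by exists w; exact: YW.
Qed.

Lemma square_injection_nat (i : nat -> A) : injective i ->
  square_injection [set ((i mn.1, i mn.2), i (pickle mn)) | mn in [set: nat * nat]].
Proof.
move=> hi; set G := (X in square_injection X).
have iG n : carrier G (i n) by exists (i (pickle (n, n))); exists (n, n).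
split.
- by move=> p z z' [[m n] _ [<- <-]] [[m' n'] _ [/hi -> /hi -> <-]].
- move=> p p' z [[m n] _ [<- <-]] [[m' n'] _ [<-]].
  by move=> /hi/(pcan_inj pickleK)[-> ->].
- by move=> x y z [[m n] _ [<- <- <-]].
- move=> x y [_ [[m n] _ [<- _ _]]] [_ [[m' n'] _ [<- _ _]]].
  by exists (i (pickle (m, m'))); exists (m, m').
Qed.

(* If S injects into its complement by h, the injection S * S -> S extends to
   the union of S and h S, the new pairs being sent into h S. *)
Lemma square_injection_extend M (i : nat -> A) (h : carrier M -> A) :
  square_injection M -> injective i -> (forall n, carrier M (i n)) ->
  injective h -> (forall s, ~ carrier M (h s)) ->
  exists N, [/\ square_injection (M `|` N), N !=set0 & forall p, N p -> ~ M p].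
Proof.
move=> [M1 M2 M3 M4] hi iM hh hM; pose S : Type := carrier M.
have cS (s : S) : carrier M (val s) := set_mem (valP s).
pose mkS x (hx : carrier M x) : S := exist _ x (mem_set hx).
have /choice[f hf] (p : S * S) : exists s : S, M ((val p.1, val p.2), val s).
  have [z hz] := M4 _ _ (cS p.1) (cS p.2).
  by have [_ _ cz] := M3 _ _ _ hz; exists (mkS _ cz).
have f_inj : injective f.
  move=> [a b] [a' b'] e; have h1 := hf (a, b); have h2 := hf (a', b').
  rewrite e in h1; have /pair_equal_spec[ea eb] := M2 _ _ _ h1 h2.
  by congr pair; apply: val_inj.
pose u (t : bool) (a : S) := if t then h a else val a.
have u_inj t t' a a' : u t a = u t' a' -> t = t' /\ a = a'.
  rewrite /u; case: t; case: t' => e.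
  - by split=> //; exact: hh.
  - by case: (hM a); rewrite e.
  - by case: (hM a'); rewrite -e.
  - by split=> //; exact: val_inj.
(* The tags record which of the two coordinates of a pair lie in h S, so that the three kinds of new
   pairs get disjoint codes. *)
pose tag (t t' : bool) := mkS _ (iM (pickle (t, t'))).
have tag_inj t t' r r' : tag t t' = tag r r' -> (t, t') = (r, r').
  by move=> /(congr1 val)/hi/(pcan_inj pickleK).
pose v t t' a b := h (f (tag t t', f (a, b))).
have v_inj t t' a b r r' a' b' : v t t' a b = v r r' a' b' ->
    [/\ t = r, t' = r', a = a' & b = b'].
  by move=> /hh/f_inj/pair_equal_spec[/tag_inj[-> ->]] /f_inj[-> ->].
pose N : set ((A * A) * A) := [set p | exists t t' a b,
  t || t' /\ p = ((u t a, u t' b), v t t' a b)].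
have NM x y z : N ((x, y), z) -> forall w, ~ M ((x, y), w).
  move=> [[] [[] [a [b [// _ [-> -> _]]]]]] w /M3[ca cb _].
  - exact: hM ca.
  - exact: hM ca.
  - exact: hM cb.
have s0 : S := mkS _ (iM 0).
have cM x : carrier M x -> carrier (M `|` N) x by move=> [z hz]; exists z; left.
have cN t a : carrier (M `|` N) (u t a).
  case: t; last exact/cM/cS.
  by exists (v true true a a); right; exists true, true, a, a.
have cE x : carrier (M `|` N) x -> exists t a, x = u t a.
  move=> [z [hz|[t [t' [a [b [_ [-> _ _]]]]]]]]; last by exists t, a.
  by have [cx _ _] := M3 _ _ _ hz; exists false, (mkS _ cx).
exists N; split; last first.
- by move=> [[x y] z] /NM; apply.
- by exists ((u true s0, u true s0), v true true s0 s0), true, true, s0, s0.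
split.
- move=> [x y] z z' [m|n] [m'|n'].
  + exact: M1 m m'.
  + by have [] := NM _ _ _ n' _ m.
  + by have [] := NM _ _ _ n _ m'.
  + case: n n' => t [t' [a [b [_ [-> -> ->]]]]].
    by case=> r [r' [a' [b' [_ [/u_inj[-> ->] /u_inj[-> ->] ->]]]]].
- move=> [x y] [x' y'] z [m|n] [m'|n'].
  + exact: M2 m m'.
  + case: n' => r [r' [a' [b' [_ [_ _ e]]]]]; have [_ _] := M3 _ _ _ m.
    by rewrite e => /hM.
  + case: n => r [r' [a' [b' [_ [_ _ e]]]]]; have [_ _] := M3 _ _ _ m'.
    by rewrite e => /hM.
  + case: n n' => t [t' [a [b [_ [-> -> ->]]]]].
    by case=> r [r' [a' [b' [_ [-> -> /v_inj[-> -> -> ->]]]]]].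
- move=> x y z [/M3[cx cy cz]|[t [t' [a [b [_ [-> -> ->]]]]]]]; first by split; exact: cM.
  by split; [exact: cN|exact: cN|exact: (cN true)].
- move=> x y /cE[t [a ->]] /cE[t' [b ->]].
  have [tt|] := boolP (t || t').
    by exists (v t t' a b); right; exists t, t', a, b.
  rewrite negb_or => /andP[/negPf -> /negPf ->].
  by have [z hz] := M4 _ _ (cS a) (cS b); exists z; left.
Qed.

(** Take a maximal square injection, with carrier S. If the complement of S embeds in S, then A
    embeds in S * S, hence in S, and A * A embeds in S * S, S and A in turn. Otherwise S embeds in
    its complement, and [square_injection_extend] contradicts maximality. *)
Theorem embeds_square : embeds nat A -> embeds (A * A) A.
Proof.
move=> [i hi]; have := square_injection_nat hi.
set G0 := (X in square_injection X) => hG0.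
have [H [HP Hmax]] := @Zorn_bigcup _ (fun X => square_injection (X `|` G0))
  (fun C CP Ctot => square_injection_chain hG0 CP Ctot).
set M := H `|` G0 in HP.
have iM n : carrier M (i n) by exists (i (pickle (n, n))); right; exists (n, n).
have [M1 M2 M3 M4] := HP; pose S : Type := carrier M.
have cS (s : S) : carrier M (val s) := set_mem (valP s).
have SS : embeds (S * S) S.
  have /choice[f hf] (p : S * S) : exists s : S, M ((val p.1, val p.2), val s).
    have [z hz] := M4 _ _ (cS p.1) (cS p.2).
    by have [_ _ cz] := M3 _ _ _ hz; exists (exist _ z (mem_set cz)).
  exists f => -[a b] [a' b'] e; have h1 := hf (a, b); have h2 := hf (a', b').
  rewrite e in h1; have /pair_equal_spec[ea eb] := M2 _ _ _ h1 h2.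
  by congr pair; apply: val_inj.
have SA : embeds S A by exists val; exact: val_inj.
have [[g hg]|[h hh]] := embeds_total (~` carrier M) S.
  suff AS : embeds A (S * S).
    have AS' := embeds_trans AS SS.
    exact: (embeds_trans (embeds_trans (embeds_prod AS' AS') SS) SA).
  pose s0 : S := exist _ (i 0) (mem_set (iM 0)).
  pose s1 : S := exist _ (i 1) (mem_set (iM 1)).
  have s01 : s0 <> s1 by move=> /(congr1 val)/hi.
  have /choice[f hf] a : exists p : S * S,
      (exists s : S, val s = a /\ p = (s0, s)) \/
      (exists s : ~` carrier M, val s = a /\ p = (s1, g s)).
    have [ca|nca] := pselect (carrier M a).
      exists (s0, exist _ a (mem_set ca)); left.
      by exists (exist _ a (mem_set ca)).
    exists (s1, g (exist _ a (mem_set (nca : (~` carrier M) a)))); right.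
    by exists (exist _ a (mem_set (nca : (~` carrier M) a))).
  exists f => a b.
  case: (hf a) => -[s [<- ->]]; case: (hf b) => -[t [<- ->]] /pair_equal_spec[].
  - by move=> _ ->.
  - by move/s01.
  - by move/esym/s01.
  - by move=> _ /hg ->.
pose h' (s : carrier M) := val (h s).
have [|s|N [N1 [p Np] N3]] := @square_injection_extend M i h' HP hi iM.
- by move=> s t /val_inj/hh.
- exact: (set_mem (valP (h s))).
exfalso; apply: (Hmax (H `|` N)).
  split; first by move=> q Hq; left.
  by move=> /(_ p) Hp; apply: (N3 p Np); left; apply: Hp; right.
by rewrite setUAC.
Qed.

End Square.

(** A sequence is coded by its length and the iterated pairing of its entries; the length tells how
    often to unpair. *)
Lemma embeds_seq (A : Type) : embeds nat A -> embeds (seq A) A.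
Proof.
move=> nA; have [g hg] := embeds_square nA; have [i hi] := nA.
apply: embeds_trans (embeds_square nA); exists (fun s =>
  (i (size s), foldr (fun a b => g (a, b)) (i 0) s)).
elim=> [|a s IH] [|b t] //= /pair_equal_spec[/hi //= [] e /hg[-> h]].
by rewrite (IH t) // e h.
Qed.

Lemma embeds_sum (A B : Type) : embeds nat A -> embeds B A -> embeds (B + A) A.
Proof.
move=> nA [f hf]; have [i hi] := nA; apply: embeds_trans (embeds_square nA).
exists (fun x => match x with inl b => (i 0, f b) | inr a => (i 1, a) end).
move=> [b|a] [b'|a'] [].
- by move=> /hf ->.
- by move=> /hi.
- by move=> /hi.
- by move=> ->.
Qed.

(** * Orthonormal bases *)

Section Combinations.
Variables (R : realType) (k : scalar_kind).
Local Notation K := (scalars R k).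
Implicit Types X Y : completeNormedModType K.

(** Indices may repeat in a formal combination, which makes concatenation the addition. *)
Definition comb (T : Type) (X : lmodType K) (g : T -> X) (s : seq (K * T)) : X :=
  \sum_(z <- s) z.1 *: g z.2.

Definition total_family (T : Type) X (g : T -> X) :=
  forall x (e : R), 0 < e -> exists s, nrm (x - comb g s) < e.

Lemma comb_cat (T : Type) (X : lmodType K) (g : T -> X) s t :
  comb g (s ++ t) = comb g s + comb g t.
Proof. by rewrite /comb big_cat. Qed.

Lemma comb_scale (T : Type) (X : lmodType K) (g : T -> X) a s :
  comb g [seq (a * z.1, z.2) | z <- s] = a *: comb g s.
Proof.
by rewrite /comb big_map scaler_sumr; apply: eq_bigr => z _; rewrite scalerA.
Qed.

Lemma comb1 (T : Type) (X : lmodType K) (g : T -> X) t : comb g [:: (1, t)] = g t.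
Proof. by rewrite /comb big_seq1 scale1r. Qed.

Section Extend.
Variables (T : Type) (X Y : completeNormedModType K) (g : T -> X) (h : T -> Y).
Hypothesis gh : forall s, nrm (comb g s) = nrm (comb h s).

(** The closure of the graph of the correspondence between [comb g s] and [comb h s], which is
    isometric by [gh]. *)
Definition comb_limit (x : X) (y : Y) := forall e : R, 0 < e ->
  exists s, nrm (x - comb g s) < e /\ nrm (y - comb h s) < e.

Lemma comb_limit_exists x : total_family g -> exists y, comb_limit x y.
Proof.
move=> tg.
have /choice[s hs] n : exists s, nrm (x - comb g s) <= 2^-1 ^+ n.
  by have [s hs] := tg x _ (half_exp_gt0 R n); exists s; exact: ltW.
have [y hy] : exists y, forall n, nrm (comb h (s n) - y) <= 2 * 2^-1 ^+ n.
  apply: banach_fast_complete => n i ni.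
  rewrite -[- comb h (s i)]scaleN1r -comb_scale -comb_cat -gh comb_cat comb_scale scaleN1r.
  rewrite (_ : comb g (s n) - comb g (s i) = (x - comb g (s i)) - (x - comb g (s n))).
    rewrite (le_trans (ler_nrmD _ _)) // nrmN mulr_natl mulr2n lerD //.
    by apply: le_trans (hs i) _; apply: ler_wiXn2l => //; lra.
  by rewrite opprB [RHS]addrC addrA subrK.
exists y => e e0; have [N /(_ N (leqnn N)) hN] := half_exp_small 2 e0.
exists (s N); split; last by rewrite nrmBC; exact: le_lt_trans (hy N) hN.
apply: le_lt_trans (hs N) _; apply: le_lt_trans hN.
by rewrite ler_peMl ?ltW ?half_exp_gt0 // ltr1n.
Qed.

Lemma comb_limit_nrm x y : comb_limit x y -> nrm x = nrm y.
Proof.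
move=> xy; apply/eqP; rewrite -subr_eq0 -normr_eq0; apply/eqP/le_anti.
rewrite normr_ge0 andbT; apply/ler_addgt0Pr => e e0; rewrite add0r.
have e2 : 0 < e / 2 by rewrite divr_gt0.
have [s [h1 h2]] := xy _ e2.
have h3 := ler_nrm_dist x (comb g s); have h4 := ler_nrm_dist y (comb h s).
rewrite gh in h3; move: h1 h2 h3 h4.
move: (nrm (x - _)) (nrm (y - _)) (nrm (comb h s)) (nrm x) (nrm y) => a b c p q.
by rewrite !ler_norml; lra.
Qed.

Lemma comb_limitP a x x' y y' :
  comb_limit x y -> comb_limit x' y' -> comb_limit (a *: x + x') (a *: y + y').
Proof.
move=> xy xy' e e0; have a0 := nrm_ge0 a.
have e1 : 0 < e / 2 / (nrm a + 1) by rewrite !divr_gt0 // ltr_wpDl.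
have e2 : 0 < e / 2 by rewrite divr_gt0.
have [s [h1 h2]] := xy _ e1; have [t [h3 h4]] := xy' _ e2.
have bound (Z : completeNormedModType K) (u v u' v' : Z) :
    nrm (u - v) < e / 2 / (nrm a + 1) -> nrm (u' - v') < e / 2 ->
    nrm (a *: u + u' - (a *: v + v')) < e.
  move=> k1 k2; rewrite opprD addrACA -scalerBr (le_lt_trans (ler_nrmD _ _)) // nrmZ.
  rewrite [ltRHS](splitr e) ler_ltD //.
  apply: (le_trans (ler_wpM2l a0 (ltW k1))).
  by rewrite mulrCA ler_piMr ?(ltW e2) // ler_pdivrMr ?ltr_wpDl // mul1r lerDl.
exists ([seq (a * z.1, z.2) | z <- s] ++ t).
by rewrite !comb_cat !comb_scale; split; exact: bound.
Qed.

Lemma comb_limit_unique x y y' : comb_limit x y -> comb_limit x y' -> y = y'.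
Proof.
move=> xy xy'; have := comb_limit_nrm (comb_limitP (-1) xy xy').
rewrite !scaleN1r addNr nrm0 addrC => /esym/nrm0_eq0 /eqP.
by rewrite subr_eq0 => /eqP.
Qed.

End Extend.

Lemma total_isometric (T : Type) X Y (g : T -> X) (h : T -> Y) :
  (forall s, nrm (comb g s) = nrm (comb h s)) ->
  total_family g -> total_family h -> linearly_isometric X Y.
Proof.
move=> gh tg th.
have /choice[f hf] x : exists y, comb_limit g h x y by exact: comb_limit_exists.
have f_linear : linear f.
  move=> a x y; apply: (comb_limit_unique gh (hf _)); exact: comb_limitP.
exists (HB.pack_for {linear X -> Y} f (GRing.isLinear.Build K X Y _ f f_linear)).
  by move=> x; apply/nrm_eq_norm/esym; exact: (comb_limit_nrm gh (hf x)).
apply/seteqP; split=> // y _.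
have [x xy] : exists x, comb_limit h g y x.
  by apply: comb_limit_exists => // s; rewrite gh.
exists x => //=; apply: (comb_limit_unique gh (hf x)) => e /xy[s [h1 h2]].
by exists s.
Qed.

End Combinations.

Section Orthonormal.
Variables (R : realType) (k : scalar_kind).
Local Notation K := (scalars R k).
Variables (H : completeNormedModType K) (d : H -> H -> K).
Hypothesis dP : inner_product d.

Definition orthonormal_set (A : set H) :=
  (forall a, A a -> nrm a = 1) /\ (forall a b, A a -> A b -> a <> b -> d a b = 0).

Lemma ip_self_unit a : nrm a = 1 -> d a a = 1.
Proof. by move=> a1; rewrite (ip_nrm dP) a1 expr1n of_real1. Qed.

Lemma sqr_nrm_proj x a : nrm a = 1 ->
  nrm (x - d x a *: a) ^+ 2 = nrm x ^+ 2 - nrm (d x a) ^+ 2.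
Proof.
move=> a1; apply/eqP; rewrite eq_sym subr_eq eq_sym; apply/eqP.
apply: (can_inj (@of_realK R k)); rewrite of_realD -!(ip_nrm dP) -mul_conj_scalar.
rewrite !(ipDl dP) !(ipDr dP) !(ipNl dP) !(ipNr dP) !(ipZl dP) !(ipZr dP).
by rewrite (ip_self_unit a1) (ipC dP a x); ring.
Qed.

Lemma nrm_ip_le x a : nrm a = 1 -> nrm (d x a) <= nrm x.
Proof.
move=> a1; rewrite -ler_sqr ?nnegrE ?nrm_ge0 // -subr_ge0.
by rewrite -(sqr_nrm_proj x a1) sqr_ge0.
Qed.

Lemma maximal_orthonormal : exists A, orthonormal_set A /\
  forall z, (forall a, A a -> d z a = 0) -> z = 0.
Proof.
have [|A [[A1 A2] Amax]] := @Zorn_bigcup _ orthonormal_set.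
  move=> C CP Ctot; split=> [a [X CX Xa]|a b [X CX Xa] [Y CY Yb]].
    exact: (CP _ CX).1.
  have [XY|YX] := Ctot _ _ CX CY; first exact: ((CP _ CY).2 _ _ (XY _ Xa) Yb).
  exact: ((CP _ CX).2 _ _ Xa (YX _ Yb)).
exists A; split=> // z hz; apply: contrapT => z0.
have nz : 0 < nrm z.
  by rewrite lt_neqAle nrm_ge0 andbT eq_sym; apply/eqP => /nrm0_eq0.
pose w := of_real k (nrm z)^-1 *: z.
have w1 : nrm w = 1.
  by rewrite nrmZ nrm_of_real ger0_norm ?invr_ge0 ?nrm_ge0 // mulVf // gt_eqF.
have wA a : A a -> d w a = 0 by move=> Aa; rewrite (ipZl dP) hz // mulr0.
apply: (Amax (A `|` [set w])).
  split; first by move=> a Aa; left.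
  move=> /(_ w (or_intror erefl)) /wA; rewrite ip_self_unit // => /eqP.
  by rewrite oner_eq0.
split=> [a [/A1//|->//]|a b [Aa|->] [Ab|->] //].
- exact: A2.
- by move=> _; rewrite (ipC dP) wA // -(of_real0 R k) conj_of_real.
- by move=> _; rewrite wA.
Qed.

(* The error at the nearest point of the closed span of A is orthogonal to A. *)
Lemma orthonormal_total (A : set H) : orthonormal_set A ->
  (forall z, (forall a, A a -> d z a = 0) -> z = 0) ->
  total_family (fun a : A => val a).
Proof.
move=> [A1 A2] Amax x; pose cb := comb (fun a : A => val a).
pose S := [set nrm (x - cb s) ^+ 2 | s in [set: seq (K * A)]].
have S_inf : has_inf S.
  split; first by exists (nrm (x - cb [::]) ^+ 2), [::].
  by exists 0 => _ [s _ <-]; exact: sqr_ge0.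
have S_le s : inf S <= nrm (x - cb s) ^+ 2.
  by apply: ge_inf; [case: S_inf|exists s].
(* A minimizing sequence. With errors a quarter of (2^-n)^2, the parallelogram law at the midpoint
   of two approximants, itself a combination, bounds their distance by 2^-n. *)
have /choice[s hs] n : exists s, nrm (x - cb s) ^+ 2 <= inf S + (2^-1 ^+ n) ^+ 2 / 4.
  have e0 : 0 < (2^-1 ^+ n : R) ^+ 2 / 4 by rewrite divr_gt0 // exprn_gt0 // half_exp_gt0.
  by have [_ [s _ <-] /ltW h] := inf_adherent e0 S_inf; exists s.
have [c hc] : exists c, forall n, nrm (cb (s n) - c) <= 1 * 2^-1 ^+ n.
  apply: banach_fast_complete => n i ni; rewrite mul1r.
  have ee : (2^-1 ^+ i : R) ^+ 2 <= (2^-1 ^+ n) ^+ 2.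
    rewrite ler_sqr ?nnegrE ?(ltW (half_exp_gt0 _ _)) //.
    by apply: ler_wiXn2l => //; lra.
  rewrite -ler_sqr ?nnegrE ?nrm_ge0 ?(ltW (half_exp_gt0 _ _)) //.
  have hp := ip_parallelogram dP (x - cb (s i)) (x - cb (s n)).
  have e1 : x - cb (s i) - (x - cb (s n)) = cb (s n) - cb (s i).
    by rewrite opprB addrC addrA subrK.
  have e2 : x - cb (s i) + (x - cb (s n)) =
      of_real k 2 *: (x - cb [seq (of_real k 2^-1 * z.1, z.2) | z <- s i ++ s n]).
    rewrite /cb comb_scale comb_cat scalerBr -double_scale scalerA -of_realM mulfV ?pnatr_eq0 //.
    by rewrite of_real1 scale1r addrACA -opprD.
  rewrite e1 e2 nrmZ nrm_of_real ger0_norm // exprMn in hp.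
  have := S_le [seq (of_real k 2^-1 * z.1, z.2) | z <- s i ++ s n].
  move: (hs i) (hs n) hp ee.
  move: (nrm (x - cb (s i)) ^+ 2) (nrm (x - cb (s n)) ^+ 2) (nrm (cb _ - cb _) ^+ 2).
  move: (nrm (x - cb _) ^+ 2) (inf S) ((2^-1 ^+ n) ^+ 2) ((2^-1 ^+ i) ^+ 2).
  by move=> a b p q f g h; lra.
have z0 : x - c = 0.
  apply: Amax => a Aa; have a1 := A1 a Aa.
  apply: nrm0_eq0; apply/le_anti; rewrite nrm_ge0 andbT.
  apply/ler_addgt0Pr => e e0; rewrite add0r.
  have [N /(_ N (leqnn N)) hN] := half_exp_small 2 e0.
  apply: le_trans (ltW hN).
  (* Subtracting the component along a lowers the squared distance by the square of this
     coefficient, which cannot exceed the gap to the infimum. *)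
  have h1 : nrm (d (x - cb (s N)) a) <= 2^-1 ^+ N.
    rewrite -ler_sqr ?nnegrE ?nrm_ge0 ?(ltW (half_exp_gt0 _ _)) //.
    pose a' : A := exist _ a (mem_set Aa).
    have := S_le (s N ++ [:: (d (x - cb (s N)) a, a')]).
    rewrite {1}/cb comb_cat -/(cb (s N)) opprD addrA {1}/comb big_seq1 /= sqr_nrm_proj //.
    have := hs N; have := sqr_ge0 (2^-1 ^+ N : R).
    move: (nrm (x - cb (s N)) ^+ 2) (nrm (d _ _) ^+ 2) (inf S) ((2^-1 ^+ N) ^+ 2).
    by move=> p q f g; lra.
  rewrite (_ : x - c = (x - cb (s N)) + (cb (s N) - c)); last by rewrite addrA subrK.
  rewrite (ipDl dP) (le_trans (ler_nrmD _ _)) // mulr_natl mulr2n lerD //.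
  by apply: le_trans (nrm_ip_le _ a1) _; rewrite -[leRHS]mul1r.
move=> e e0; have [N /(_ N (leqnn N)) hN] := half_exp_small 1 e0.
exists (s N); apply: le_lt_trans hN.
by rewrite nrmBC (_ : x = c) //; apply/eqP; rewrite -subr_eq0 z0.
Qed.

(** The norm of a combination depends on the family only through its Gram matrix, so orthonormal
    families in bijection give combinations of equal norm. *)
Lemma sqr_nrm_comb (T : Type) (g : T -> H) s :
  of_real k (nrm (comb g s) ^+ 2) =
  \sum_(z <- s) \sum_(w <- s) z.1 * (conj_scalar w.1 * d (g z.2) (g w.2)).
Proof.
rewrite -(ip_nrm dP) /comb.
have suml (r : seq (K * T)) y :
    d (\sum_(z <- r) z.1 *: g z.2) y = \sum_(z <- r) z.1 * d (g z.2) y.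
  elim: r => [|z r IH]; first by rewrite !big_nil (ip0l dP).
  by rewrite !big_cons (ipP dP) IH.
have sumr (r : seq (K * T)) y :
    d y (\sum_(z <- r) z.1 *: g z.2) = \sum_(z <- r) conj_scalar z.1 * d y (g z.2).
  elim: r => [|z r IH]; last by rewrite !big_cons (ipDr dP) (ipZr dP) IH.
  by rewrite !big_nil (ipC dP) (ip0l dP) -(of_real0 R k) conj_of_real.
rewrite suml; apply: eq_bigr => z _.
by rewrite sumr mulr_sumr.
Qed.

End Orthonormal.

(** * Density characters *)

Section Density.
Variables (R : realType) (k : scalar_kind).
Local Notation K := (scalars R k).
Implicit Types X Y : completeNormedModType K.

Lemma dense_nrmP X (D : set X) :
  dense D <-> forall x (e : R), 0 < e -> exists2 y, D y & nrm (x - y) < e.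
Proof.
split=> [dD x e e0|h O [x Ox] Oo].
  have e0' : 0 < of_real k e by rewrite -(of_real0 R k) ltr_of_real.
  have [|y [/interior_subset]] := dD (interior (ball x (of_real k e))) _ (@open_interior _ _).
    exists x; apply: nbhsx_ballx => //.
  by rewrite -ball_normE /ball_ /= -nrmE ltr_of_real => hy Dy; exists y.
have /nbhs_ballP[e /= e0 eO] := open_nbhs_nbhs (conj Oo Ox).
have [y Dy hy] := h x _ (real_part_gt0 e0); exists y; split=> //; apply: eO.
by rewrite -ball_normE /ball_ /= -nrmE -(ge0_of_real (ltW e0)) ltr_of_real.
Qed.

(** The real case ignores the second component, so that one countable index type serves both
    fields. *)
Definition rat_scalar : rat * rat -> K :=
  match k return rat * rat -> scalars R k with
  | RealScalars => fun q => ratr q.1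
  | ComplexScalars => fun q => (ratr q.1 +i* ratr q.2)%C
  end.

Lemma rat_approx (a e : R) : 0 < e -> exists q : rat, `|a - ratr q| < e.
Proof.
move=> e0; have : a - e < a + e by lra.
move=> /rat_in_itvoo[q]; rewrite in_itv /= => /andP[h1 h2]; exists q.
by rewrite ltr_norml; move: h1 h2; move: (ratr q) => b; lra.
Qed.

Lemma rat_scalar_approx (a : K) (e : R) : 0 < e -> exists q, nrm (a - rat_scalar q) < e.
Proof.
rewrite /rat_scalar; case: k a => a e0.
  by have [q hq] := rat_approx a e0; exists (q, 0).
have e2 : 0 < e / 2 by rewrite divr_gt0.
have [p hp] := rat_approx (complex.Re (a : R[i])) e2.
have [q hq] := rat_approx (complex.Im (a : R[i])) e2.
exists (p, q); apply: le_lt_trans (nrm_complex_le _) _.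
by case: a hp hq => x y /= hp hq; rewrite [ltRHS]splitr ltrD.
Qed.

Lemma total_dense (T : Type) X (g : T -> X) : total_family g ->
  exists2 D : set X, dense D & (D #<= [set: seq ((rat * rat) * T)])%card.
Proof.
move=> tg; pose cb s := comb g [seq (rat_scalar z.1, z.2) | z <- s].
exists (range cb); last exact: card_image_le.
apply/dense_nrmP => x e e0; have e2 : 0 < e / 2 by rewrite divr_gt0.
have [s hs] := tg x _ e2.
suff [t ht] : exists t, nrm (comb g s - cb t) < e / 2.
  exists (cb t); first by exists t.
  rewrite (_ : x - cb t = (x - comb g s) + (comb g s - cb t)); last by rewrite addrA subrK.
  by rewrite (le_lt_trans (ler_nrmD _ _)) // [ltRHS]splitr ltrD.
elim: s (e / 2) e2 {hs} => [|[a i] s IH] r r0.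
  by exists [::]; rewrite /cb /= subrr nrm0.
have r2 : 0 < r / 2 by rewrite divr_gt0.
have [t ht] := IH _ r2.
have n0 := nrm_ge0 (g i); have r3 : 0 < r / 2 / (nrm (g i) + 1).
  by rewrite divr_gt0 // ltr_wpDl.
have [q hq] := rat_scalar_approx a r3.
exists ((q, i) :: t); rewrite /cb /comb /= !big_cons /= opprD addrACA -scalerBl.
rewrite (le_lt_trans (ler_nrmD _ _)) // [ltRHS]splitr ler_ltD //.
rewrite nrmZ mulrC; apply: (le_trans (ler_wpM2l n0 (ltW hq))).
by rewrite mulrCA ler_piMr ?(ltW r2) // ler_pdivrMr ?ltr_wpDl // mul1r lerDl.
Qed.

(** Balls of radius 1/2 about the points g t are disjoint, and D meets each of them. *)
Lemma dense_separated X (T : Type) (g : T -> X) (D : set X) :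
  (forall s t, s <> t -> 1 <= nrm (g s - g t)) -> dense D -> embeds T D.
Proof.
move=> sep /dense_nrmP dD.
have h0 : 0 < 2^-1 :> R by rewrite invr_gt0.
have /choice[f hf] t : exists y : D, nrm (g t - val y) < 2^-1.
  by have [y Dy hy] := dD (g t) _ h0; exists (exist _ y (mem_set Dy)).
exists f => s t e; apply: contrapT => st; have := sep _ _ st.
rewrite leNgt => /negP; apply.
rewrite (_ : g s - g t = (g s - val (f s)) + (val (f s) - g t)); last by rewrite addrA subrK.
rewrite (le_lt_trans (ler_nrmD _ _)) // [ltRHS](splitr 1) !mul1r ltrD //.
by rewrite e nrmBC.
Qed.

Lemma dense_isometric X Y (T : {linear X -> Y}) (D : set X) :
  isometric T -> range T = setT -> dense D -> dense (T @` D).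
Proof.
move=> Tiso Tonto /dense_nrmP dD; apply/dense_nrmP => y e e0.
have : range T y by rewrite Tonto.
case=> x _ <-; have [z Dz hz] := dD x e e0; exists (T z); first by exists z.
by rewrite -(raddfB T) ((nrm_eq_norm _ _).2 (Tiso _)).
Qed.

Lemma density_character_isometric X Y (kappa : Type) :
  linearly_isometric X Y -> density_character X kappa -> density_character Y kappa.
Proof.
have key X' Y' (D : set X') : linearly_isometric X' Y' -> dense D ->
    exists2 D' : set Y', dense D' & (D' #= D)%card.
  case=> T Tiso Tonto dD; exists (T @` D); first exact: dense_isometric.
  apply: inj_card_eq => x y _ _; apply: isometric_inj => z.
  exact/(nrm_eq_norm _ _).2/Tiso.
move=> XY [[D dD Dk] min]; split.
  have [D' dD' D'D] := key _ _ _ XY dD; exists D' => //.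
  exact: card_eq_trans D'D Dk.
move=> D' dD'; have [D2 dD2 D2D] := key _ _ _ (linearly_isometric_sym XY) dD'.
apply: card_le_trans (min _ dD2) _.
by move: D2D; rewrite card_eq_le => /andP[].
Qed.

Lemma density_character_unique X (kappa kappa' : Type) :
  density_character X kappa -> density_character X kappa' ->
  ([set: kappa] #= [set: kappa'])%card.
Proof.
move=> [[D dD Dk] min] [[D' dD' Dk'] min'].
rewrite card_eq_le; apply/andP; split.
  by apply: card_le_trans (min _ dD') _; move: Dk'; rewrite card_eq_le => /andP[].
by apply: card_le_trans (min' _ dD) _; move: Dk; rewrite card_eq_le => /andP[].
Qed.

End Density.

(** * The density character of a sum with a Hilbert space *)

Section Basis.
Variables (R : realType) (k : scalar_kind).
Local Notation K := (scalars R k).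
Variable E : nat -> completeNormedModType K.
Local Notation F := (l2sum E).
Hypothesis E_fd : forall n, finite_dimensional (E n).

Lemma nrm_l2prod_le (X Y : completeNormedModType K) (z : l2prod X Y) :
  nrm z <= nrm (z : X * Y).1 + nrm (z : X * Y).2.
Proof.
rewrite nrm_l2prod -ler_sqr ?nnegrE ?sqrtr_ge0 ?addr_ge0 ?nrm_ge0 //.
rewrite sqr_sqrtr ?addr_ge0 ?sqr_ge0 // sqrrD lerD2r lerDl.
by rewrite mulrn_wge0 // mulr_ge0 ?nrm_ge0.
Qed.

Lemma l2prod_total (H : completeNormedModType K) (S : Type) (g : S -> H) :
  total_family g ->
  exists G : (nat * nat) + S -> l2prod F H,
    (forall s, G (inr s) = ((0, g s) : F * H)) /\ total_family G.
Proof.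
move=> tg.
have [b hb] : exists b : forall n, seq (E n), forall n, is_basis (b n).
  exists (fun n => projT1 (cid (E_fd n))) => n.
  exact: (projT2 (cid (E_fd n))).
(* The default 0 of [nth] pads every basis with zero vectors, so all bases together are indexed by
   pairs of integers. *)
pose G (t : (nat * nat) + S) : l2prod F H :=
  match t with
  | inl p => (inj (nth 0 (b p.1) p.2), 0)
  | inr s => (0, g s)
  end.
exists G; split=> // y e e0.
have combD y1 y2 : (exists s, y1 = comb G s) -> (exists s, y2 = comb G s) ->
    exists s, y1 + y2 = comb G s.
  by move=> [s ->] [t ->]; exists (s ++ t); rewrite comb_cat.
have combZ a y1 : (exists s, y1 = comb G s) -> exists s, a *: y1 = comb G s.
  by move=> [s ->]; exists [seq (a * z.1, z.2) | z <- s]; rewrite comb_scale.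
have comb0 : exists s, 0 = comb G s by exists [::]; rewrite /comb big_nil.
have comb_inj n (x : E n) : exists s, ((inj x, 0) : l2prod F H) = comb G s.
  have [c ->] := (hb n).1 x.
  have -> : ((inj (\sum_i c i *: (b n)`_i), 0) : l2prod F H) =
      \sum_i c i *: (G (inl (n, val i))).
    elim/big_ind2: _ => [|x1 y1 x2 y2 <- <-|i _].
    - by rewrite raddf0.
    - by rewrite (raddfD (@inj _ _ E n)); congr pair; rewrite /= addr0.
    - by rewrite (linearZZ (@inj _ _ E n)); congr pair; rewrite /= scaler0.
  elim/big_ind: _ => [//|u v hu hv|i _]; first exact: (combD u v hu hv).
  by apply: combZ; exists [:: (1, inl (n, val i))]; rewrite comb1.
have comb_trunc N (x : F) : exists s, ((trunc N x, 0) : l2prod F H) = comb G s.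
  rewrite trunc_sum.
  have -> : ((\sum_(m < N) inj (coord m x), 0) : l2prod F H) =
      \sum_(m < N) ((inj (coord m x), 0) : l2prod F H).
    elim/big_ind2: _ => // x1 y1 x2 y2 <- <-.
    by congr pair; rewrite /= addr0.
  by elim/big_ind: _ => // u v hu hv; exact: (combD u v hu hv).
have comb_snd s : exists t, ((0, comb g s) : l2prod F H) = comb G t.
  elim: s => [|[a i] s [t ht]]; first by exists [::]; rewrite /comb !big_nil.
  exists ((a, inr i) :: t); rewrite /comb !big_cons -/(comb g s) -/(comb G t) -ht.
  by congr pair; rewrite /= scaler0 addr0.
have e2 : 0 < e / 2 by rewrite divr_gt0.
have [N hN] := trunc_approx (y : F * H).1 e2.
have [s hs] := tg (y : F * H).2 _ e2.
have [t ht] := combD _ _ (comb_trunc N (y : F * H).1) (comb_snd s).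
exists t; rewrite -ht (le_lt_trans (nrm_l2prod_le _)) //= addr0 add0r.
by rewrite [ltRHS]splitr ltrD.
Qed.

Section DensityBasis.
Variables (H : completeNormedModType K) (d : H -> H -> K) (A : set H).
Hypotheses (dP : inner_product d) (A_on : orthonormal_set d A)
  (A_max : forall z, (forall a, A a -> d z a = 0) -> z = 0).

Lemma orthonormal_separated (s t : A) : s <> t -> 1 <= nrm (val s - val t).
Proof.
move=> st; have As := set_mem (valP s); have At := set_mem (valP t).
have st' : val s <> val t by move/val_inj.
have e : nrm (val s - val t) ^+ 2 = 2.
  apply: (can_inj (@of_realK R k)); rewrite -(ip_nrm dP).
  rewrite (ipDl dP) !(ipDr dP) !(ipNl dP) !(ipNr dP) opprK.
  rewrite (A_on.2 _ _ As At st') (A_on.2 _ _ At As (nesym st')).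
  rewrite !(ip_self_unit dP (A_on.1 _ _)) // oppr0 addr0 add0r.
  by rewrite -(of_real1 R k) -of_realD.
rewrite -ler_sqr ?nnegrE ?nrm_ge0 // e expr1n; lra.
Qed.

(** A is infinite, since otherwise rational combinations would form a countable dense set. They then
    number at most A by [embeds_seq], while a dense set is at least as large as A because distinct
    elements of A are at distance at least 1. *)
Lemma density_basis :
  (forall D : set (l2prod F H), dense D -> ~ countable D) ->
  density_character (l2prod F H) A.
Proof.
move=> nsep.
have [G [Gr Gt]] := l2prod_total (orthonormal_total dP A_on A_max).
have [D dD DT] := total_dense Gt.
have NA : embeds nat A.
  apply: contrapT => nA; apply: (nsep D dD).
  have /finite_set_countable/card_leE hA : finite_set A.
    by apply: contrapT => /infiniteP/card_leE[f hf]; apply: nA;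
      exact: (embeds_trans (embeds_setT nat).2 (ex_intro _ f hf)).
  have [An _] := embeds_setT nat; have {}hA := embeds_trans hA An.
  apply: card_le_trans DT _; apply/card_leTE.
  have c1 : embeds ((rat * rat) * ((nat * nat) + A)) nat.
    apply: embeds_trans (embeds_count ((rat * rat) * ((nat * nat) + nat))%type).
    apply: embeds_prod; first by exists id.
    by case: hA => f hf; exists (fun x => match x with inl p => inl p | inr a => inr (f a) end);
      move=> [p|a] [q|b] // []; [move=> ->|move=> /hf ->].
  case: c1 => f hf; apply: embeds_trans (embeds_count (seq nat)).
  by exists (map f); exact: inj_map.
have sep (D' : set (l2prod F H)) : dense D' -> (A #<= D')%card.
  move=> dD'; apply/card_leE; apply: (dense_separated (g := fun a : A => G (inr a)) _ dD')
    => s t st.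
  rewrite !Gr nrm_l2prod /= subrr nrm0 expr0n add0r sqrtr_sqr ger0_norm ?nrm_ge0 //.
  exact: orthonormal_separated.
have DA : (D #<= A)%card.
  apply: card_le_trans DT _; apply/card_leE; apply: embeds_trans (embeds_setT _).1 _.
  have N2 : embeds (nat * nat) A.
    exact: embeds_trans (embeds_count (nat * nat)%type) NA.
  have Q2 : embeds (rat * rat) A by exact: embeds_trans (embeds_count (rat * rat)%type) NA.
  have e1 := embeds_sum NA N2.
  have [f hf] := embeds_trans (embeds_prod Q2 e1) (embeds_square NA).
  apply: embeds_trans (embeds_seq NA).
  by exists (map f); exact: inj_map.
split; last first.
  by move=> D' dD'; apply: card_le_trans (sep _ dD');
    move: (card_setT A); rewrite card_eq_le => /andP[].
exists D => //; apply: card_eq_trans (card_setT_sym A).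
by rewrite card_eq_le DA sep.
Qed.

End DensityBasis.

Lemma hilbert_isometric (H1 H2 : completeNormedModType K) d1 d2
  (A1 : set H1) (A2 : set H2) :
  inner_product d1 -> orthonormal_set d1 A1 ->
  (forall z, (forall a, A1 a -> d1 z a = 0) -> z = 0) ->
  inner_product d2 -> orthonormal_set d2 A2 ->
  (forall z, (forall a, A2 a -> d2 z a = 0) -> z = 0) ->
  (A1 #= A2)%card -> linearly_isometric H1 H2.
Proof.
move=> d1P on1 max1 d2P on2 max2 /card_eqP/bijPex[f [_ finj fsurj]].
have t1 := orthonormal_total d1P on1 max1; have t2 := orthonormal_total d2P on2 max2.
have f_inj : injective f by move=> s t; apply: finj; rewrite inE.
apply: (@total_isometric _ _ _ _ _ (fun s : A1 => val s) (fun s : A1 => val (f s))) => //.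
  move=> s; apply/eqP; rewrite -(eqrXn2 (n := 2)) ?nrm_ge0 //; apply/eqP.
  apply: (can_inj (@of_realK R k)); rewrite (sqr_nrm_comb d1P) (sqr_nrm_comb d2P).
  apply: eq_bigr => z _; apply: eq_bigr => w _; congr (_ * (_ * _)).
  have m1 (a : A1) : A1 (val a) := set_mem (valP a).
  have m2 (a : A2) : A2 (val a) := set_mem (valP a).
  have [->|ne] := pselect (z.2 = w.2).
    by rewrite (ip_self_unit d1P (on1.1 _ (m1 _))) (ip_self_unit d2P (on2.1 _ (m2 _))).
  rewrite (on1.2 _ _ (m1 _) (m1 _)); last by move/val_inj.
  by rewrite (on2.2 _ _ (m2 _) (m2 _)) // => /val_inj/f_inj.
move=> x e e0; have [s hs] := t2 x e e0.
have /choice[h fh] t : exists u, f u = t by have [u _ <-] := fsurj t I; exists u.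
exists [seq (z.1, h z.2) | z <- s]; rewrite /comb big_map.
by under eq_bigr do rewrite /= fh.
Qed.

Lemma l2prod_isometric (X H1 H2 : completeNormedModType K) :
  linearly_isometric H1 H2 -> linearly_isometric (l2prod X H1) (l2prod X H2).
Proof.
case=> T Tiso Tonto.
pose S (z : l2prod X H1) : l2prod X H2 := ((z : X * H1).1, T (z : X * H1).2).
have S_linear : linear S.
  by move=> a x y; congr pair; rewrite /= linearP.
exists (HB.pack_for {linear l2prod X H1 -> l2prod X H2} S
  (GRing.isLinear.Build K (l2prod X H1) (l2prod X H2) _ S S_linear)).
  by move=> z; apply/nrm_eq_norm; rewrite !nrm_l2prod /= ((nrm_eq_norm _ _).2 (Tiso _)).
apply/seteqP; split=> // -[x h] _; have : range T h by rewrite Tonto.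
by case=> h' _ <-; exists (x, h').
Qed.

End Basis.

(** * Exponents *)

Section Exponents.
Variable R : realType.
Implicit Types a b p q s t u v : R.

(** Young's inequality for u and 1 with exponent q and its conjugate, multiplied by q. *)
Lemma bernoulli_powR u q : 0 <= u -> 1 < q -> 1 + q * (u - 1) <= u `^ q.
Proof.
move=> u0 q1; have q0 : 0 < q by rewrite (lt_trans ltr01).
have qn : q != 0 by rewrite gt_eqF.
pose q' := q / (q - 1).
have q'0 : 0 < q' by rewrite divr_gt0 // subr_gt0.
have qq' : q^-1 + q'^-1 = 1.
  by rewrite /q' invf_div mulrBl mulfV // mul1r addrC subrK.
have := conjugate_powR u0 ler01 q0 q'0 qq'.
rewrite mulr1 powR1 div1r => h.
have := ler_wpM2l (ltW q0) h.
rewrite mulrDr mulrCA mulfV // mulr1 -[q'^-1](addKr q^-1) qq' mulrDr mulr1 mulrN mulfV //.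
move: (u `^ q) => w; lra.
Qed.

(** Convexity of the power: divide by the mean of s and t, so that u + v = 2, and add the tangent
    inequalities at 1. *)
Lemma powR_add_le q s t : 1 < q -> 0 <= s -> 0 <= t ->
  (s + t) `^ q <= 2 `^ (q - 1) * (s `^ q + t `^ q).
Proof.
move=> q1 s0 t0; have q0 : 0 < q by rewrite (lt_trans ltr01).
have [st|st] := eqVneq (s + t) 0.
  by rewrite st powR0 ?gt_eqF // mulr_ge0 ?addr_ge0 ?powR_ge0.
have [m [u [v [m0 [u0 v0] [es et uv]]]]] : exists m u v,
    [/\ 0 < m, 0 <= u /\ 0 <= v & [/\ s = m * u, t = m * v & u + v = 2]].
  pose m := (s + t) / 2.
  have m0 : 0 < m by rewrite divr_gt0 // lt_neqAle eq_sym st addr_ge0.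
  have mm : m != 0 by rewrite gt_eqF.
  exists m, (s / m), (t / m); split=> //.
    by split; exact: divr_ge0 (ltW m0).
  split; [by rewrite mulrC divfK|by rewrite mulrC divfK|].
  by rewrite -mulrDl /m invf_div mulrCA mulfV // mulr1.
have -> : s + t = 2 * m by rewrite es et -mulrDr uv mulrC.
have hu := bernoulli_powR u0 q1; have hv := bernoulli_powR v0 q1.
rewrite es et !powRM ?(ltW m0) //.
have <- : 2 `^ (q - 1) * 2 = 2 `^ q :> R by rewrite mulrC mulr_powRB1.
rewrite -mulrDr -mulrA ler_wpM2l ?powR_ge0 // mulrC ler_wpM2l ?powR_ge0 //.
apply: (le_trans _ (lerD hu hv)).
have -> : 1 + q * (u - 1) + (1 + q * (v - 1)) = 2 + q * (u + v - 2) by ring.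
by rewrite uv subrr mulr0 addr0.
Qed.

Lemma powR_div2 a p : 0 <= a -> 0 < p -> (a `^ p) `^ (2 / p) = a ^+ 2.
Proof.
by move=> a0 p0; rewrite -powRrM mulrCA mulfV ?gt_eqF // mulr1 powR_mulrn.
Qed.

(* Condition (a) gives the parallelogram law up to this factor, and l_p-pairs
   attain it. *)
Definition exponent_defect p : R := 2 `^ (2 / p - 1).

Lemma exponent_defect_gt1 p : 1 <= p < 2 -> 1 < exponent_defect p.
Proof.
move=> /andP[p1 p2]; have p0 : 0 < p by rewrite (lt_le_trans ltr01).
rewrite /exponent_defect /powR pnatr_eq0 /= expR_gt1 mulr_gt0 //; last first.
  by rewrite ln_gt0 // ltr1n.
by rewrite subr_gt0 ltr_pdivlMr // mul1r.
Qed.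

Lemma exponent_defectE p : exponent_defect p * 2 = 2 `^ (2 / p).
Proof.
rewrite /exponent_defect mulrC -[X in X * _](powRr1 (ler0n R 2)) -powRD ?pnatr_eq0 ?implybT //.
by rewrite addrC subrK.
Qed.

Lemma exponent_defect_cvg (p : nat -> R) : p n @[n --> \oo] --> (2 : R) ->
  exponent_defect (p n) @[n --> \oo] --> (1 : R).
Proof.
move=> p2; have P := @eventually_filter.
have h : (2 / p n - 1) * ln 2 @[n --> \oo] --> (0 : R).
  have h1 : (p n)^-1 @[n --> \oo] --> (2^-1 : R) by apply: cvgV; rewrite ?pnatr_eq0.
  have h2 := cvg_realB P (cvg_realZ P (c := 2) h1) (cvg_real_cst P (a := 1)).
  rewrite mulfV ?pnatr_eq0 // subrr in h2.
  have := cvg_realZ P (c := ln 2) h2; rewrite mulr0.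
  by apply: eq_cvg_real => n; rewrite mulrC.
rewrite -expR0.
apply: (@eq_cvg_real _ _ _ (fun n => expR ((2 / p n - 1) * ln 2))).
  by move=> n; rewrite /exponent_defect /powR pnatr_eq0.
by apply: continuous_cvg h; exact: continuous_expR.
Qed.

Lemma powR_one_add p t : 1 <= p -> 0 <= t -> 1 + t `^ p <= (1 + t) `^ p.
Proof.
move=> p1 t0; have p0 : 0 < p by rewrite (lt_le_trans ltr01).
have t1 : 0 <= 1 + t by rewrite addr_ge0.
rewrite -(mulr_powRB1 t0 p0) -(mulr_powRB1 t1 p0) mulrDl mul1r lerD //.
  have := @ler_powR _ (1 + t) _ 0 (p - 1); rewrite powRr0; apply; last by rewrite subr_ge0.
  by rewrite lerDl.
rewrite ler_wpM2l // ge0_ler_powR ?nnegrE ?subr_ge0 //.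
by rewrite lerDr.
Qed.

Variable k : scalar_kind.
Local Notation K := (scalars R k).

Lemma lp_pair_defect p (X : normedModType K) (x y : X) : 1 <= p ->
  lp_pair p x y -> [/\ nrm x <= 1, nrm y <= 1 &
    4 * exponent_defect p <= nrm (x + y) ^+ 2 + nrm (x - y) ^+ 2].
Proof.
move=> p1 xy; have p0 : 0 < p by rewrite (lt_le_trans ltr01).
have x1 : nrm x <= 1.
  have := xy 0; rewrite of_real0 scale0r addr0 normr0 powR0 ?gt_eqF // addr0.
  move=> /(congr1 (fun a => a `^ (2 / p))); rewrite powR_div2 ?nrm_ge0 // powR1.
  by move=> e; rewrite -ler_sqr ?nnegrE ?nrm_ge0 // e expr1n.
(* The pair identity bounds the norm of x + t y by 1 + t; letting t grow will give nrm y <= 1. *)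
have ty t : 0 <= t -> t * nrm y <= 2 + t.
  move=> t0; have h : nrm (x + of_real k t *: y) <= 1 + t.
    rewrite leNgt; apply/negP => h.
    have := gt0_ltr_powR p0 (_ : 1 + t \in Num.nneg) (_ : nrm _ \in Num.nneg) h.
    rewrite !nnegrE nrm_ge0 addr_ge0 // => /(_ isT isT).
    by rewrite xy ger0_norm // ltNge powR_one_add.
  have := ler_nrmD (x + of_real k t *: y) (- x).
  rewrite addrAC subrr add0r nrmZ nrm_of_real ger0_norm // nrmN.
  move: h x1; move: (t * nrm y) => a; lra.
split=> //.
  rewrite leNgt; apply/negP => y1; have y0 : 0 < nrm y - 1 by rewrite subr_gt0.
  (* At this t the bound [ty] reads 3 <= 2. *)
  have := ty (3 / (nrm y - 1)); rewrite divr_ge0 ?(ltW y0) // => /(_ isT).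
  rewrite -lerBlDr -[X in _ - X]mulr1 -mulrBr divfK ?gt_eqF //; lra.
have h t : `|t| = 1 -> nrm (x + of_real k t *: y) ^+ 2 = 2 * exponent_defect p.
  move=> t1; rewrite -(powR_div2 (nrm_ge0 _) p0) xy t1 powR1 [RHS]mulrC exponent_defectE.
  by [].
have := h 1 (normr1 R); have := h (-1) (normrN1 R).
have -> : of_real k (-1) = -1 :> K.
  by apply/eqP; rewrite -subr_eq0 opprK -(of_real1 R k) -of_realD addNr of_real0.
rewrite of_real1 scale1r scaleN1r => -> ->; lra.
Qed.

Lemma exponent_par p (X : normedModType K) (x y : X) : 1 <= p < 2 ->
  nrm (x + y) ^+ 2 + nrm (x - y) ^+ 2 <=
    2 * (nrm x `^ p + nrm y `^ p) `^ (2 / p) ->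
  nrm (x + y) ^+ 2 + nrm (x - y) ^+ 2 <=
    2 * exponent_defect p * (nrm x ^+ 2 + nrm y ^+ 2).
Proof.
move=> /andP[p1 p2] /le_trans; apply; have p0 : 0 < p by rewrite (lt_le_trans ltr01).
rewrite -mulrA ler_pM2l // -(powR_div2 (nrm_ge0 x) p0) -(powR_div2 (nrm_ge0 y) p0).
by apply: powR_add_le; rewrite ?powR_ge0 // ltr_pdivlMr // mul1r.
Qed.

End Exponents.

(** * Infinite dimension and nonseparability *)

Section Infinite.
Variables (R : realType) (k : scalar_kind).
Local Notation K := (scalars R k).
Variable E : nat -> completeNormedModType K.
Local Notation F := (l2sum E).
Hypothesis E_nonzero : forall n, exists x : E n, x != 0.

Lemma unit_vector n : exists x : E n, nrm x = 1.
Proof.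
have [x x0] := E_nonzero n; exists (of_real k (nrm x)^-1 *: x).
rewrite nrmZ nrm_of_real ger0_norm ?invr_ge0 ?nrm_ge0 // mulVf //.
by apply: contra_neq x0; exact: nrm0_eq0.
Qed.

Lemma unit_vectors : exists e : forall n, E n, forall n, nrm (e n) = 1.
Proof.
by exists (fun n => projT1 (cid (unit_vector n))) => n; exact: (projT2 (cid (unit_vector n))).
Qed.

(** Unit vectors on distinct coordinates are at distance at least 1, so they cannot converge along a
    nonprincipal ultrafilter, as bounded families do in finite dimension. *)
Lemma l2sum_infinite_dimensional : ~ finite_dimensional F.
Proof.
move=> [b hb]; have [e e1] := unit_vectors.
have [U UU hU] := nonprincipal_ultrafilter; have UP := @ultra_proper _ _ UU.
have [i|x hx] := basis_ultra_cvg hb UU (u := fun i => inj (e i)) (C := 1).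
  by rewrite nrm_inj e1.
have h2 : 0 < 2^-1 :> R by rewrite invr_gt0.
have {}hx : U [set i | nrm (inj (e i) - x) < 2^-1].
  have /(@cvgrPdist_lt _ _ _ U)/(_ _ h2) := hx.
  by apply: filterS => j /=; rewrite sub0r normrN ger0_norm ?nrm_ge0.
have [i /= hi] := @filter_ex _ U UP _ hx.
have [j [/= hj ij]] := @filter_ex _ U UP _ (filterI hx (hU i.+1)).
have := nrm_coord_le i (inj (e i) - inj (e j)).
rewrite raddfB /= coord_inj coord_inj_neq ?ltn_eqF // subr0 e1.
apply/negP; rewrite -ltNge.
rewrite (_ : inj (e i) - inj (e j) = (inj (e i) - x) + (x - inj (e j))); last first.
  by rewrite addrA subrK.
by rewrite (le_lt_trans (ler_nrmD _ _)) // [ltRHS](splitr 1) !mul1r ltrD // nrmBC.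
Qed.

Lemma coord_eventually_small (y : F) (r : R) : 0 < r ->
  exists N, forall m, (N <= m)%N -> nrm (coord m y) < r.
Proof.
move=> r0; have [N hN] := trunc_approx y r0; exists N => m Nm.
apply: le_lt_trans hN; have := nrm_coord_le m (y - trunc N y).
by rewrite raddfB /= coord_trunc ltnNge Nm subr0.
Qed.

(* Diagonal argument: the i-th term of the new family is a unit vector
   supported far away from the first i terms of the i-th representatives. *)
Lemma ultrapower_nonseparable (U : set_system nat) (UU : UltraFilter U) :
  (forall n, U [set i | (n <= i)%N]) ->
  forall D : set (ultrapower UU F), dense D -> ~ countable D.
Proof.
move=> hU D dD /card_leE[f hf]; have UP := @ultra_proper _ _ UU.
have [e e1] := unit_vectors.
have h2 : 0 < 2^-1 :> R by rewrite invr_gt0.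
(* The family x n represents the point of D with code n, and is 0 when n codes no point. *)
have /choice[x hx] n : exists x : linf nat F,
    forall d : D, val (f d) = n -> val d = uclass UU x.
  have [[d dn]|nd] := pselect (exists d : D, val (f d) = n).
    have [x xd] := uclass_surj (val d); exists x => d' d'n.
    by rewrite xd; congr val; apply/hf/val_inj; rewrite dn.
  by exists 0 => d dn; case: nd; exists d.
have /choice[m hm] i : exists m, forall n, (n <= i)%N ->
    nrm (coord m (linf_val (x n) i)) < 2^-1.
  suff key j : exists N, forall m, (N <= m)%N -> forall n, (n < j)%N ->
      nrm (coord m (linf_val (x n) i)) < 2^-1.
    by have [N hN] := key i.+1; exists N => n ni; exact: hN.
  elim: j => [|j [N hN]]; first by exists 0.
  have [N' hN'] := coord_eventually_small (linf_val (x j) i) h2.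
  exists (maxn N N') => l; rewrite geq_max => /andP[Nl N'l] n.
  by rewrite ltnS leq_eqVlt => /predU1P[->|]; [exact: hN'|exact: hN].
have wb : exists C, forall i, nrm (inj (e (m i)) : F) <= C.
  by exists 1 => i; rewrite nrm_inj e1.
have [_ /dense_nrmP dD'] := conj dD dD.
have [q Dq hq] := dD' (uclass UU (bfamily wb)) _ h2.
pose d : D := exist _ q (mem_set Dq); pose n := val (f d).
have qn : q = uclass UU (x n) by rewrite -(hx n d).
move: hq; rewrite qn -uclassB; apply/negP; rewrite -leNgt.
(* For i >= n the two families differ by at least 1/2 in the coordinate m i, where one is a unit
   vector and the other is smaller than 1/2. *)
apply: (ge_cvg_cst UP (@nrm_uclass _ _ _ _ UU _ _)).
apply: filterS (hU n) => i /= ni.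
apply: le_trans (nrm_coord_le (m i) _); rewrite raddfB /= coord_inj.
have h := hm i n ni; have h' := ler_nrmD (e (m i) - coord (m i) (linf_val (x n) i))
  (coord (m i) (linf_val (x n) i)).
rewrite subrK e1 in h'; move: h h'.
by move: (nrm (e (m i) - _)) (nrm (coord _ _)) => a b; lra.
Qed.

End Infinite.

(** * Categoricity *)

Section Categorical.
Variables (R : realType) (k : scalar_kind).
Local Notation K := (scalars R k).
Variable E : nat -> completeNormedModType K.
Local Notation F := (l2sum E).
Hypothesis E_fd : forall n, finite_dimensional (E n).

Lemma nonseparable_isometric (X Y : completeNormedModType K) :
  linearly_isometric X Y -> (forall D : set X, dense D -> ~ countable D) ->
  forall D : set Y, dense D -> ~ countable D.
Proof.
move=> /linearly_isometric_sym[T Tiso Tonto] nsep D dD cD.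
apply: (nsep _ (dense_isometric Tiso Tonto dD)).
exact: card_le_trans (card_image_le _ _) cD.
Qed.

Lemma density_character_nonseparable (X : completeNormedModType K) (kappa : Type) :
  ~ countable [set: kappa] -> density_character X kappa ->
  forall D : set X, dense D -> ~ countable D.
Proof.
by move=> kc [_ min] D /min kD cD; apply: kc; exact: card_le_trans kD cD.
Qed.

Lemma hilbert_extension_basis (M : completeNormedModType K)
  (io : {linear F -> M}) (pr : {linear M -> F}) :
  hilbert_extension io pr -> (forall D : set M, dense D -> ~ countable D) ->
  exists (H : completeNormedModType K) (d : H -> H -> K) (A : set H),
    [/\ inner_product d, orthonormal_set d A,
        forall z, (forall a, A a -> d z a = 0) -> z = 0,
        linearly_isometric M (l2prod F H) & density_character M A].
Proof.
move=> ext nsep; have [H /hilbert_inner_product[d dP] iso] := hilbert_extension_split ext.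
have [A [Aon Amax]] := maximal_orthonormal dP.
exists H, d, A; split=> //; apply: density_character_isometric (linearly_isometric_sym iso) _.
by apply: (density_basis E_fd dP) => //; exact: nonseparable_isometric iso nsep.
Qed.

End Categorical.

Theorem proposition5p6 (R : realType) (k : scalar_kind)
    (E : nat -> completeNormedModType (scalars R k))
    (p : nat -> R)
    (E_finite_dimensional : forall n, finite_dimensional (E n))
    (E_nonzero : forall n, exists x : E n, x != 0)
    (p_range : forall n, 1 <= p n < 2)
    (p_to_2 : p n @[n --> \oo] --> (2 : R))
    (condition_a : forall n (x y : E n),
      nrm (x + y) ^+ 2 + nrm (x - y) ^+ 2 <=
        2 * (nrm x `^ p n + nrm y `^ p n) `^ (2 / p n))
    (condition_b : forall n, exists2 B : seq (E n), is_basis B &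
      forall y, y \in B -> exists2 x, x \in B & lp_pair (p n) x y) :
  [/\ forall (I : Type) (U : set_system I) (UU : UltraFilter U),
        exists2 H : completeNormedModType (scalars R k), hilbert H &
          linearly_isometric (ultrapower UU (l2sum E)) (l2prod (l2sum E) H),
      forall (H : completeNormedModType (scalars R k))
        (T : {linear l2sum E -> l2prod (l2sum E) H}),
        hilbert H -> isometric T -> range T = range (l2inl (l2sum E) H)
    & uncountably_categorical (l2sum E)].
Proof.
(* The exponents and both conditions enter the rest of the argument only through these constants. *)
pose c n := exponent_defect (p n).
have c_gt1 n : 1 < c n by exact: exponent_defect_gt1.
have c_cvg : c n @[n --> \oo] --> (1 : R) by exact: exponent_defect_cvg.
have c_par n (x y : E n) :
    nrm (x + y) ^+ 2 + nrm (x - y) ^+ 2 <= 2 * c n * (nrm x ^+ 2 + nrm y ^+ 2).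
  exact: (exponent_par (p_range n) (condition_a n x y)).
have c_pair n : exists2 B : seq (E n), is_basis B &
    forall y, y \in B -> exists x : E n, [/\ nrm x <= 1, nrm y <= 1 &
      4 * c n <= nrm (x + y) ^+ 2 + nrm (x - y) ^+ 2].
  have [B hB pB] := condition_b n; exists B => // y /pB[x _ xy]; exists x.
  by apply: lp_pair_defect => //; case/andP: (p_range n).
have E_fd := E_finite_dimensional.
have ultra_ext I (U : set_system I) (UU : UltraFilter U) :
    exists (io : {linear l2sum E -> ultrapower UU (l2sum E)})
      (pr : {linear ultrapower UU (l2sum E) -> l2sum E}), hilbert_extension io pr.
  have [io [pr [ext _]]] := self_extension (l2sum E).
  have [io' [pr' [ext' _]]] := ultrapower_extension E_fd UU c_cvg c_par ext.
  by exists io', pr'.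
split.
- move=> I U UU; have [io [pr ext]] := ultra_ext I U UU.
  exact: hilbert_extension_split ext.
- move=> H T H_hilbert Tiso.
  have [io [pr [ext ioE]]] := l2prod_extension (l2sum E) H_hilbert.
  have Tnrm x : nrm (T x) = nrm x by exact/nrm_eq_norm/Tiso.
  by rewrite (rigidity E_fd c_gt1 c_cvg c_par c_pair ext Tnrm) (funext ioE).
split; first exact: l2sum_infinite_dimensional.
(* The cardinal kappa is the density character of a nonseparable ultrapower, realized by an
   orthonormal basis of its Hilbert summand. *)
have [U UU hU] := nonprincipal_ultrafilter.
have [io [pr ext]] := ultra_ext nat U UU.
have nsep := @ultrapower_nonseparable _ _ _ E_nonzero _ UU hU.
have [H [d [A [_ _ _ _ dens]]]] := hilbert_extension_basis E_fd ext nsep.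
have A_unc : ~ countable [set: A].
  move=> Ac; have [[D dD DA] _] := dens; apply: (nsep D dD).
  by move: DA; rewrite card_eq_le => /andP[DA _]; exact: card_le_trans DA Ac.
exists A; split=> //.
  exists (ultrapower UU (l2sum E)); split=> //.
  exact: elementarily_equivalent_ultrapower.
move=> Y Z EY Yd EZ Zd.
have [ioY [prY extY]] := elementary_extension E_fd c_gt1 c_cvg c_par c_pair EY.
have [ioZ [prZ extZ]] := elementary_extension E_fd c_gt1 c_cvg c_par c_pair EZ.
have [HY [dY [AY [dYP onY maxY isoY densY]]]] :=
  hilbert_extension_basis E_fd extY (density_character_nonseparable A_unc Yd).
have [HZ [dZ [AZ [dZP onZ maxZ isoZ densZ]]]] :=
  hilbert_extension_basis E_fd extZ (density_character_nonseparable A_unc Zd).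
(* Both bases have the cardinality of the common density character, so the Hilbert summands of Y and
   Z are isometric. *)
have AYZ : (AY #= AZ)%card.
  have h1 := density_character_unique densY Yd.
  have h2 := density_character_unique Zd densZ.
  apply: card_eq_trans (card_setT_sym AY) _; apply: card_eq_trans (card_setT AZ).
  exact: card_eq_trans h1 h2.
apply: linearly_isometric_trans isoY _.
apply: linearly_isometric_trans (linearly_isometric_sym isoZ).
exact/l2prod_isometric/(hilbert_isometric dYP onY maxY dZP onZ maxZ).
Qed.
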